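(* Let $n\ge1$ and let $\Omega\subset\mathbb R^{n+1}$ be a domain with nonempty $C^2$ boundary. Then $$-\Delta\delta(x)\ \ge\ \frac{nH(N(x))}{n-\delta(x)H(N(x))}$$ in the distribution sense on $\Omega$: for every $\varphi\in C_0^\infty(\Omega)$ with $\varphi\ge0$, $$\int_\Omega\nabla\delta\cdot\nabla\varphi\,dx\ \ge\ \int_\Omega\frac{nH(N(x))}{n-\delta(x)H(N(x))}\,\varphi(x)\,dx ,$$ where, for $x\in G$, $N(x)\in\partial\Omega$ is the unique nearest boundary point to $x$ and $H(N(x))$ is the mean curvature of $\partial\Omega$ there.
   Context: A domain is an open connected subset of Euclidean space; its boundary is $C^2$ if near each boundary point the domain is, after a rotation, the region on one side of the graph of a $C^2$ function. $\delta(x)=\inf_{y\in\mathbb R^{n+1}\setminus\Omega}|x-y|$ (a Lipschitz function, so $\nabla\delta$ exists a.e.). For $y\in\partial\Omega$, $\kappa_1(y),\dots,\kappa_n(y)$ are the principal curvatures of $\partial\Omega$ at $y$ with respect to the outward unit normal, with the sign convention that they all equal $1$ when $\Omega$ is the unit ball, and $H(y)=\sum_{i=1}^n\kappa_i(y)$ is the mean curvature (so the unit sphere has $H=n$). The good set $G\subset\Omega$ is the largest open subset of $\Omega$ such that every $x\in G$ has a unique nearest point $N(x)$ on $\partial\Omega$; $S=\Omega\setminus G$ has Lebesgue measure zero, so the integrand on the right is defined almost everywhere (on $G$ one has $n-\delta(x)H(N(x))>0$). *)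

(* Defs.v *)
From HB Require Import structures.
From mathcomp Require Export all_boot all_order all_algebra.
From mathcomp Require Export all_classical all_reals all_analysis.
Export numFieldNormedType.Exports.
Export Order.TTheory GRing.Theory Num.Theory.

Set Implicit Arguments.
Unset Strict Implicit.
Unset Printing Implicit Defensive.
Set Warnings "-redundant-canonical-projection".

Local Open Scope classical_set_scope.
Local Open Scope ring_scope.

Section row_measurable.
Context {d} {T : measurableType d} (n : nat).

Let coord (i : 'I_n) (v : 'rV[T]_n) : T := v ord0 i.

Let row_set0 : g_sigma_preimage coord set0.
Proof. exact: sigma_algebra0. Qed.

Let row_setC A : g_sigma_preimage coord A -> g_sigma_preimage coord (~` A).
Proof. exact: sigma_algebraC. Qed.

Let row_bigcup (F : _^nat) : (forall i, g_sigma_preimage coord (F i)) ->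
  g_sigma_preimage coord (\bigcup_i (F i)).
Proof. exact: sigma_algebra_bigcup. Qed.

HB.instance Definition _ := @isMeasurable.Build (measure_tuple_display d)
  'rV[T]_n (g_sigma_preimage coord) row_set0 row_setC row_bigcup.

Lemma measurable_row_coord (i : 'I_n) :
  measurable_fun setT (fun v : 'rV[T]_n => v ord0 i : T).
Proof.
move=> _ Y mY; rewrite setTI; apply: sub_sigma_algebra => /=.
rewrite -bigcup_seq/=; exists i => /=; first by rewrite mem_index_enum.
by exists Y => //; rewrite setTI.
Qed.

Lemma measurable_fun_row d1 (T1 : measurableType d1) (f : T1 -> 'rV[T]_n) :
  (forall i, measurable_fun setT (fun x => f x ord0 i : T)) ->
  measurable_fun setT f.
Proof.
move=> mf; apply: (@measurability _ _ _ _ _ _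
  (\big[setU/set0]_(i < n) preimage_set_system setT (coord i) measurable)) => //.
move=> _ [A + <-]; rewrite -bigcup_seq/= => -[i _ [B mB <-]].
by rewrite !setTI; have := mf i measurableT B mB; rewrite setTI.
Qed.

End row_measurable.

Lemma product_sigma_finite d1 d2 (T1 : measurableType d1)
    (T2 : measurableType d2) (R : realType)
    (m1 : {sigma_finite_measure set T1 -> \bar R})
    (m2 : {sigma_finite_measure set T2 -> \bar R}) :
  sigma_finite setT (m1 \x m2)%E.
Proof.
have /sigma_finiteP[F [TF ndF Foo]] := sigma_finiteT m1.
have /sigma_finiteP[G [TG ndG Goo]] := sigma_finiteT m2.
exists (fun n => F n `*` G n).
  rewrite -setXTT TF TG predeqE => -[x y]; split.
    move=> [/= [n _ Fnx] [k _ Gky]]; exists (maxn n k) => //; split.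
    - by move: x Fnx; exact/subsetPset/ndF/leq_maxl.
    - by move: y Gky; exact/subsetPset/ndG/leq_maxr.
  by move=> [n _ []/= ? ?]; split; exists n.
move=> k; have [? ?] := Foo k; have [? ?] := Goo k.
split; first exact: measurableX.
by rewrite product_measure1E// lte_mul_pinfty// ge0_fin_numE.
Qed.

Section lebesgue_row.
Context {R : realType}.

Definition row_cons n (xv : R * 'rV[R]_n) : 'rV[R]_n.+1 :=
  row_mx (xv.1%:M : 'rV_1) xv.2.

Definition row_uncons n (v : 'rV[R]_n.+1) : R * 'rV[R]_n :=
  (v ord0 ord0, \row_i v ord0 (lift ord0 i)).

Lemma row_cons0 n xv : @row_cons n xv ord0 ord0 = xv.1.
Proof.
by rewrite /row_cons mxE; case: splitP => [j _|//]; rewrite mxE (ord1 j) eqxx.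
Qed.

Lemma row_consS n xv i : @row_cons n xv ord0 (lift ord0 i) = xv.2 ord0 i.
Proof.
rewrite /row_cons mxE; case: splitP => [[[]]//|j [ij]].
by congr (_ _ _); apply/val_inj.
Qed.

Lemma row_consK n : cancel (@row_cons n) (@row_uncons n).
Proof.
move=> [x v]; rewrite /row_uncons row_cons0; congr pair.
by apply/rowP => i; rewrite mxE row_consS.
Qed.

Lemma row_unconsK n : cancel (@row_uncons n) (@row_cons n).
Proof.
move=> v; apply/rowP => i; have [j ->|->] := unliftP ord0 i.
  by rewrite row_consS mxE.
by rewrite row_cons0.
Qed.

Lemma measurable_row_cons n : measurable_fun setT (@row_cons n).
Proof.
apply: measurable_fun_row => i; have [j ->|->] := unliftP ord0 i.
- rewrite (_ : (fun _ => _) = (fun v : 'rV[R]_n => v ord0 j) \o snd).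
    exact: (measurableT_comp (measurable_row_coord j) measurable_snd).
  by apply/funext => x; rewrite row_consS.
- rewrite (_ : (fun _ => _) = fst) //.
  by apply/funext => x; rewrite row_cons0.
Qed.

Lemma measurable_row_uncons n : measurable_fun setT (@row_uncons n).
Proof.
apply: measurable_fun_pair; first exact: measurable_row_coord.
apply: measurable_fun_row => i.
rewrite (_ : (fun _ => _) = fun v : 'rV[R]_n.+1 => v ord0 (lift ord0 i)).
  exact: measurable_row_coord.
by apply/funext => x; rewrite mxE.
Qed.

Section step.
Variables (n : nat) (mu : {sigma_finite_measure set 'rV[R]_n -> \bar R}).

Definition row_cons_measure : set 'rV[R]_n.+1 -> \bar R :=
  pushforward (lebesgue_measure \x mu)%E (@row_cons n).

Let row_cons_measure0 : row_cons_measure set0 = 0%E.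
Proof. by rewrite /row_cons_measure /pushforward preimage_set0 measure0. Qed.

Let row_cons_measure_ge0 A : (0 <= row_cons_measure A)%E.
Proof. by rewrite /row_cons_measure /pushforward measure_ge0. Qed.

Let row_cons_measure_sigma_additive : semi_sigma_additive row_cons_measure.
Proof.
have mcons A : measurable A -> measurable (@row_cons n @^-1` A).
  by move=> mA; rewrite -[X in measurable X]setTI; exact: measurable_row_cons.
move=> F mF tF mUF; rewrite /row_cons_measure /pushforward preimage_bigcup.
apply: measure_semi_sigma_additive.
- by move=> k; exact: mcons.
- apply/trivIsetP => /= i j _ _ ij; rewrite -preimage_setI.
  by move/trivIsetP : tF => /(_ _ _ _ _ ij) ->//; rewrite preimage_set0.
- by rewrite -preimage_bigcup; exact: mcons.
Qed.

HB.instance Definition _ := isMeasure.Build _ _ _ row_cons_measure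
  row_cons_measure0 row_cons_measure_ge0 row_cons_measure_sigma_additive.

Let row_cons_measure_sigma_finite : sigma_finite setT row_cons_measure.
Proof.
have [F FT mF] : sigma_finite setT (lebesgue_measure \x mu)%E.
  exact: product_sigma_finite.
exists (fun k => @row_uncons n @^-1` F k).
  by rewrite -preimage_bigcup -FT preimage_setT.
move=> k; split.
  by rewrite -[X in measurable X]setTI; apply: measurable_row_uncons; case: (mF k).
rewrite /row_cons_measure /pushforward -comp_preimage.
rewrite (_ : _ \o _ = id) ?preimage_id; first by case: (mF k).
by apply/funext => x /=; rewrite row_consK.
Qed.

HB.instance Definition _ := Measure_isSigmaFinite.Build _ _ _ row_cons_measure
  row_cons_measure_sigma_finite.

End step.

Fixpoint lebesgue_row (n : nat) : {sigma_finite_measure set 'rV[R]_n -> \bar R} :=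
  if n is m.+1 then row_cons_measure (lebesgue_row m) else \d_(0 : 'rV[R]_0).

Lemma lebesgue_row_box n (A : 'I_n -> set R) :
  (forall i, measurable (A i)) ->
  lebesgue_row n [set v | forall i, A i (v ord0 i)] =
  (\prod_(i < n) lebesgue_measure (A i))%E.
Proof.
elim: n A => [|n IHn] A mA.
  by rewrite big_ord0 /= diracE mem_set//= => -[].
have mB : measurable [set v : 'rV[R]_n | forall i, A (lift ord0 i) (v ord0 i)].
  rewrite (_ : [set _ | _] =
      \bigcap_(i in [set: 'I_n]) ((fun v : 'rV[R]_n => v ord0 i) @^-1` A (lift ord0 i))).
    apply: fin_bigcap_measurable; first exact: finite_finset.
    move=> i _; rewrite -[X in measurable X]setTI.
    exact: measurable_row_coord.
  by apply/seteqP; split => [v Av i _|v Av i]; apply: Av.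
rewrite big_ord_recl -IHn; last by move=> i; exact: mA.
rewrite /= /row_cons_measure /pushforward -product_measure1E//; last exact: mA.
congr (_ _); apply/seteqP; split => [[x v] /= Axv|[x v] /= [Ax Av] i].
  split=> [|i]; first by have := Axv ord0; rewrite row_cons0.
  by have := Axv (lift ord0 i); rewrite row_consS.
by have [j ->|->] := unliftP ord0 i; rewrite ?row_consS ?row_cons0.
Qed.

End lebesgue_row.

Arguments lebesgue_row {R} n.

Section geometry.
Context {R : realType}.

Definition dotv n (u v : 'rV[R]_n) : R := \sum_(i < n) u ord0 i * v ord0 i.

(* The library norm on ['rV[R]_n] is the sup norm; it induces the same topology
   but not the Euclidean distance. *)
Definition enorm n (v : 'rV[R]_n) : R := Num.sqrt (dotv v v).

Definition partial n (i : 'I_n) (f : 'rV[R]_n -> R) (x : 'rV[R]_n) : R :=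
  'D_(delta_mx ord0 i) f x.

Definition gradient n (f : 'rV[R]_n -> R) (x : 'rV[R]_n) : 'rV[R]_n :=
  \row_i partial i f x.

Definition hessian n (f : 'rV[R]_n -> R) (x : 'rV[R]_n) : 'M[R]_n :=
  \matrix_(i, j) partial j (partial i f) x.

(* [U] is meant to be open. *)
Fixpoint Ck_on n (k : nat) (U : set 'rV[R]_n) (f : 'rV[R]_n -> R) : Prop :=
  (forall x, U x -> {for x, continuous f}) /\
  if k is l.+1 then
    forall i : 'I_n, (forall x, U x -> derivable f x (delta_mx ord0 i)) /\
                     Ck_on l U (partial i f)
  else True.

Definition test_function n (W : set 'rV[R]_n) (phi : 'rV[R]_n -> R) : Prop :=
  [/\ forall k, Ck_on k setT phi,
      compact (closure [set x | phi x != 0]) &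
      closure [set x | phi x != 0] `<=` W].

Definition boundary n (W : set 'rV[R]_n) : set 'rV[R]_n :=
  closure W `\` interior W.

Definition dist_compl n (W : set 'rV[R]_n) (x : 'rV[R]_n) : R :=
  inf [set enorm (x - y) | y in ~` W].

Definition nearest_point n (W : set 'rV[R]_n) (x y : 'rV[R]_n) : Prop :=
  boundary W y /\ forall z, boundary W z -> enorm (x - y) <= enorm (x - z).

(* The interior of a set is its largest open subset. *)
Definition good_set n (W : set 'rV[R]_n) : set 'rV[R]_n :=
  interior [set x | W x /\ exists! y, nearest_point W x y].

(* In the coordinates [(x - y) *m Q], which put [y] at the origin, [W] is near
   [y] the region above the graph of [f], the last coordinate being vertical. *)
Definition graph_chart n (W : set 'rV[R]_n.+1) (y : 'rV[R]_n.+1)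
    (Q : 'M[R]_n.+1) (f : 'rV[R]_n -> R) : Prop :=
  [/\ Q *m Q^T = 1%:M, \det Q = 1,
      exists U : set 'rV[R]_n, [/\ open U, U 0 & Ck_on 2 U f] &
      \forall x \near y, W x <->
        f (col' ord_max ((x - y) *m Q)) < ((x - y) *m Q) ord0 ord_max].

Definition C2_boundary n (W : set 'rV[R]_n.+1) : Prop :=
  forall y, boundary W y -> exists Q f, graph_chart W y Q f.

(* The outward unit normal of the region above the graph of [f] is
   [nu = (grad f, -1) / sqrt (1 + |grad f|^2)].  In the basis of the tangent
   space given by the graph parametrization, the first fundamental form is
   [1 + (grad f)^T (grad f)], the form [d nu (X) . Y] is
   [hessian f / sqrt (1 + |grad f|^2)], and the product below is the matrix
   (acting on row vectors) of the differential [d nu] of the Gauss map.  For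
   the unit ball [nu] is the identity of the sphere, so its eigenvalues are
   all [1]. *)
Definition shape_operator n (f : 'rV[R]_n -> R) (x : 'rV[R]_n) : 'M[R]_n :=
  let g := gradient f x in
  (Num.sqrt (1 + dotv g g))^-1 *: (hessian f x *m invmx (1%:M + g^T *m g)).

Definition are_principal_curvatures n (W : set 'rV[R]_n.+1) (y : 'rV[R]_n.+1)
    (kappa : 'rV[R]_n) : Prop :=
  exists Q f, graph_chart W y Q f /\
    char_poly (shape_operator f 0) = \prod_(i < n) ('X - (kappa ord0 i)%:P).

(* The principal curvatures are determined up to order; one order is chosen. *)
Definition principal_curvatures n (W : set 'rV[R]_n.+1) (y : 'rV[R]_n.+1)
    : 'rV[R]_n :=
  xget 0 [set kappa | are_principal_curvatures W y kappa].

Definition mean_curvature n (W : set 'rV[R]_n.+1) (y : 'rV[R]_n.+1) : R :=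
  \sum_(i < n) principal_curvatures W y ord0 i.

End geometry.

(* Main.v *)
From HB Require Import structures.
From mathcomp Require Import ring lra complex measurable_realfun.
Require Import Defs.

(** Write [del] for the distance to the complement.  At a point [x] whose
  minimizing segment from its foot [y] extends beyond [x], the distance from
  [x + h e] to a suitably displaced boundary point near [y] bounds
  [del (x + h e)] from above to second order; displacing along the projections
  of the [n + 1] coordinate directions, scaled by one and the same optimal
  factor, bounds the sum of the second differences of [del] at [x] by
  [- h^2 n H / (n - del x * H) + o(h^2)].  The points whose segment does not
  extend form a null set, by moving them towards their feet.  Off this set
  [del] is differentiable, so by dominated convergence the left-hand side is
  the limit of its difference-quotient analogue; a discrete integration by
  parts turns the latter into the integral of [phi] against minus the second
  differences of [del], which are bounded below on the support of [phi] because
  [del] is semiconcave, and Fatou's lemma concludes. *)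

Set Implicit Arguments.
Unset Strict Implicit.
Unset Printing Implicit Defensive.

Local Open Scope classical_set_scope.
Local Open Scope ring_scope.

(** * Euclidean norm on row vectors *)

(** Off the cut, if the foot has principal curvatures [k_i], the Laplacian of [- del] is the sum of
    [k_i / (1 - del * k_i)], and the claimed bound is Jensen's inequality for the convex function
    [t / (1 - del * t)]. The barrier reaches it through traces alone: the displacement factor
    adapted to the i-th principal direction is [1 / (1 - del * k_i)], and replacing all of these by
    the common value [n / (n - del * H)] loses exactly what Jensen's inequality loses. Only
    one-sided information is at hand: the nearest-point map is not shown to be differentiable, and
    the curvature integrand, built from a choice of curvatures at [N x], is not known to be
    measurable. Hence upper bounds on second differences instead of second derivatives, and a use of
    Fatou's lemma that goes through a measurable lower limit. Extending the segment beyond [x]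
    serves three times: it makes the foot unique, it makes the second-order condition at the foot
    strict, so that [n - del * H] is positive, and it gives a lower barrier for [del], hence
    differentiability. *)

Section euclidean.
Context {R : realType}.
Implicit Types n : nat.

Lemma dotvC n (u v : 'rV[R]_n) : dotv u v = dotv v u.
Proof. by apply: eq_bigr => i _; rewrite mulrC. Qed.

Lemma dotvDl n (u v w : 'rV[R]_n) : dotv (u + v) w = dotv u w + dotv v w.
Proof. by rewrite -big_split/=; apply: eq_bigr => i _; rewrite mxE mulrDl. Qed.

Lemma dotvZl n a (u v : 'rV[R]_n) : dotv (a *: u) v = a * dotv u v.
Proof. by rewrite mulr_sumr; apply: eq_bigr => i _; rewrite mxE mulrA. Qed.

Lemma dotvDr n (u v w : 'rV[R]_n) : dotv w (u + v) = dotv w u + dotv w v.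
Proof. by rewrite dotvC dotvDl !(dotvC w). Qed.

Lemma dotvZr n a (u v : 'rV[R]_n) : dotv v (a *: u) = a * dotv v u.
Proof. by rewrite dotvC dotvZl dotvC. Qed.

Lemma dotvNl n (u v : 'rV[R]_n) : dotv (- u) v = - dotv u v.
Proof. by rewrite -scaleN1r dotvZl mulN1r. Qed.

Lemma dotvNr n (u v : 'rV[R]_n) : dotv u (- v) = - dotv u v.
Proof. by rewrite dotvC dotvNl dotvC. Qed.

Lemma dotvBl n (u v w : 'rV[R]_n) : dotv (u - v) w = dotv u w - dotv v w.
Proof. by rewrite dotvDl dotvNl. Qed.

Lemma dotvBr n (u v w : 'rV[R]_n) : dotv w (u - v) = dotv w u - dotv w v.
Proof. by rewrite dotvDr dotvNr. Qed.

Lemma dot0v n (v : 'rV[R]_n) : dotv 0 v = 0.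
Proof. by rewrite -(scale0r 0) dotvZl mul0r. Qed.

Lemma dotv0 n (v : 'rV[R]_n) : dotv v 0 = 0.
Proof. by rewrite dotvC dot0v. Qed.

Definition dotvE := (dotvDl, dotvDr, dotvBl, dotvBr, dotvNl, dotvNr, dotvZl,
  dotvZr, dot0v, dotv0).

Lemma dotv_sub_scale n (w v : 'rV[R]_n) h : dotv (w - h *: v) (w - h *: v) =
  dotv w w - 2 * h * dotv w v + h ^+ 2 * dotv v v.
Proof. by rewrite !dotvE (dotvC v); ring. Qed.

Lemma dotv_delta n (i : 'I_n) (v : 'rV[R]_n) :
  dotv (delta_mx ord0 i) v = v ord0 i.
Proof.
rewrite /dotv (bigD1 i)//= mxE !eqxx mul1r big1 ?addr0// => j ji.
by rewrite mxE eqxx (negbTE ji) mul0r.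
Qed.

Lemma dotv_mulmx n (u v : 'rV[R]_n) : dotv u v = (u *m v^T) ord0 ord0.
Proof. by rewrite mxE; apply: eq_bigr => i _; rewrite mxE. Qed.

Lemma dotv_mxl n m (u : 'rV[R]_n) (A : 'M[R]_(n, m)) (v : 'rV[R]_m) :
  dotv (u *m A) v = dotv u (v *m A^T).
Proof. by rewrite !dotv_mulmx trmx_mul trmxK mulmxA. Qed.

Lemma dotv_ge0 n (v : 'rV[R]_n) : 0 <= dotv v v.
Proof. by apply: sumr_ge0 => i _; rewrite -expr2 sqr_ge0. Qed.

Lemma dotv_eq0 n (v : 'rV[R]_n) : dotv v v = 0 -> v = 0.
Proof.
move=> v0; apply/rowP => i; rewrite mxE; apply/eqP; rewrite -sqrf_eq0 expr2.
have /psumr_eq0P : forall i, true -> 0 <= v ord0 i * v ord0 i.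
  by move=> j _; rewrite -expr2 sqr_ge0.
by move=> /(_ v0 i isT) ->.
Qed.

Lemma cauchy_schwarz n (u v : 'rV[R]_n) :
  dotv u v ^+ 2 <= dotv u u * dotv v v.
Proof.
have [v0|v0] := eqVneq (dotv v v) 0.
  by rewrite (dotv_eq0 v0) !dotv0 expr0n mulr0.
have vp : 0 < dotv v v by rewrite lt_def v0 dotv_ge0.
have := dotv_ge0 (dotv v v *: u - dotv u v *: v).
rewrite !dotvE (dotvC v u) => H.
rewrite -(ler_pM2l vp) -subr_ge0; move: H; congr (_ <= _); ring.
Qed.

Lemma enorm_ge0 n (v : 'rV[R]_n) : 0 <= enorm v.
Proof. exact: sqrtr_ge0. Qed.

Lemma enorm_sqr n (v : 'rV[R]_n) : enorm v ^+ 2 = dotv v v.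
Proof. by rewrite sqr_sqrtr ?dotv_ge0. Qed.

Lemma enorm0 n : enorm (0 : 'rV[R]_n) = 0.
Proof. by rewrite /enorm dotv0 sqrtr0. Qed.

Lemma enorm_eq0 n (v : 'rV[R]_n) : enorm v = 0 -> v = 0.
Proof. by move=> v0; apply: dotv_eq0; rewrite -enorm_sqr v0 expr0n. Qed.

Lemma enorm_gt0 n (v : 'rV[R]_n) : v != 0 -> 0 < enorm v.
Proof.
move=> v0; rewrite lt_def enorm_ge0 andbT.
by apply: contraNneq v0 => /enorm_eq0 ->.
Qed.

Lemma enormZ n a (v : 'rV[R]_n) : enorm (a *: v) = `|a| * enorm v.
Proof.
by rewrite /enorm dotvZl dotvZr mulrA -expr2 sqrtrM ?sqr_ge0// sqrtr_sqr.
Qed.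

Lemma enormN n (v : 'rV[R]_n) : enorm (- v) = enorm v.
Proof. by rewrite -scaleN1r enormZ normrN1 mul1r. Qed.

Lemma enormBC n (u v : 'rV[R]_n) : enorm (u - v) = enorm (v - u).
Proof. by rewrite -enormN opprB. Qed.

Lemma dotv_le n (u v : 'rV[R]_n) : dotv u v <= enorm u * enorm v.
Proof.
apply: (le_trans (ler_norm _)).
rewrite -[leLHS]sqrtr_sqr -sqrtrM ?dotv_ge0//.
by rewrite ler_wsqrtr// cauchy_schwarz.
Qed.

Lemma le_enorm n m (u : 'rV[R]_n) (v : 'rV[R]_m) : (enorm u <= enorm v) = (dotv u u <= dotv v v).
Proof. by rewrite /enorm ler_sqrt// dotv_ge0. Qed.

Lemma enormD n (u v : 'rV[R]_n) : enorm (u + v) <= enorm u + enorm v.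
Proof.
rewrite -(@ler_pXn2r _ 2)// ?nnegrE ?addr_ge0 ?enorm_ge0//.
rewrite enorm_sqr sqrrD !enorm_sqr !dotvE (dotvC v u).
by have := dotv_le u v; lra.
Qed.

Lemma enormB_trans n (w u v : 'rV[R]_n) :
  enorm (u - v) <= enorm (u - w) + enorm (w - v).
Proof. by rewrite (le_trans _ (enormD _ _))// addrA subrK. Qed.

Lemma enorm_add_lb n (u v : 'rV[R]_n) : enorm u - enorm v <= enorm (u + v).
Proof. by have := enormD (u + v) (- v); rewrite addrK enormN; lra. Qed.

Lemma enorm_coord n (v : 'rV[R]_n) i : `|v ord0 i| <= enorm v.
Proof.
rewrite -sqrtr_sqr ler_wsqrtr// /dotv (bigD1 i)//= -expr2 lerDl.
by apply: sumr_ge0 => j _; rewrite -expr2 sqr_ge0.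
Qed.

Lemma enorm_delta n (i : 'I_n) : enorm (delta_mx ord0 i : 'rV[R]_n) = 1.
Proof. by rewrite /enorm dotv_delta mxE !eqxx sqrtr1. Qed.

Lemma coord_norm n (v : 'rV[R]_n) i : `|v ord0 i| <= `|v|.
Proof.
rewrite [leRHS]/Num.norm/= mx_normrE; apply/bigmax_geP; right.
by exists (ord0, i).
Qed.

Lemma norm_le_coord n (v : 'rV[R]_n) (e : R) :
  0 <= e -> (forall i, `|v ord0 i| <= e) -> `|v| <= e.
Proof.
move=> e0 ve; rewrite [leLHS]/Num.norm/= mx_normrE; apply/bigmax_leP.
by split=> // -[i j] _; rewrite (ord1 i).
Qed.

Lemma norm_le_enorm n (v : 'rV[R]_n) : `|v| <= enorm v.
Proof. exact: norm_le_coord (enorm_ge0 _) (enorm_coord v). Qed.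

Lemma enorm_le_norm n (v : 'rV[R]_n) : enorm v <= n%:R * `|v|.
Proof.
rewrite -[leRHS]ger0_norm ?mulr_ge0// -sqrtr_sqr ler_wsqrtr//.
case: n v => [|n] v.
  by rewrite mul0r expr0n /dotv/= big_ord0.
apply: (@le_trans _ _ (\sum_(i < n.+1) `|v| ^+ 2)).
  by apply: ler_sum => i _; rewrite -expr2 -real_normK ?num_real// lerXn2r// ?nnegrE// coord_norm.
rewrite sumr_const card_ord -[(`|v| ^+ 2) *+ _]mulr_natl exprMn ler_wpM2r ?sqr_ge0// expr2.
by rewrite ler_peMl// ler1n.
Qed.

Lemma dotv_orth n (Q : 'M[R]_n) (u v : 'rV[R]_n) :
  Q *m Q^T = 1%:M -> dotv (u *m Q) (v *m Q) = dotv u v.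
Proof. by move=> QQ; rewrite dotv_mxl -mulmxA QQ mulmx1. Qed.

Lemma enorm_orth n (Q : 'M[R]_n) (u : 'rV[R]_n) :
  Q *m Q^T = 1%:M -> enorm (u *m Q) = enorm u.
Proof. by move=> QQ; rewrite /enorm dotv_orth. Qed.

Lemma coord_cont n (i : 'I_n) : continuous (fun v : 'rV[R]_n => v ord0 i).
Proof. exact: coord_continuous. Qed.

(** The topology comes from the sup norm; with this form of neighborhoods, later arguments choose
    Euclidean radii directly. *)
Lemma nbhs_enorm n (x : 'rV[R]_n) (P : set 'rV[R]_n) :
  nbhs x P <-> exists2 e, 0 < e & forall y, enorm (y - x) < e -> P y.
Proof.
split=> [/nbhs_ballP[e /= e0 eP]|[e e0 eP]].
  exists e => // y yx; apply: eP; rewrite -ball_normE /=.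
  by rewrite (le_lt_trans (norm_le_enorm _))// enormBC.
(* [n + 1] instead of [n] keeps the radius positive in dimension zero. *)
have n0 : 0 < n%:R + 1 :> R by rewrite ltr_wpDl.
apply/nbhs_ballP; exists (e / (n%:R + 1)); first by rewrite /= divr_gt0.
move=> y; rewrite -ball_normE /= ltr_pdivlMr// => H; apply: eP.
rewrite enormBC (le_lt_trans (enorm_le_norm _))//; apply: le_lt_trans H.
by rewrite mulrC ler_wpM2l// lerDl.
Qed.

Lemma lipschitz_enorm_continuous n (f : 'rV[R]_n -> R) (L : R) :
  0 <= L -> (forall x y, f x - f y <= L * enorm (x - y)) -> continuous f.
Proof.
move=> L0 fL x A /nbhs_normP[e /= e0 eA].
apply/nbhs_enorm; exists (e / (L + 1)); first by rewrite divr_gt0// ltr_wpDl.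
move=> y; rewrite ltr_pdivlMr ?ltr_wpDl// => H.
have : L * enorm (y - x) < e.
  by apply: le_lt_trans H; rewrite mulrC ler_wpM2l ?enorm_ge0// lerDl.
move=> Le; apply: eA; rewrite /ball_ /= ltr_norml.
by have := fL x y; have := fL y x; rewrite (enormBC x); lra.
Qed.

Lemma enorm_continuous n : continuous (@enorm R n).
Proof.
apply: (@lipschitz_enorm_continuous _ _ 1) => // x y.
by have := enorm_add_lb x (y - x); rewrite mul1r [x + _]addrC subrK enormBC; lra.
Qed.

Lemma enorm_bounded n (A : set 'rV[R]_n) (M : R) :
  (forall x, A x -> enorm x <= M) -> bounded_set A.
Proof.
move=> AM; exists M; split; first exact: num_real.
by move=> y My x Ax /=; rewrite (le_trans (norm_le_enorm _))// (le_trans (AM _ Ax))// ltW.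
Qed.

Lemma enorm_closed_compact n (A : set 'rV[R]_n) (M : R) :
  (forall x, A x -> enorm x <= M) -> closed A -> compact A.
Proof. by move=> /enorm_bounded; exact: bounded_closed_compact. Qed.

End euclidean.

(** * Integrals of possibly nonmeasurable functions *)

Section integral_nonmeasurable.
Context d (T : measurableType d) (R : realType).
Variable mu : {measure set T -> \bar R}.
Local Open Scope ereal_scope.
Import HBNNSimple.

(** A simple function below [f], set to zero on [Z], keeps its integral and lies below [g]
    everywhere, so it competes in the supremum defining the integral of [g]. *)
Let ge0_le_integralT (Z : set T) (f g : T -> \bar R) :
  measurable Z -> mu Z = 0 -> (forall x, 0 <= f x) -> (forall x, 0 <= g x) ->
  (forall x, ~ Z x -> f x <= g x) ->
  \int[mu]_x f x <= \int[mu]_x g x.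
Proof.
move=> mZ Z0 f0 g0 fg; rewrite !ge0_integralTE//.
apply/ge_ereal_sup => /= _ [h hf <-].
have mZC : measurable (~` Z) by exact: measurableC.
pose h' : {nnsfun T >-> R} := proj_nnsfun h mZC.
have h'E x : h' x = (h \_ (~` Z)) x by rewrite mrestrict.
have -> : sintegral mu h = sintegral mu h'.
  rewrite -!integralT_nnsfun; apply: ae_eq_integral => //.
  - by apply/measurable_EFinP; exact: measurable_funP.
  - by apply/measurable_EFinP; exact: measurable_funP.
  exists Z; split => // x /=; apply: contra_notP => nZ _; apply: congr1.
  by apply/esym/(etrans (h'E x)); rewrite patchE mem_set.
apply: ereal_sup_ubound; exists h' => // x.
suff : (((h \_ (~` Z)) x)%:E <= g x) by move: (h'E x) => <-.
rewrite patchE; have [xZ|xZ] := pselect (Z x).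
  by rewrite memNset.
by rewrite mem_set// (le_trans (hf x))// fg.
Qed.

(* The integral of an arbitrary nonnegative function is a supremum over simple
   functions, so monotonicity does not need measurability. *)
Lemma le_integral_off_negligible (D Z : set T) (f g : T -> \bar R) :
  measurable Z -> mu Z = 0 -> (forall x, D x -> ~ Z x -> f x <= g x) ->
  \int[mu]_(x in D) f x <= \int[mu]_(x in D) g x.
Proof.
move=> mZ Z0 fg; rewrite (integral_mkcond D f) (integral_mkcond D g).
have {}fg x : ~ Z x -> (f \_ D) x <= (g \_ D) x.
  by move=> nZ; rewrite !patchE; case: ifPn => // /set_mem Dx; exact: fg.
rewrite [leLHS]integralE [leRHS]integralE leeB//.
  apply: (ge0_le_integralT mZ) => // x nZ; rewrite !funeposE.
  by rewrite le_max2// fg.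
apply: (ge0_le_integralT mZ) => // x nZ; rewrite !funenegE.
by rewrite le_max2// leeN2 fg.
Qed.

Lemma integral_setD_negligible (D Z : set T) (f : T -> \bar R) :
  measurable Z -> mu Z = 0 ->
  \int[mu]_(x in D) f x = \int[mu]_(x in D `\` Z) f x.
Proof.
move=> mZ Z0; rewrite (integral_mkcond D) (integral_mkcond (D `\` Z)).
have E x : ~ Z x -> (f \_ D) x = (f \_ (D `\` Z)) x.
  move=> nZ; rewrite !patchE; congr (if _ then _ else _).
  by apply/idP/idP => /set_mem H; apply/mem_set; [split|case: H].
by apply/eqP; rewrite eq_le; apply/andP; split;
  apply: (le_integral_off_negligible mZ) => // x _ nZ; rewrite E.
Qed.

End integral_nonmeasurable.

(** * Lebesgue measure on row vectors *)

Section row_borel.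
Context {R : realType}.
Implicit Types n : nat.

Lemma measurable_coord n (i : 'I_n) (A : set R) :
  measurable A -> measurable [set v : 'rV[R]_n | A (v ord0 i)].
Proof.
move=> mA; rewrite -[X in measurable X]setTI.
exact: (measurable_row_coord i measurableT mA).
Qed.

Lemma measurable_row_box n (A : 'I_n -> set R) : (forall i, measurable (A i)) ->
  measurable [set v : 'rV[R]_n | forall i, A i (v ord0 i)].
Proof.
move=> mA; rewrite (_ : [set _ | _] =
    \bigcap_(i in [set: 'I_n]) [set v : 'rV[R]_n | A i (v ord0 i)]).
  apply: fin_bigcap_measurable; first exact: finite_finset.
  by move=> i _; exact: measurable_coord.
by apply/seteqP; split => [v Av i _|v Av i]; apply: Av.
Qed.

Lemma row_ballE n (x : 'rV[R]_n) (r : R) : 0 < r ->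
  ball x r = [set v : 'rV[R]_n | forall i, ball (x ord0 i) r (v ord0 i)].
Proof.
move=> r0; rewrite predeqE => v; split; first by move=> [_ H] i; exact: H.
by move=> xv; split => // i j; rewrite (ord1 i).
Qed.

Lemma measurable_row_ball n (x : 'rV[R]_n) (r : R) :
  measurable (ball x r : set 'rV[R]_n).
Proof.
have [r0|r0] := ltP 0 r; last first.
  rewrite (_ : ball x r = set0) ?predeqE // => y; split => // -[].
  by rewrite ltNge r0.
rewrite row_ballE//.
apply: (measurable_row_box (A := fun i => ball (x ord0 i) r)) => i.
exact: measurable_ball.
Qed.

Lemma rat_row_dense n (x : 'rV[R]_n) (e : R) : 0 < e ->
  exists q : 'rV[rat]_n, ball (\row_i ratr (q ord0 i) : 'rV[R]_n) e x.
Proof.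
move=> e0.
have /choice[q qe] (i : 'I_n) : exists q : rat, ratr q \in `]x ord0 i - e, x ord0 i + e[.
  by apply: rat_in_itvoo; lra.
exists (\row_i q i); split => // i j; rewrite (ord1 i) !mxE /ball/= ltr_norml.
by have := qe j; rewrite in_itv/= => /andP[]; lra.
Qed.

(** Measurability is generated by the coordinates, so an open set has to be written as a countable
    union of boxes: the sup-norm balls with rational centre and radius [1 / (k + 1)] contained in
    it. *)
Lemma open_measurable_row n (A : set 'rV[R]_n) : open A -> measurable A.
Proof.
move=> oA.
pose c (q : 'rV[rat]_n) : 'rV[R]_n := \row_i ratr (q ord0 i).
pose F m := if unpickle m is Some qk then
    if `[< ball (c qk.1) qk.2.+1%:R^-1 `<=` A >]
    then ball (c qk.1) qk.2.+1%:R^-1 else set0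
  else set0 : set 'rV[R]_n.
rewrite (_ : A = \bigcup_m F m).
  apply: bigcupT_measurable => m; rewrite /F.
  case: unpickle => // -[q k] /=; case: ifP => // _.
  exact: measurable_row_ball.
apply/seteqP; split => [x Ax|x [m _]]; last first.
  by rewrite /F; case: unpickle => // -[q k] /=; case: asboolP => // + cx; apply.
have /nbhs_ballP[e /= e0 eA] : nbhs x A by exact: open_nbhs_nbhs.
have e20 : 0 < e / 2 by rewrite divr_gt0.
have [k _ /(_ _ (leqnn k))/= ke] := near_infty_natSinv_lt (PosNum e20).
have [q qx] := rat_row_dense x (ltac:(by rewrite invr_gt0) : 0 < k.+1%:R^-1 :> R).
exists (pickle (q, k)) => //; rewrite /F pickleK /=; case: asboolP => // nA.
exfalso; apply: nA => y qy; apply: eA.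
apply: le_ball (ball_triangle (ball_sym qx) qy).
by rewrite (splitr e) lerD// ltW.
Qed.

Lemma closed_measurable_row n (A : set 'rV[R]_n) : closed A -> measurable A.
Proof.
move=> /closed_openC/open_measurable_row/measurableC; by rewrite setCK.
Qed.

Lemma continuous_measurable_row n (f : 'rV[R]_n -> R) :
  continuous f -> measurable_fun setT f.
Proof.
move=> /continuousP cf; apply: (measurability _ (RGenOpens.measurableE R)).
move=> _ [_ [a [b ->] <-]]; rewrite setTI; apply: open_measurable_row.
exact/cf/interval_open.
Qed.

Definition cbox n (M : R) : set 'rV[R]_n :=
  [set v | forall i, v ord0 i \in `[- M, M]].

Lemma cbox_measurable n M : measurable (cbox M : set 'rV[R]_n).
Proof. by apply: (measurable_row_box (A := fun=> [set` `[- M, M]])). Qed.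

Lemma cbox_compact n M : compact (cbox M : set 'rV[R]_n).
Proof.
by apply: (@rV_compact _ _ (fun=> [set` `[- M, M]])) => _; exact: segment_compact.
Qed.

Lemma cboxP n M (v : 'rV[R]_n) : 0 <= M -> cbox M v <-> `|v| <= M.
Proof.
move=> M0; split => [H|H i].
  by apply: norm_le_coord => // i; rewrite ler_norml; have := H i; rewrite in_itv.
by rewrite in_itv/= -ler_norml (le_trans (coord_norm _ _)).
Qed.

Lemma lebesgue_row_cbox n M : 0 <= M ->
  lebesgue_row n (cbox M) = ((2 * M) ^+ n)%:E.
Proof.
move=> M0; rewrite (@lebesgue_row_box _ _ (fun=> [set` `[- M, M]]))//.
under eq_bigr do rewrite lebesgue_measure_itv/=.
have -> : (if (- M)%:E < M%:E then M%:E - (- M)%:E else 0)%E = (2 * M)%:E :> \bar R.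
  case: ifPn; rewrite lte_fin; first by rewrite -EFinD => _; congr _%:E; ring.
  by rewrite -leNgt => MM; congr _%:E; lra.
by rewrite prodEFin prodr_const card_ord.
Qed.

Lemma lebesgue_row_ball n (x : 'rV[R]_n) r : 0 < r ->
  lebesgue_row n (ball x r) = ((2 * r) ^+ n)%:E.
Proof.
move=> r0.
rewrite row_ballE//.
rewrite (@lebesgue_row_box _ _ (fun i => ball (x ord0 i) r)); last first.
  by move=> i; exact: measurable_ball.
under eq_bigr do rewrite lebesgue_measure_ball ?ltW// -mulr_natl.
by rewrite prodEFin prodr_const card_ord.
Qed.

Lemma lebesgue_row_closed_ball n (x : 'rV[R]_n) r : 0 <= r ->
  lebesgue_row n [set v | forall i, v ord0 i \in `[x ord0 i - r, x ord0 i + r]] =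
  ((2 * r) ^+ n)%:E.
Proof.
move=> r0.
rewrite (@lebesgue_row_box _ _ (fun i => [set` `[x ord0 i - r, x ord0 i + r]]))//.
have E (i : 'I_n) : lebesgue_measure [set` `[x ord0 i - r, x ord0 i + r]] =
    (2 * r)%:E :> \bar R.
  rewrite lebesgue_measure_itv/= lte_fin.
  case: ifPn; first by rewrite -EFinD => _; congr _%:E; ring.
  by rewrite -leNgt => MM; congr _%:E; lra.
by under eq_bigr do rewrite E; rewrite prodEFin prodr_const card_ord.
Qed.


Lemma lebesgue_translation (a : R) (A : set R) : measurable A ->
  lebesgue_measure ((fun x => x + a) @^-1` A) = lebesgue_measure A.
Proof.
have mta : measurable_fun setT (fun x : R => x + a).
  apply: continuous_measurable_fun => x.
  by apply: cvgD; [exact: cvg_id|exact: cvg_cst].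
pose tr : {mfun measurableTypeR R >-> measurableTypeR R} :=
  HB.pack (fun x : R => x + a) (isMeasurableFun.Build _ _ (measurableTypeR R) (measurableTypeR R) _ mta).
move=> mA; apply/esym.
rewrite (@lebesgue_measure_unique R (pushforward lebesgue_measure tr))//.
move=> _ [[x y] _ <-].
have E : (fun z : R => z + a) @^-1` `]x, y] = `]x - a, y - a]%classic.
  apply/seteqP; split => z /=; rewrite !in_itv/= => /andP[? ?]; apply/andP; split; lra.
transitivity (lebesgue_measure (`]x - a, y - a]%classic : set R)); last by rewrite -E.
rewrite !lebesgue_measure_itv/= !lte_fin ltrBlDr subrK.
by case: ifPn => // _; rewrite -!EFinD; congr _%:E; ring.
Qed.

Let boxes n : set (set 'rV[R]_n) :=
  [set B | exists2 A : 'I_n -> set R, (forall i, measurable (A i)) &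
     B = [set v : 'rV[R]_n | forall i, A i (v ord0 i)]].

Let boxes_generate n : measurable = <<s @boxes n >>.
Proof.
apply/seteqP; split => A; last first.
  apply: smallest_sub; first exact: sigma_algebra_measurable.
  by move=> _ [B mB ->]; exact: measurable_row_box.
apply: smallest_sub; first exact: smallest_sigma_algebra.
move=> B; rewrite -bigcup_seq/= => -[i _ [C mC <-]].
apply: sub_sigma_algebra.
exists (fun j => if j == i then C else setT); first by move=> j; case: ifP.
apply/seteqP; split => v /=.
  by move=> [_ Cv] j; case: eqP => // ->.
by move=> /(_ i); rewrite eqxx.
Qed.

Let boxesI n : setI_closed (@boxes n).
Proof.
move=> _ _ [A mA ->] [B mB ->]; exists (fun i => A i `&` B i).
  by move=> i; exact: measurableI.
apply/seteqP; split => v /=; first by move=> [Av Bv] i; split.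
by move=> H; split => i; case: (H i).
Qed.

Lemma translation_measurable n (a : 'rV[R]_n) :
  measurable_fun setT (fun v : 'rV[R]_n => v + a).
Proof.
apply: measurable_fun_row => i; apply: continuous_measurable_row.
apply: (@lipschitz_enorm_continuous _ _ _ 1) => // x y.
rewrite !mxE mul1r (le_trans _ (enorm_coord _ i))//.
by rewrite (le_trans _ (ler_norm _))// !mxE; lra.
Qed.

Lemma cbox_bigcup n : \bigcup_k (cbox k%:R : set 'rV[R]_n) = setT.
Proof.
apply/seteqP; split => // v _; exists (Num.trunc `|v|).+1 => //.
by apply/cboxP => //; rewrite ltW// truncnS_gt.
Qed.

(** The translated measure agrees with the original one on products of measurable sets, a generating
    family stable under intersection, and is finite on an exhausting sequence of cubes. *)
Lemma lebesgue_row_translation n (a : 'rV[R]_n) (A : set 'rV[R]_n) :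
  measurable A ->
  lebesgue_row n ((fun v => v + a) @^-1` A) = lebesgue_row n A.
Proof.
pose tr : {mfun 'rV[R]_n >-> 'rV[R]_n} := HB.pack (fun v : 'rV[R]_n => v + a)
  (isMeasurableFun.Build _ _ _ _ _ (@translation_measurable n a)).
move=> mA.
apply: (@measure_unique _ _ _ (@boxes n) (fun k => cbox k%:R) _ _ _ _
  (pushforward (lebesgue_row n) tr) (lebesgue_row n)) => //.
- exact: boxes_generate.
- exact: boxesI.
- by move=> k; exists (fun=> [set` `[- k%:R, k%:R]]).
- exact: cbox_bigcup.
- move=> _ [B mB ->]; apply: etrans (esym (lebesgue_row_box mB)).
  transitivity (lebesgue_row n
    [set v | forall i, ((fun x => x + a ord0 i) @^-1` B i) (v ord0 i)]).
    have E : (fun v : 'rV[R]_n => v + a) @^-1` [set v | forall i, B i (v ord0 i)] =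
        [set v : 'rV[R]_n | forall i, ((fun x => x + a ord0 i) @^-1` B i) (v ord0 i)].
      by apply/seteqP; split => v /= H i; have := H i; rewrite mxE.
    exact: (congr1 (lebesgue_row n) E).
  rewrite (@lebesgue_row_box _ _ (fun i => (fun x => x + a ord0 i) @^-1` B i)).
    by apply: eq_bigr => i _; exact: lebesgue_translation.
  move=> i; rewrite -[X in measurable X]setTI.
  have mta : measurable_fun setT (fun x : R => x + a ord0 i).
    apply: continuous_measurable_fun => x.
    by apply: cvgD; [exact: cvg_id|exact: cvg_cst].
  exact: mta.
- move=> k.
  have E : (fun v : 'rV[R]_n => v + a) @^-1` cbox k%:R =
      [set v : 'rV[R]_n | forall i, v ord0 i \in `[(- a) ord0 i - k%:R, (- a) ord0 i + k%:R]].
    apply/seteqP; split => v /= H i; have := H i; rewrite ?mxE !in_itv/= => /andP[? ?];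
      apply/andP; split; lra.
  apply: (@le_lt_trans _ _ (((2 * k%:R) ^+ n)%:E)); last by rewrite ltry.
  rewrite -(@lebesgue_row_closed_ball n (- a) k%:R (ler0n _ _)).
  by rewrite le_eqVlt; apply/orP; left; apply/eqP; exact: (congr1 (lebesgue_row n) E).
Qed.

Lemma integral_translation n (a : 'rV[R]_n) (f : 'rV[R]_n -> \bar R) :
  measurable_fun setT f ->
  (lebesgue_row n).-integrable setT (fun v : 'rV[R]_n => f (v + a)) ->
  (\int[lebesgue_row n]_v f (v + a)%R = \int[lebesgue_row n]_v f v)%E.
Proof.
move=> mf intf.
have := @integral_pushforward _ _ _ _ _ _ (@translation_measurable n a)
  (lebesgue_row n) setT f mf.
rewrite preimage_setT => /(_ intf measurableT) <-.
pose tr : {mfun 'rV[R]_n >-> 'rV[R]_n} := HB.pack (fun v : 'rV[R]_n => v + a)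
  (isMeasurableFun.Build _ _ _ _ _ (@translation_measurable n a)).
apply: (@eq_measure_integral _ _ _ _ (lebesgue_row n) (pushforward (lebesgue_row n) tr)) => A mA _.
exact: lebesgue_row_translation.
Qed.

End row_borel.

(** * Inner regularity of Lebesgue measure by closed sets *)

Section regularity.
Context {R : realType} (n : nat).
Local Notation mu := (@lebesgue_row R n).
Variable M : R.
Local Notation B := (cbox M : set 'rV[R]_n).

Let muB (A : set 'rV[R]_n) : measurable A -> (mu (A `&` B) < +oo)%E.
Proof.
move=> mA; have mB := @cbox_measurable R n M.
have [M0|M0] := leP 0 M.
  apply: (@le_lt_trans _ _ (mu B)); last by rewrite lebesgue_row_cbox// ltry.
  by apply: le_measure; rewrite ?inE//; exact: measurableI.
apply: (@le_lt_trans _ _ (mu (cbox 0))).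
  apply: le_measure; rewrite ?inE//; [exact: measurableI|exact: cbox_measurable|].
  move=> v [_ Bv] i; have := Bv i; rewrite !in_itv/= => /andP[? ?].
  by apply/andP; split; lra.
by rewrite lebesgue_row_cbox// ltry.
Qed.

(** The error is measured inside the cube [B], where the measure is finite, so that continuity from
    above applies. *)
Let inner (A : set 'rV[R]_n) := measurable A /\ forall e : R, 0 < e ->
  exists F, [/\ closed F, F `<=` A & (mu ((A `\` F) `&` B) <= e%:E)%E].

Let inner_closed A : closed A -> inner A.
Proof.
move=> cA; split; first exact: closed_measurable_row.
by move=> e e0; exists A; split => //; rewrite setDv set0I measure0 lee_fin ltW.
Qed.

Let halves (A F : (set 'rV[R]_n)^nat) (e : R) : 0 <= e ->
  (forall k, measurable (A k)) -> (forall k, measurable (F k)) ->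
  (forall k, mu ((A k `\` F k) `&` B) <= (e / (2 ^ k.+1)%:R)%:E)%E ->
  (mu ((\bigcup_k (A k `\` F k)) `&` B) <= e%:E)%E.
Proof.
move=> e0 mA mF AF; have mB := @cbox_measurable R n M.
have mAF k : measurable ((A k `\` F k) `&` B).
  by apply: measurableI => //; exact: measurableD.
rewrite setI_bigcupl.
apply: le_trans (measure_sigma_subadditive _ mAF (bigcupT_measurable _ mAF) (fun x h => h)) _.
apply: le_trans (epsilon_trick0 xpredT e0).
by apply: lee_nneseries => // k _; exact: AF.
Qed.

Let inner_bigcap (A : (set 'rV[R]_n)^nat) : (forall k, inner (A k)) ->
  inner (\bigcap_k A k).
Proof.
move=> iA; split; first by apply: bigcapT_measurable => k; have [] := iA k.
move=> e e0.
have ek0 k : 0 < e / (2 ^ k.+1)%:R by rewrite divr_gt0// ltr0n expn_gt0.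
have /choice[F HF] (k : nat) := (iA k).2 _ (ek0 k).
exists (\bigcap_k F k); split.
- by apply: closed_bigI => k _; have [] := HF k.
- by move=> x Fx k _; have [_ FA _] := HF k; exact/FA/Fx.
have mA k : measurable (A k) by have [] := iA k.
have mF k : measurable (F k) by apply: closed_measurable_row; have [] := HF k.
apply: le_trans (halves (ltW e0) mA mF _); last by move=> k; have [] := HF k.
apply: le_measure; rewrite ?inE.
- by apply: measurableI; [apply: measurableD; exact: bigcapT_measurable|exact: cbox_measurable].
- apply: measurableI; last exact: cbox_measurable.
  by apply: bigcupT_measurable => k; exact: measurableD.
move=> x [[Ax nFx] Bx]; split => //.
have /existsNP[k /not_implyP[_ nFk]] := nFx.
by exists k => //; split => //; exact: Ax.
Qed.

(** A countable union of closed sets need not be closed, so only finitely many approximants are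
    kept. Half of the error pays for the discarded tail [G N], whose measure tends to zero, the
    other half for the approximations. *)
Let inner_bigcup (A : (set 'rV[R]_n)^nat) : (forall k, inner (A k)) ->
  inner (\bigcup_k A k).
Proof.
move=> iA; have mU : measurable (\bigcup_k A k).
  by apply: bigcupT_measurable => k; have [] := iA k.
split => // e e0.
have e20 : 0 < e / 2 by rewrite divr_gt0.
have ek0 k : 0 < e / 2 / (2 ^ k.+1)%:R by rewrite divr_gt0// ltr0n expn_gt0.
have /choice[F HF] (k : nat) := (iA k).2 _ (ek0 k).
have mA k : measurable (A k) by have [] := iA k.
have mF k : measurable (F k) by apply: closed_measurable_row; have [] := HF k.
have mB := @cbox_measurable R n M.
pose G N := ((\bigcup_k A k) `\` \bigcup_(k in `I_N) A k) `&` B.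
have mG N : measurable (G N).
  apply: measurableI => //; apply: measurableD => //.
  by apply: fin_bigcup_measurable => // k _; exact: mA.
have G0 : \bigcap_N G N = set0.
  apply/seteqP; split => // x Gx; have [[[k _ Ak] _] _] := Gx 0 I.
  by have [[_ nA] _] := Gx k.+1 I; apply: nA; exists k => /=.
have cG : mu \o G @ \oo --> 0%E.
  rewrite -(measure0 mu) -G0; apply: nonincreasing_cvg_mu => //.
  - by apply: muB; apply: measurableD => //; rewrite bigcup0// => k; rewrite /= ltn0.
  - by rewrite G0.
  - move=> N1 N2 N12; apply/subsetPset => x [[Ux nx] Bx]; split => //; split => //.
    by apply: contra_not nx => -[k /= kN Ak]; exists k => //=; exact: leq_trans N12.
have [N _ /(_ _ (leqnn N))/= HN] : \forall N \near \oo, (mu (G N) < (e / 2)%:E)%E.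
  apply: (cG [set x | (x < (e / 2)%:E)%E]); apply: open_nbhs_nbhs; split.
    exact: open_ereal_lt_ereal.
  by rewrite /= lte_fin.
exists (\bigcup_(k in `I_N) F k); split.
- by apply: closed_bigcup => // k _; have [] := HF k.
- by move=> x [k _ Fk]; exists k => //; have [_ FA _] := HF k; exact: FA.
have mH : measurable (\bigcup_k (A k `\` F k)).
  by apply: bigcupT_measurable => k; exact: measurableD.
apply: (@le_trans _ _ (mu (G N `|` (\bigcup_k (A k `\` F k)) `&` B))).
  apply: le_measure; rewrite ?inE.
  - apply: measurableI => //; apply: measurableD => //.
    by apply: fin_bigcup_measurable => // k _; exact: mF.
  - by apply: measurableU => //; exact: measurableI.
  move=> x [[Ax nFx] Bx].
  have [[k /= kN Ak]|nA] := pselect ((\bigcup_(k in `I_N) A k) x); last by left.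
  by right; split => //; exists k => //; split => // Fk; apply: nFx; exists k.
apply: le_trans (measureU2 _ _ _) _; [exact: mG|exact: measurableI|].
rewrite (splitr e) EFinD; apply: leeD; first exact: ltW.
by apply: (halves (ltW e20) mA mF) => k; have [] := HF k.
Qed.

(** Inner approximability is not visibly stable under complement; requiring it of both a set and its
    complement makes this immediate. *)
Let reg A := inner A /\ inner (~` A).

Let reg_sigma : sigma_algebra setT reg.
Proof.
split.
- split; first by apply: inner_closed; exact: closed0.
  by rewrite setC0; apply: inner_closed; exact: closedT.
- by move=> A [iA iCA]; rewrite setTD; split => //; rewrite setCK.
- move=> A rA; split; first by apply: inner_bigcup => k; have [] := rA k.
  by rewrite setC_bigcup; apply: inner_bigcap => k; have [] := rA k.
Qed.

Let reg_coord (i : 'I_n) (A : set R) : measurable A ->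
  reg [set v : 'rV[R]_n | A (v ord0 i)].
Proof.
pose T := [set A : set R | reg [set v : 'rV[R]_n | A (v ord0 i)]].
have sT : sigma_algebra setT T.
  have [r0 rC rU] := reg_sigma; split => //=.
  - by move=> C /rC H; apply: (eq_ind _ reg H); apply/seteqP; split.
  - move=> C /rU; rewrite /T/= => rC'.
    rewrite (_ : [set v | _] = \bigcup_k [set v : 'rV[R]_n | C k (v ord0 i)]) //.
suff H : (measurable : set (set R)) `<=` T by exact: H.
move=> C; rewrite [X in X C -> _](RGenOpens.measurableE R).
apply: smallest_sub => // _ [a [b ->]].
split; last first.
  apply: inner_closed; rewrite closedC.
  have /continuousP := @coord_cont R n i.
  by apply; exact: interval_open.
rewrite (_ : [set v | _] = \bigcup_k [set v : 'rV[R]_n |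
    v ord0 i \in `[a + k.+1%:R^-1, b - k.+1%:R^-1]]).
  apply: inner_bigcup => k; apply: inner_closed.
  have /continuous_closedP H := @coord_cont R n i.
  by apply: (H [set` `[a + k.+1%:R^-1, b - k.+1%:R^-1]]); exact: interval_closed.
apply/seteqP; split => v /=; last first.
  move=> [k _ /=]; have : 0 < k.+1%:R^-1 :> R by rewrite invr_gt0.
  move: k.+1%:R^-1 => r r0; rewrite !in_itv/= => /andP[? ?].
  by apply/andP; split; lra.
rewrite in_itv/= => /andP[av vb].
have e0 : 0 < Num.min (v ord0 i - a) (b - v ord0 i) by rewrite lt_min !subr_gt0 av.
have [k _ /(_ _ (leqnn k))/=] := near_infty_natSinv_lt (PosNum e0).
move=> kr; exists k => //=; move: kr; move: k.+1%:R^-1 => r.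
by rewrite lt_min => /andP[? ?]; rewrite in_itv/=; apply/andP; split; lra.
Qed.

Lemma lebesgue_row_inner_regular (A : set 'rV[R]_n) (e : R) :
  measurable A -> 0 < e ->
  exists F, [/\ closed F, F `<=` A & (mu ((A `\` F) `&` B) <= e%:E)%E].
Proof.
move=> mA e0; suff : reg A by move=> [[_ +] _]; exact.
move: A mA; apply: smallest_sub; first exact: reg_sigma.
move=> A; rewrite -bigcup_seq/= => -[i _ [C mC <-]].
by rewrite setTI; exact: reg_coord.
Qed.

End regularity.

(** * Null sets and Lipschitz images *)

Section null_sets.
Context {R : realType} (n : nat).
Local Notation mu := (@lebesgue_row R n).

(** Closed inner approximants intersected with a cube are compact, hence null, and they exhaust the
    part of [A] in that cube up to arbitrarily small measure. *)
Lemma compact_null_negligible (A : set 'rV[R]_n) : measurable A ->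
  (forall K, compact K -> K `<=` A -> mu K = 0%E) -> mu A = 0%E.
Proof.
move=> mA KA.
have mB k := @cbox_measurable R n k%:R.
have AB0 (k : nat) : mu (A `&` cbox k%:R) = 0%E.
  apply/eqP; rewrite eq_le measure_ge0 andbT; apply/lee_addgt0Pr => e e0.
  rewrite add0e.
  have [F [cF FA FAe]] := lebesgue_row_inner_regular k%:R mA e0.
  have mF := closed_measurable_row cF.
  apply: le_trans FAe; rewrite -[leRHS]add0e.
  have K0 : mu (F `&` cbox k%:R) = 0%E.
    apply: KA; last by move=> x [/FA].
    by rewrite setIC; apply: compact_closedI => //; exact: cbox_compact.
  rewrite -[X in (X + _)%E]K0.
  apply: le_trans (measureU2 _ _ _).
  - apply: le_measure; rewrite ?inE.
    + exact: measurableI.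
    + by apply: measurableU; apply: measurableI => //; exact: measurableD.
    move=> x [Ax Bx]; have [Fx|nFx] := pselect (F x); first by left.
    by right; split.
  - exact: measurableI.
  - by apply: measurableI => //; exact: measurableD.
rewrite -(setIT A) -cbox_bigcup setI_bigcupr.
apply/eqP; rewrite eq_le measure_ge0 andbT.
have mAB k : measurable (A `&` cbox k%:R) by exact: measurableI.
apply: le_trans (measure_sigma_subadditive _ mAB (bigcupT_measurable _ mAB) (fun x h => h)) _.
by rewrite eseries0 // => k _ _; exact: AB0.
Qed.

Let ballM q (e : R) : measurable (ball q e : set 'rV[R]_n).
Proof. exact: measurable_row_ball. Qed.

Let separated (e : R) := pairwise (fun p q : 'rV[R]_n => e <= `|p - q|).

(** In the sup norm these balls are cubes of side [e], disjoint because the centres are at least [e]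
    apart. *)
Let measure_separated_balls (e : R) (s : seq 'rV[R]_n) : 0 < e -> separated e s ->
  mu (\big[setU/set0]_(q <- s) ball q (e / 2)) = ((size s)%:R * e ^+ n)%:E.
Proof.
move=> e0; elim: s => [|q s IH]; first by rewrite big_nil measure0 mul0r.
move=> /= /andP[qs ss]; rewrite big_cons measureU//; last 2 first.
- by apply: bigsetU_measurable => p _; exact: ballM.
- apply/seteqP; split => // x [qx]; rewrite -bigcup_seq => -[p ps px].
  have /(allP qs) := ps; rewrite leNgt => /negP; apply.
  move: qx px; rewrite /= -!ball_normE /ball_/= => qx px.
  rewrite (_ : q - p = (q - x) - (p - x)); last by rewrite opprB addrA subrK.
  by apply: le_lt_trans (ler_normB _ _) _; rewrite (splitr e) ltrD.
have E1 : mu (ball q (e / 2)) = (e ^+ n)%:E.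
  by rewrite lebesgue_row_ball ?divr_gt0//; congr (_ ^+ _)%:E; field.
apply: (etrans (congr2 adde E1 (IH ss))).
transitivity ((e ^+ n + (size s)%:R * e ^+ n)%:E) => //; congr _%:E.
by rewrite -(natr1 (size s)) mulrDl mul1r addrC.
Qed.

Let measure_cubes (r : R) (s : seq 'rV[R]_n) (K : set 'rV[R]_n) : 0 <= r ->
  measurable K ->
  (forall x, K x -> exists2 q, q \in s & `|x - q| <= r) ->
  (mu K <= ((size s)%:R * (2 * r) ^+ n)%:E)%E.
Proof.
move=> r0; elim: s K => [|q s IH] K mK Kq.
  rewrite mul0r (_ : K = set0) ?measure0//; apply/seteqP; split => // x /Kq[].
  by move=> q; rewrite in_nil.
pose C : set 'rV[R]_n := [set v | forall i, v ord0 i \in `[q ord0 i - r, q ord0 i + r]].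
have mC : measurable C.
  by apply: (@measurable_row_box _ _ (fun i => [set` `[q ord0 i - r, q ord0 i + r]])).
rewrite -(setUIDK K C); apply: le_trans (measureU2 _ _ _) _.
- exact: measurableI.
- exact: measurableD.
apply: (@le_trans _ _ (((2 * r) ^+ n)%:E + ((size s)%:R * (2 * r) ^+ n)%:E)%E); last first.
  rewrite -EFinD lee_fin [size (q :: s)]/= -(natr1 (size s)).
  by move: ((2 * r) ^+ n) (size s)%:R => X Y; lra.
apply: leeD.
  rewrite -(lebesgue_row_closed_ball q r0); apply: le_measure; rewrite ?inE//.
  exact: measurableI.
apply: IH; first exact: measurableD.
move=> x [/Kq[p]]; rewrite inE => /predU1P[->|ps] xq nC; last by exists p.
exfalso; apply: nC => i; rewrite in_itv/=.
have := le_trans (coord_norm (x - q) i) xq; rewrite !mxE ler_norml => /andP[? ?].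
by apply/andP; split; lra.
Qed.

(** Packing against covering: for a maximal [e]-separated family in [K'], the cubes of side [e]
    about its points are disjoint inside the neighborhood [V e], while cubes of side [2 * L * e]
    about the image points cover [K]. Then [e] tends to zero. The factor 2 is the ratio between
    covering and packing radii. *)
Lemma lipschitz_image_measure_le (K K' : set 'rV[R]_n) (f : 'rV[R]_n -> 'rV[R]_n)
    (L : R) : 0 <= L -> measurable K -> compact K' ->
  (forall x, K x -> exists2 p, K' p & x = f p) ->
  (forall p q, K' p -> K' q -> `|f p - f q| <= L * `|p - q|) ->
  (mu K <= ((2 * L) ^+ n)%:E * mu K')%E.
Proof.
move=> L0 mK cK' Kf fL.
have clK' : closed K' by apply: compact_closed => //; exact: norm_hausdorff.
have [M [Mr K'M]] := compact_bounded cK'.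
pose M1 : R := `|M| + 1.
have M1K x : K' x -> `|x| <= M1.
  by move=> Kx; apply: K'M Kx; rewrite /M1 (le_lt_trans (ler_norm _))// ltrDl.
have M10 : 0 <= M1 by rewrite addr_ge0.
pose V (e : R) : set 'rV[R]_n := \bigcup_(p in K') ball p e.
have mV e : measurable (V e).
  by apply: open_measurable_row; apply: bigcup_open => p _; exact: ball_open.
have VM e : e <= 1 -> V e `<=` cbox (M1 + 1).
  move=> e1 x [p Kp]; rewrite /= -ball_normE /ball_/= => px.
  apply/cboxP; first by rewrite addr_ge0.
  rewrite -(subrK p x) addrC (le_trans (ler_normD _ _))// lerD// ?M1K//.
  by rewrite distrC (le_trans (ltW px)).
have V1 : (mu (V 1%R) < +oo)%E.
  apply: (@le_lt_trans _ _ (mu (cbox (M1 + 1)))).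
    by apply: le_measure; rewrite ?inE//; [exact: cbox_measurable|exact: VM].
  by rewrite lebesgue_row_cbox ?ltry// addr_ge0.
have step e : 0 < e -> e <= 1 -> (mu K <= ((2 * L) ^+ n)%:E * mu (V e))%E.
  move=> e0 e1.
  have Ve_fin : mu (V e) \is a fin_num.
    rewrite ge0_fin_numE//; apply: le_lt_trans V1.
    apply: le_measure; rewrite ?inE// => x [p Kp px]; exists p => //.
    exact: le_ball px.
  have en0 : 0 < e ^+ n by rewrite exprn_gt0.
  (* The possible sizes of separated families are bounded by volume, so a largest one exists; by
     maximality it is an [e]-net of [K']. *)
  pose P N := `[< exists s : seq 'rV[R]_n,
    [/\ size s = N, separated e s & forall q, q \in s -> K' q] >].
  have bound s : separated e s -> (forall q, q \in s -> K' q) ->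
      (size s)%:R * e ^+ n <= fine (mu (V e)).
    move=> ss sK; rewrite -lee_fin fineK// -(measure_separated_balls e0 ss).
    apply: le_measure; rewrite ?inE//.
      by apply: bigsetU_measurable => p _; exact: ballM.
    move=> x; rewrite -bigcup_seq => -[p /= ps px]; exists p; first exact: sK.
    by apply: le_ball px; rewrite ler_pdivrMr// ler_peMr// ?ler1n// ltW.
  have exP : exists N, P N.
    by exists 0; apply/asboolP; exists [::]; split => // q; rewrite in_nil.
  have bP N : P N -> (N <= (Num.trunc (fine (mu (V e)) / e ^+ n)).+1)%N.
    move=> /asboolP[s [<- ss sK]]; rewrite -(ler_nat R).
    apply: le_trans (ltW (truncnS_gt _)).
    by rewrite ler_pdivlMr//; exact: bound.
  have [N /asboolP[s [sN ss sK]] maxN] := ex_maxnP exP bP.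
  have near_s p : K' p -> exists2 q, q \in s & `|p - q| <= e.
    move=> Kp; apply: contrapT => nq.
    have : P N.+1.
      apply/asboolP; exists (p :: s); split => /=; first by rewrite sN.
        apply/andP; split => //; apply/allP => q qs; rewrite leNgt; apply/negP => pq.
        by apply: nq; exists q => //; exact: ltW.
      by move=> q; rewrite inE => /predU1P[->//|]; exact: sK.
    by move=> /maxN; rewrite ltnn.
  apply: (@le_trans _ _ ((size (map f s))%:R * (2 * (L * e)) ^+ n)%:E).
    apply: measure_cubes => //; first by rewrite mulr_ge0// ltW.
    move=> x /Kf[p Kp ->]; have [q qs pq] := near_s _ Kp.
    exists (f q); first exact: map_f.
    by rewrite (le_trans (fL _ _ Kp (sK _ qs)))// ler_wpM2l.
  rewrite size_map mulrA exprMn mulrCA EFinM lee_pmul//.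
  - by rewrite lee_fin exprn_ge0// mulr_ge0.
  - by rewrite lee_fin mulr_ge0// ltW.
  - by rewrite -(fineK Ve_fin) lee_fin; exact: bound.
pose W k := V k.+1%:R^-1.
have W1 k : k.+1%:R^-1 <= 1 :> R by rewrite invf_le1// ler1n.
have capW : \bigcap_k W k = K'.
  apply/seteqP; split => x; last first.
    by move=> Kx k _; exists x => //; exact: ballxx.
  move=> Wx; apply: clK' => B /nbhs_ballP[e /= e0 eB].
  have [k _ /(_ _ (leqnn k))/= ke] := near_infty_natSinv_lt (PosNum e0).
  have [p Kp px] := Wx k I; exists p; split => //; apply: eB; apply: ball_sym.
  by apply: le_ball px; exact: ltW.
(* The neighborhoods decrease to [K'] because it is closed, and [V 1] has finite measure. *)
have cW : mu \o W @ \oo --> mu K'.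
  rewrite -capW; apply: nonincreasing_cvg_mu => //.
  - by rewrite /W invr1.
  - by move=> k; exact: mV.
  - by rewrite capW; exact: closed_measurable_row.
  - move=> a b ab; apply/subsetPset => x [p Kp px]; exists p => //.
    by apply: le_ball px; rewrite lef_pV2 ?posrE// ler_nat ltnS.
have cW' : (fun k => ((2 * L) ^+ n)%:E * mu (W k))%E @ \oo -->
    (((2 * L) ^+ n)%:E * mu K')%E by exact: cvgeZl.
rewrite -(cvg_lim _ cW')//; apply: lime_ge; first by apply/cvg_ex; eexists; exact: cW'.
by apply: nearW => k; exact: step.
Qed.

End null_sets.

(** * The distance function and its cut set *)

Section distance.
Context {R : realType} (d : nat) (W : set 'rV[R]_d).
Hypothesis openW : open W.
Hypothesis W0 : ~` W !=set0.
Local Notation del := (dist_compl W).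
Implicit Types x y z : 'rV[R]_d.

Let closedCW : closed (~` W). Proof. by rewrite closedC. Qed.

Lemma dist_compl_le x y : ~ W y -> del x <= enorm (x - y).
Proof.
move=> Wy; apply: ge_inf; last by exists y.
by exists 0 => _ [z _ <-]; exact: enorm_ge0.
Qed.

Lemma dist_compl_ge x r : (forall y, ~ W y -> r <= enorm (x - y)) -> r <= del x.
Proof.
have [y0 Wy0] := W0.
move=> H; apply: lb_le_inf; first by exists (enorm (x - y0)), y0.
by move=> _ [z Wz <-]; exact: H.
Qed.

Lemma dist_compl_ge0 x : 0 <= del x.
Proof. by apply: dist_compl_ge => y _; exact: enorm_ge0. Qed.

Lemma dist_compl_lipschitz x y : del x - del y <= enorm (x - y).
Proof.
rewrite lerBlDr -lerBlDl; apply: dist_compl_ge => z Wz.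
by have := dist_compl_le x Wz; have := enormB_trans y x z; lra.
Qed.

Lemma dist_compl_continuous : continuous del.
Proof.
apply: (@lipschitz_enorm_continuous _ _ _ 1) => // x y.
by rewrite mul1r dist_compl_lipschitz.
Qed.

(** Feet are sought in the complement, over which [del] is an infimum; [nearest_pointP] identifies
    them with the nearest boundary points. *)
Definition foot x y := ~ W y /\ enorm (x - y) = del x.

Lemma foot_exists x : exists y, foot x y.
Proof.
have [y0 Wy0] := W0.
pose A := [set y | ~ W y /\ enorm (x - y) <= enorm (x - y0)].
have cont : continuous (fun y => enorm (x - y)).
  apply: (@lipschitz_enorm_continuous _ _ _ 1) => // a b.
  by rewrite mul1r; have := enormB_trans b x a; rewrite (enormBC b a); lra.
have cA : compact A.
  apply: (@enorm_closed_compact _ _ _ (enorm x + enorm (x - y0))).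
    move=> y [_ H]; have := enorm_add_lb (- y) x.
    by rewrite enormN [- y + x]addrC; have := H; lra.
  apply: (@closedI _ (~` W) [set y | enorm (x - y) <= enorm (x - y0)]) => //.
  have /continuous_closedP H := cont.
  by apply: (H [set r | r <= enorm (x - y0)]); exact: closed_le.
have [y /set_mem[Wy yy0] ymin] := EVT_min_rV (ex_intro _ y0 (conj Wy0 (lexx _)))
  cA (continuous_subspaceT cont).
exists y; split => //; apply/eqP; rewrite eq_le dist_compl_le// andbT.
apply: dist_compl_ge => z Wz.
have [zy0|zy0] := leP (enorm (x - z)) (enorm (x - y0)).
  by apply: ymin; apply/mem_set; split.
by rewrite (le_trans yy0)// ltW.
Qed.

Lemma dist_compl_gt0 x : W x -> 0 < del x.
Proof.
move=> Wx; have [y [Wy <-]] := foot_exists x; apply: enorm_gt0.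
by rewrite subr_eq0; apply: contra_notN Wy => /eqP <-.
Qed.

Lemma dist_compl_gt0P x : 0 < del x -> W x.
Proof.
move=> d0; apply: contrapT => Wx; have := dist_compl_le x Wx.
by rewrite subrr enorm0; lra.
Qed.

(** The distance to [y] bounds [del] from above, and the Lipschitz bound from [x] gives the matching
    lower bound. *)
Lemma foot_segment x y t : foot x y -> 0 <= t -> t <= 1 ->
  foot (y + t *: (x - y)) y /\ del (y + t *: (x - y)) = t * del x.
Proof.
move=> [Wy xy] t0 t1.
have E : enorm (y + t *: (x - y) - y) = t * del x.
  by rewrite addrC addKr enormZ ger0_norm// xy.
suff Ed : del (y + t *: (x - y)) = t * del x by split => //; split => //; rewrite E.
apply/eqP; rewrite eq_le -{1}E dist_compl_le//=.
have := dist_compl_lipschitz x (y + t *: (x - y)).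
rewrite (_ : x - (y + t *: (x - y)) = (1 - t) *: (x - y)).
  by rewrite enormZ xy ger0_norm ?subr_ge0//; lra.
by rewrite scalerBl scale1r opprD addrA.
Qed.

(** A foot belongs to the boundary because the points of the segment towards [x] have positive
    [del], so they lie in [W] and accumulate at the foot. *)
Lemma nearest_pointP x y : W x -> nearest_point W x y <-> foot x y.
Proof.
move=> Wx; have W_in : interior W = W by apply/interior_id.
have foot_boundary z : foot x z -> boundary W z.
  move=> xz; split; last by rewrite W_in; have [] := xz.
  move=> B /nbhs_enorm[e e0 eB].
  have dx := dist_compl_gt0 Wx.
  pose t := Num.min 1 (e / (del x * 2)).
  have t0 : 0 < t by rewrite lt_min ltr01 divr_gt0// mulr_gt0.
  have t1 : t <= 1 by rewrite ge_min lexx.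
  exists (z + t *: (x - z)); split.
    by apply: dist_compl_gt0P; rewrite (foot_segment xz (ltW t0) t1).2 mulr_gt0.
  apply: eB; rewrite addrC addKr enormZ gtr0_norm// xz.2.
  apply: (@le_lt_trans _ _ (e / (del x * 2) * del x)).
    by rewrite ler_wpM2r ?ge_min ?lexx ?orbT// ltW.
  rewrite (_ : _ * del x = e / 2); last by field; rewrite gt_eqF.
  by lra.
split; last first.
  move=> xy; split; first exact: foot_boundary.
  by move=> z [_ +]; rewrite W_in xy.2; exact: dist_compl_le.
move=> [[_ +] ymin]; rewrite W_in => Wy; split => //.
have [z xz] := foot_exists x.
apply/eqP; rewrite eq_le dist_compl_le// andbT -xz.2.
exact/ymin/foot_boundary.
Qed.

(* [extendable r x]: the minimizing segment from the boundary to [x] stays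
   minimizing on a further length [r]. *)
Definition extendable r x := exists2 z, enorm (z - x) <= r & del x + r <= del z.

(** The triangle inequality from [z] to [y] through [x] is an equality, which forces [z - x] to be a
    multiple of [x - y]: the square of [z - x - (r / del x) *: (x - y)] expands to zero. *)
Lemma extendable_foot r x y : W x -> 0 < r -> foot x y -> forall z,
  enorm (z - x) <= r -> del x + r <= del z ->
  z = x + (r / del x) *: (x - y) /\ foot z y.
Proof.
move=> Wx r0 [Wy xy] z zx xz; have dx := dist_compl_gt0 Wx.
have zy : enorm (z - y) <= del z.
  by have := enormB_trans x z y; rewrite xy; lra.
have fzy : foot z y by split => //; apply/eqP; rewrite eq_le zy dist_compl_le.
have E1 : enorm (z - x) = r by have := enormB_trans x z y; have := fzy.2; lra.
have E2 : enorm (z - y) = r + del x by have := enormB_trans x z y; have := fzy.2; lra.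
split => //.
suff : z - x = (r / del x) *: (x - y) by move=> <-; rewrite addrC subrK.
apply/eqP; rewrite -subr_eq0; apply/eqP/dotv_eq0.
have D1 : dotv (z - x) (z - x) = r ^+ 2 by rewrite -enorm_sqr E1.
have D2 : dotv (x - y) (x - y) = del x ^+ 2 by rewrite -enorm_sqr xy.
have D3 : dotv (z - x) (x - y) = r * del x.
  have : dotv (z - y) (z - y) = (r + del x) ^+ 2 by rewrite -enorm_sqr E2.
  rewrite (_ : z - y = (z - x) + (x - y)); last by rewrite addrA subrK.
  move: (z - x) (x - y) D1 D2 => u v D1 D2.
  by rewrite !dotvE D1 D2 (dotvC v); lra.
move: (z - x) (x - y) D1 D2 D3 => u v D1 D2 D3.
rewrite !dotvE (dotvC v) D1 D2 D3.
by field; rewrite gt_eqF.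
Qed.

(** The rays from both feet through [x] reach the same point [z] at distance [r] from [x]. *)
Lemma extendable_unique r x y y' : W x -> 0 < r -> extendable r x ->
  foot x y -> foot x y' -> y = y'.
Proof.
move=> Wx r0 [z zx xz] fy fy'.
have [E _] := extendable_foot Wx r0 fy zx xz.
have [E' _] := extendable_foot Wx r0 fy' zx xz.
have := E; rewrite E' => /addrI /(scalerI _) H.
have : x - y' = x - y by apply: H; rewrite gt_eqF// divr_gt0// dist_compl_gt0.
by move=> /addrI /oppr_inj.
Qed.

Lemma extendable_le r s x : W x -> 0 < s -> s <= r -> extendable r x ->
  extendable s x.
Proof.
move=> Wx s0 sr [z zx xz]; have r0 := lt_le_trans s0 sr.
have [y fy] := foot_exists x.
have [Ez fz] := extendable_foot Wx r0 fy zx xz.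
have dx := dist_compl_gt0 Wx.
exists (x + (s / del x) *: (x - y)).
  rewrite addrC addKr enormZ fy.2 ger0_norm; first by rewrite divfK ?gt_eqF.
  by apply: divr_ge0; exact: ltW.
have := dist_compl_lipschitz z (x + (s / del x) *: (x - y)).
rewrite Ez opprD addrACA subrr add0r -scalerBl enormZ fy.2 -mulrBl ger0_norm; last first.
  by rewrite divr_ge0 ?subr_ge0// ltW.
by rewrite divfK ?gt_eqF// -Ez; lra.
Qed.

(** Failing to extend means that the maximum of [del] on a closed ball is less than [del x + r].
    Moving [x0] changes each side by at most the displacement, so a third of the gap can be
    afforded. *)
Lemma extendable_closed r : 0 <= r -> closed [set x | extendable r x].
Proof.
move=> r0; rewrite -openC; rewrite openE => x0 /= nx0; apply/nbhs_enorm.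
have cont : continuous (fun z => enorm (z - x0)).
  apply: (@lipschitz_enorm_continuous _ _ _ 1) => // a b.
  by rewrite mul1r; have := enormB_trans b a x0; lra.
pose A := [set z | enorm (z - x0) <= r].
have cA : compact A.
  apply: (@enorm_closed_compact _ _ _ (r + enorm x0)).
    by move=> z Az; have := enorm_add_lb z (- x0); rewrite enormN; move: Az; rewrite /A/=; lra.
  have /continuous_closedP H := cont.
  by apply: (H [set s | s <= r]); exact: closed_le.
have Ax0 : A !=set0 by exists x0; rewrite /A/= subrr enorm0.
have [m /set_mem Am mmax] := EVT_max_rV Ax0 cA (continuous_subspaceT dist_compl_continuous).
have me : del m < del x0 + r.
  by rewrite ltNge; apply/negP => H; apply: nx0; exists m.
exists ((del x0 + r - del m) / 3); first by rewrite divr_gt0// subr_gt0.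
move=> x xx0 [z zx xz].
have Az : A (z - (x - x0)) by rewrite /A/= opprB addrA addrAC addrK.
have := mmax _ (mem_set Az).
have := dist_compl_lipschitz z (z - (x - x0)).
rewrite (_ : z - (z - (x - x0)) = x - x0); last by rewrite opprB addrC subrK.
have := dist_compl_lipschitz x0 x; rewrite enormBC; lra.
Qed.

(** Extendability passes to shorter lengths, so the lengths [1 / (k + 1)] detect every extension and
    the cut is visibly measurable. *)
Definition cut := W `\` \bigcup_k [set x | extendable k.+1%:R^-1 x].

Lemma measurable_cut : measurable cut.
Proof.
apply: measurableD; first exact: open_measurable_row.
apply: bigcupT_measurable => k; apply: closed_measurable_row.
by apply: extendable_closed.
Qed.

Lemma not_cut x : W x -> ~ cut x -> exists2 r, 0 < r & extendable r x.
Proof.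
move=> Wx nx; have [[k _ xk]|nk] :=
  pselect ((\bigcup_k [set x | extendable k.+1%:R^-1 x]) x).
  by exists k.+1%:R^-1.
by exfalso; apply: nx; split.
Qed.

Lemma cut_not_extendable r x : cut x -> 0 < r -> ~ extendable r x.
Proof.
move=> [Wx nx] r0 rx; apply: nx.
have [k _ /(_ _ (leqnn k))/= kr] := near_infty_natSinv_lt (PosNum r0).
by exists k => //; apply: (extendable_le Wx _ (ltW kr)).
Qed.

(** Each foot is at least as close to its own point as the other foot is; adding the two
    inequalities shows that [dotv (x - x') (y - y')] is nonnegative. The difference of the shrunk
    points is [(1 - t) *: (y - y') + t *: (x - x')]; pair it with [y - y'] and apply
    Cauchy-Schwarz. *)
Lemma foot_lipschitz x y x' y' t : foot x y -> foot x' y' -> 0 < t -> t < 1 ->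
  (1 - t) * enorm (y - y') <=
    enorm ((y + t *: (x - y)) - (y' + t *: (x' - y'))).
Proof.
move=> [Wy xy] [Wy' xy'] t0 t1.
have H1 : dotv (x - y) (x - y) <= dotv (x - y') (x - y').
  by rewrite -le_enorm xy dist_compl_le.
have H2 : dotv (x' - y') (x' - y') <= dotv (x' - y) (x' - y).
  by rewrite -le_enorm xy' dist_compl_le.
set a := y + t *: _; set b := y' + t *: _.
have H : (1 - t) * dotv (y - y') (y - y') <= dotv (a - b) (y - y').
  have E1 : x - y' = (x - y) + (y - y') by rewrite addrA subrK.
  have E2 : x' - y = (x' - y') - (y - y') by rewrite opprB addrA subrK.
  have E3 : a - b = (1 - t) *: (y - y') + t *: ((x - y) - (x' - y')) + t *: (y - y').
    by apply/rowP => i; rewrite /a /b !mxE; ring.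
  move: H1 H2; rewrite E1 E2 E3.
  move: (x - y) (x' - y') (y - y') => u v w.
  rewrite !dotvE !(dotvC w) => H1 H2.
  have H3 : 0 <= t * (dotv u w - dotv v w + dotv w w).
    by apply: mulr_ge0; [exact: ltW|lra].
  by move: H3; rewrite mulrBr; lra.
have [->|w0] := eqVneq (y - y') 0.
  by rewrite enorm0 mulr0 enorm_ge0.
rewrite -(ler_pM2r (enorm_gt0 w0)) -mulrA -expr2 enorm_sqr.
exact: le_trans H (dotv_le _ _).
Qed.

Let shrink (K : set 'rV[R]_d) (t : R) : set 'rV[R]_d :=
  [set a | exists x y, [/\ K x, foot x y & a = y + t *: (x - y)]].

(** A common point [a] lies strictly inside a minimizing segment, so its foot is unique and [x],
    [x'] are on one ray from it. As [t < s], [x'] comes before [x], so its segment extends up to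
    [x], which the cut forbids. *)
Let shrink_disjoint K s t : K `<=` cut -> 0 < t -> t < s -> s < 1 ->
  forall a, shrink K t a -> ~ shrink K s a.
Proof.
move=> Kcut t0 ts s1 a [x [y [/Kcut cx fy ax]]] [x' [y' [/Kcut cx' fy' ax']]].
have s0 := lt_trans t0 ts; have t1 := lt_trans ts s1.
have [Wx _] := cx; have [Wx' _] := cx'.
have dx := dist_compl_gt0 Wx.
have [fa da] := foot_segment fy (ltW t0) (ltW t1).
have [fa' da'] := foot_segment fy' (ltW s0) (ltW s1).
rewrite -ax in fa da; rewrite -ax' in fa' da'.
have Wa : W a by apply: dist_compl_gt0P; rewrite da mulr_gt0.
have r0 : 0 < (1 - t) * del x by rewrite mulr_gt0// subr_gt0.
have yy' : y = y'.
  apply: (extendable_unique Wa r0 _ fa fa'); exists x; last by rewrite da; lra.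
  rewrite ax (_ : x - (y + t *: (x - y)) = (1 - t) *: (x - y)).
    by rewrite enormZ fy.2 gtr0_norm ?subr_gt0.
  by rewrite scalerBl scale1r opprD addrA.
subst y'.
have E : x' - y = (t / s) *: (x - y).
  have : t *: (x - y) = s *: (x' - y) by apply: (@addrI _ y); rewrite -ax.
  move=> H; rewrite mulrC -scalerA H scalerA mulVf ?gt_eqF// scale1r.
  by [].
have dx' : del x' = t / s * del x.
  by rewrite -fy'.2 E enormZ fy.2 gtr0_norm// divr_gt0.
have ts1 : 0 < 1 - t / s by rewrite subr_gt0 ltr_pdivrMr// mul1r.
apply: (@cut_not_extendable ((1 - t / s) * del x) x' cx'); first exact: mulr_gt0.
exists x; last by rewrite dx'; lra.
rewrite (_ : x - x' = (1 - t / s) *: (x - y)); first by rewrite enormZ fy.2 gtr0_norm.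
by rewrite scalerBl scale1r -E opprB addrA subrK.
Qed.

(** A point of [K] may have several feet, so the shrinking is a continuous image not of [K] but of
    the compact set of pairs of a point and one of its feet. *)
Let shrink_compact K t : compact K -> compact (shrink K t).
Proof.
move=> cK; have [M [_ KM]] := compact_bounded cK.
pose M1 : R := d%:R * (`|M| + 1).
have M1K x : K x -> enorm x <= M1.
  move=> Kx; apply: le_trans (enorm_le_norm _) _; rewrite ler_wpM2l//.
  by apply: KM Kx; rewrite (le_lt_trans (ler_norm _))// ltrDl.
have [y0 Wy0] := W0.
(* A foot [y] of [x] satisfies [enorm y <= enorm x + del x], and [del x <= enorm (x - y0)]. *)
pose B := [set y : 'rV[R]_d | enorm y <= M1 + (M1 + enorm y0)].
have cB : compact B.
  apply: (@enorm_closed_compact _ _ _ (M1 + (M1 + enorm y0))) => //.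
  have /continuous_closedP H := @enorm_continuous R d.
  by apply: (H [set s | s <= M1 + (M1 + enorm y0)]); exact: closed_le.
pose g (p : 'rV[R]_d * 'rV[R]_d) := enorm (p.1 - p.2) - del p.1.
have sub_cont : continuous (fun p : 'rV[R]_d * 'rV[R]_d => p.1 - p.2).
  by move=> p; apply: cvgB; [exact: cvg_fst|exact: cvg_snd].
have g_cont : continuous g.
  move=> p; apply: cvgB.
    apply: (@continuous_comp _ _ _ (fun p : 'rV[R]_d * 'rV[R]_d => p.1 - p.2) (@enorm R d)).
      exact: sub_cont.
    exact: enorm_continuous.
  apply: (@continuous_comp _ _ _ (fst : 'rV[R]_d * 'rV[R]_d -> _) del).
    exact: cvg_fst.
  exact: dist_compl_continuous.
pose C := (K `*` B) `&` (g @^-1` [set 0] `&` snd @^-1` (~` W)).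
have cC : compact C.
  apply: compact_closedI; first exact: compact_setX.
  apply: closedI.
    by have /continuous_closedP := g_cont; apply; exact: closed_eq.
  have snd_cont : continuous (snd : 'rV[R]_d * 'rV[R]_d -> 'rV[R]_d).
    by move=> p; exact: cvg_snd.
  by have /continuous_closedP H := snd_cont; exact: (H (~` W)).
rewrite (_ : shrink K t = (fun p => p.2 + t *: (p.1 - p.2)) @` C).
  apply: continuous_compact => //; apply: continuous_subspaceT => p.
  apply: cvgD; first exact: cvg_snd.
  by apply: cvgZr; exact: sub_cont.
apply/seteqP; split => a.
  move=> [x [y [Kx fy ->]]]; exists (x, y) => //; split; split => //=.
  - have := enorm_add_lb (- y) x; rewrite enormN [- y + x]addrC fy.2.
    have := dist_compl_le x Wy0; have := enormD x (- y0); rewrite enormN.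
    by have := M1K _ Kx; rewrite /B/=; lra.
  - by rewrite /g/= fy.2 subrr.
  - by have [] := fy.
move=> [[x y] [[/= Kx _] [/= gxy Wy]] <-]; exists x, y; split => //; split => //.
by apply/eqP; rewrite -subr_eq0; apply/eqP.
Qed.

Local Notation mu := (@lebesgue_row R d).

(* The sets [shrink K t] of a compact [K] in the cut are pairwise disjoint, lie
   in a fixed box, and [K] is the image of each of them under a map with a
   Lipschitz constant independent of [t], so [K] is null. *)
Lemma lebesgue_cut : mu cut = 0%E.
Proof.
apply: compact_null_negligible measurable_cut _ => K cK Kcut.
have clK : closed K by apply: compact_closed => //; exact: norm_hausdorff.
have mK := closed_measurable_row clK.
have [r rE] : exists r : nat -> R, forall j, r j = j.+1%:R^-1.
  by exists (fun j => j.+1%:R^-1).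
(* Distinct factors below 1, and at least 1/4 so that the map back to [K] has a Lipschitz constant
   independent of [j]. *)
pose t (j : nat) : R := (1 + r j) / 4.
have j1 (j : nat) : (0 < r j) && (r j <= 1).
  by rewrite rE invr_gt0 ltr0n/= invf_le1// ler1n.
have t0 j : 0 < t j by rewrite /t; have /andP[? ?] := j1 j; lra.
have t2 j : t j <= 1 / 2 by rewrite /t; have /andP[? ?] := j1 j; lra.
have t4 j : 1 / 4 <= t j by rewrite /t; have /andP[? ?] := j1 j; lra.
have cS j : compact (shrink K (t j)) by exact: shrink_compact.
have mS j : measurable (shrink K (t j)).
  by apply: closed_measurable_row; apply: compact_closed (cS j); exact: norm_hausdorff.
have [M [_ KM]] := compact_bounded cK.
pose M1 : R := d%:R * (`|M| + 1).
have M1K x : K x -> enorm x <= M1.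
  move=> Kx; apply: le_trans (enorm_le_norm _) _; rewrite ler_wpM2l//.
  by apply: KM Kx; rewrite (le_lt_trans (ler_norm _))// ltrDl.
have M10 : 0 <= M1 by rewrite mulr_ge0// addr_ge0.
have [y0 Wy0] := W0.
pose M2 : R := M1 + (M1 + enorm y0).
have M20 : 0 <= M2 by rewrite !addr_ge0// enorm_ge0.
have SM j : shrink K (t j) `<=` cbox M2.
  move=> a [x [y [Kx fy ->]]]; apply/cboxP => //; apply: le_trans (norm_le_enorm _) _.
  rewrite (_ : _ + _ = x + (t j - 1) *: (x - y)); last first.
    by apply/rowP => i; rewrite !mxE; ring.
  apply: le_trans (enormD _ _) _; rewrite enormZ fy.2 lerD ?M1K//.
  have -> : `|t j - 1| = 1 - t j by rewrite ler0_norm ?opprB//; have := t2 j; lra.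
  apply: (@le_trans _ _ (1 * del x)).
    by rewrite ler_wpM2r ?dist_compl_ge0//; have := t0 j; lra.
  rewrite mul1r; have := dist_compl_le x Wy0; have := enormD x (- y0); rewrite enormN.
  by have := M1K _ Kx; lra.
(* By [foot_lipschitz], [t j * enorm (x - x')] is at most [2 * enorm (a - b)]; dividing by
   [t j >= 1/4] gives 8, and [d] compares the Euclidean norm with the sup norm. *)
pose L : R := 8 * d%:R.
have L0 : 0 <= L by rewrite mulr_ge0.
have KS j : (mu K <= ((2 * L) ^+ d)%:E * mu (shrink K (t j)))%E.
  (* The map back is a choice of preimage; [lip] with [a = b] shows that it recovers the original
     point. *)
  have fP a : exists x, shrink K (t j) a ->
      exists y, [/\ K x, foot x y & a = y + t j *: (x - y)].
    have [[x [y H]]|na] := pselect (shrink K (t j) a); last by exists 0.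
    by exists x => _; exists y.
  have [f fE] := choice fP.
  have lip a b : shrink K (t j) a -> shrink K (t j) b -> forall x x' y y',
      foot x y -> foot x' y' -> a = y + t j *: (x - y) -> b = y' + t j *: (x' - y') ->
      enorm (x - x') <= 8 * enorm (a - b).
    move=> _ _ x x' y y' fy fy' ax bx'.
    have := foot_lipschitz fy fy' (t0 j); rewrite -ax -bx'.
    have t1 : t j < 1 by have := t2 j; lra.
    move=> /(_ t1) H.
    have E : x - x' = (t j)^-1 *: ((a - b) - (1 - t j) *: (y - y')).
      have tn : t j != 0 by rewrite gt_eqF.
      by rewrite ax bx'; apply/rowP => i; rewrite !mxE; field.
    rewrite E enormZ gtr0_norm ?invr_gt0//.
    rewrite -(ler_pM2l (t0 j)) mulrA divff ?gt_eqF// mul1r.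
    have := enormD (a - b) (- ((1 - t j) *: (y - y'))); rewrite enormN enormZ.
    rewrite ger0_norm; last by rewrite subr_ge0 ltW.
    have := ler_wpM2r (enorm_ge0 (a - b)) (t4 j).
    by lra.
  apply: (lipschitz_image_measure_le (f := f)) => //.
    move=> x Kx; have [y fy] := foot_exists x.
    exists (y + t j *: (x - y)); first by exists x, y.
    have Sx : shrink K (t j) (y + t j *: (x - y)) by exists x, y.
    have [y' [Kx' fy' ax']] := fE _ Sx.
    apply/eqP; rewrite -subr_eq0; apply/eqP/enorm_eq0/le_anti.
    rewrite enorm_ge0 andbT; apply: le_trans (lip _ _ Sx Sx _ _ _ _ fy fy' erefl ax') _.
    by rewrite subrr enorm0 mulr0.
  move=> a b Sa Sb; have [y [_ fy ay]] := fE _ Sa; have [y' [_ fy' by']] := fE _ Sb.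
  apply: le_trans (norm_le_enorm _) _.
  apply: le_trans (lip _ _ Sa Sb _ _ _ _ fy fy' ay by') _.
  by rewrite /L -mulrA ler_wpM2l// enorm_le_norm.
have Sfin j : mu (shrink K (t j)) \is a fin_num.
  rewrite ge0_fin_numE//; apply: (@le_lt_trans _ _ (mu (cbox M2))).
    by apply: le_measure; [rewrite inE; exact: mS|rewrite inE; exact: cbox_measurable|exact: SM].
  by rewrite lebesgue_row_cbox// ltry.
have Kfin : mu K \is a fin_num.
  rewrite ge0_fin_numE//; apply: le_lt_trans (KS 0) _.
  by rewrite -(fineK (Sfin 0)) -EFinM ltry.
have disj : trivIset setT (fun j => shrink K (t j)).
  apply: ltn_trivIset => i j ij.
  have tij : t i < t j.
    by rewrite /t ltr_pM2r ?invr_gt0// ltrD2l !rE ltf_pV2 ?posrE// ltr_nat ltnS.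
  apply/seteqP; split => // a [Sj Si].
  apply: (shrink_disjoint Kcut (t0 i) tij _ Si Sj).
  by have := t2 j; lra.
set k := fine (mu K).
have bound (m : nat) : m%:R * k <= (2 * L) ^+ d * (2 * M2) ^+ d.
  rewrite -lee_fin.
  have -> : m%:R * k = \sum_(j < m) k by rewrite sumr_const card_ord mulr_natl.
  apply: (@le_trans _ _ (\sum_(j < m) ((2 * L) ^+ d)%:E * mu (shrink K (t j)))%E).
    by rewrite -sumEFin; apply: lee_sum => j _; rewrite /k fineK.
  rewrite EFinM.
  rewrite -ge0_sume_distrr//; apply: lee_pmul => //.
  - by rewrite lee_fin exprn_ge0// mulr_ge0.
  - by apply: sume_ge0.
  rewrite -(lebesgue_row_cbox d M20) -(@measure_bigsetU _ _ _ mu (fun j => shrink K (t j)))//.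
  apply: le_measure; rewrite ?inE//.
  - exact: bigsetU_measurable.
  - exact: cbox_measurable.
  elim/big_ind : _ => [a []|A B HA HB a [/HA|/HB]|j _] //; exact: SM.
have k0 : 0 <= k by rewrite fine_ge0.
suff : k = 0 by rewrite -(fineK Kfin) -/k => ->.
apply/eqP; apply: contraT => kn0.
have kp : 0 < k by rewrite lt_def kn0.
have := bound (Num.trunc ((2 * L) ^+ d * (2 * M2) ^+ d / k)).+1.
rewrite -ler_pdivlMr// => H.
have := truncnS_gt ((2 * L) ^+ d * (2 * M2) ^+ d / k).
by rewrite ltNge H.
Qed.

End distance.

(** * Differential calculus *)

Section calculus.
Context {R : realType}.
Implicit Types n : nat.

(** A division-free form that also covers [h = 0], convenient for combining with explicit remainder
    bounds. *)
Lemma is_derive_epsP (V : normedModType R) (f : V -> R) (x v : V) (d : R) :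
  is_derive x v f d <->
  forall e : R, 0 < e -> exists2 r : R, 0 < r & forall h : R, `|h| < r ->
    `|f (x + h *: v) - f x - h * d| <= e * `|h|.
Proof.
split.
  move=> [df <-] e e0.
  have /cvgrPdist_le /(_ e e0) /nbhs_ballP[r /= r0 H] := df.
  exists r => // h hr; have [->|h0] := eqVneq h 0.
    by rewrite scale0r addr0 subrr mul0r subrr !normr0 mulr0.
  have := H h; rewrite /ball/= sub0r normrN => /(_ hr h0).
  rewrite -(ler_pM2r (_ : 0 < `|h|)) ?normr_gt0// -normrM distrC mulrBl.
  rewrite addrC (addrC x) [in X in X -> _]/GRing.scale/= mulrAC mulVf// mul1r.
  by rewrite (mulrC _ h) addrC.
move=> H; suff L : h^-1 *: ((f \o shift x) (h *: v) - f x) @[h --> 0^'] --> d.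
  by split; [apply/cvg_ex; exists d|apply/cvg_lim].
apply/cvgrPdist_le => e e0; have [r r0 Hr] := H _ e0.
apply/nbhs_ballP; exists r => // h; rewrite /ball/= sub0r normrN => hr h0.
have hp : 0 < `|h| by rewrite normr_gt0.
rewrite -(ler_pM2l hp) -normrM [leRHS]mulrC.
rewrite (_ : h * _ = - (f (x + h *: v) - f x - h * d)) ?normrN; first exact: Hr.
by rewrite /GRing.scale/= (addrC (h *: v)); field.
Qed.

Lemma is_derive_quadratic (V : normedModType R) (f : V -> R) (x v : V) (d C : R) :
  (forall h, `|f (x + h *: v) - f x - h * d| <= C * h ^+ 2) ->
  is_derive x v f d.
Proof.
move=> H; apply/is_derive_epsP => e e0; exists (e / (`|C| + 1)).
  by rewrite divr_gt0// ltr_wpDl.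
move=> h; rewrite ltr_pdivlMr ?ltr_wpDl// => hr; apply: le_trans (H h) _.
rewrite -real_normK ?num_real// expr2 mulrA ler_wpM2r//.
apply: le_trans (ltW hr); rewrite mulrC ler_wpM2l//.
by rewrite (le_trans (ler_norm _))// lerDl.
Qed.

Lemma is_derive_line (V : normedModType R) (f : V -> R) (u v : V) (t d : R) :
  is_derive (u + t *: v) v f d -> is_derive t 1 (fun s => f (u + s *: v)) d.
Proof.
move=> /is_derive_epsP H; apply/is_derive_epsP => e /H[r r0 Hr].
exists r => // h hr.
have E : u + t *: v + h *: v = u + (t + h *: 1) *: v.
  by rewrite -addrA -scalerDl [h *: 1]/GRing.scale/= mulr1.
by have := Hr h hr; rewrite E.
Qed.

Lemma MVT_line (g dg : R -> R) (s : R) :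
  (forall t : R, `|t| <= `|s| -> is_derive t 1 g (dg t)) ->
  exists2 c, `|c| <= `|s| & g s - g 0 = dg c * s.
Proof.
move=> H.
have cont (a b : R) : (forall t, t \in `[a, b] -> `|t| <= `|s|) ->
    {within `[a, b], continuous g}.
  move=> ab; apply: continuous_in_subspaceT => t /set_mem/ab tab.
  by apply/differentiable_continuous/derivable1_diffP; have [] := H t tab.
have [s0|s0] := leP 0 s.
  have ss t : t \in `[0, s] -> `|t| <= `|s|.
    by rewrite in_itv/= => /andP[t0 ts]; rewrite !ger0_norm.
  have [|c cs E] := @MVT_segment R g dg 0 s s0 _ (cont _ _ ss).
    by move=> t /subset_itv_oo_cc/ss/H.
  by exists c; [exact: ss|rewrite E subr0].
have ss t : t \in `[s, 0] -> `|t| <= `|s|.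
  by rewrite in_itv/= => /andP[t0 ts]; rewrite !ler0_norm ?lerN2// ltW.
have [|c cs E] := @MVT_segment R g dg s 0 (ltW s0) _ (cont _ _ ss).
  by move=> t /subset_itv_oo_cc/ss/H.
by exists c; [exact: ss|rewrite -opprB E sub0r mulrN opprK].
Qed.

Lemma MVT_itv (g dg : R -> R) (a b : R) : a < b ->
  (forall t : R, a <= t <= b -> is_derive t 1 g (dg t)) ->
  exists2 c, a < c < b & g b - g a = dg c * (b - a).
Proof.
move=> ab H.
have [t||c] := @MVT R g dg a b ab.
- by rewrite in_itv/= => /andP[? ?]; apply: H; rewrite !ltW.
- apply: continuous_in_subspaceT => t /set_mem/=; rewrite in_itv/= => /H[df _].
  by apply/differentiable_continuous/derivable1_diffP.
- by rewrite in_itv/= => cab; exists c.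
Qed.

(** Otherwise the mean value theorem on the two halves gives [dg c1 >= 0 >= dg c2] with [c1 < c2],
    although [dg] increases strictly. *)
Lemma strict_convex_midpoint (g dg ddg : R -> R) :
  (forall t : R, 0 <= t <= 1 -> is_derive t 1 g (dg t)) ->
  (forall t : R, 0 <= t <= 1 -> is_derive t 1 dg (ddg t)) ->
  (forall t, 0 <= t <= 1 -> 0 < ddg t) -> g 0 = g 1 -> g (1 / 2) < g 0.
Proof.
move=> dg1 dg2 pos g01; rewrite ltNge; apply/negP => H.
have [||c1 /andP[c10 c12] H1] := @MVT_itv g dg 0 (1 / 2).
- by rewrite divr_gt0.
- by move=> t /andP[? ?]; apply: dg1; apply/andP; split => //; lra.
have [||c2 /andP[c20 c21] H2] := @MVT_itv g dg (1 / 2) 1.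
- by lra.
- by move=> t /andP[? ?]; apply: dg1; apply/andP; split => //; lra.
have [||c3 /andP[c30 c31] H3] := @MVT_itv dg ddg c1 c2.
- by lra.
- by move=> t /andP[? ?]; apply: dg2; apply/andP; split => //; lra.
have c3p : 0 < ddg c3 * (c2 - c1).
  by rewrite mulr_gt0 ?subr_gt0; [lra|apply: pos; apply/andP; split; lra|lra].
lra.
Qed.

Lemma Ck_onW n k (U : set 'rV[R]_n) (f : 'rV[R]_n -> R) :
  Ck_on k.+1 U f -> Ck_on k U f.
Proof.
elim: k f => [|k IH] f /= [cf H]; first by split.
split => // i; have [df Hi] := H i; split => //.
by apply: IH.
Qed.

Lemma Ck_on_partial n k (U : set 'rV[R]_n) (f : 'rV[R]_n -> R) i :
  Ck_on k.+1 U f -> Ck_on k U (partial i f).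
Proof. by move=> /= [_ /(_ i)[]]. Qed.

Lemma continuous_enorm n (f : 'rV[R]_n -> R) x : {for x, continuous f} ->
  forall e : R, 0 < e -> exists2 r : R, 0 < r &
    forall y, enorm (y - x) < r -> `|f y - f x| <= e.
Proof.
move=> cf e e0; have : nbhs (f x) [set s | `|s - f x| <= e].
  apply/nbhs_normP; exists e => // s; rewrite /ball_/= distrC; exact: ltW.
by move=> /cf /nbhs_enorm.
Qed.

Lemma Ck_on_is_derive_partial n (U : set 'rV[R]_n) (f : 'rV[R]_n -> R) i x :
  Ck_on 1 U f -> U x -> is_derive x (delta_mx ord0 i) f (partial i f x).
Proof. by move=> [_ /(_ i)[df _]] Ux; apply: derivableP; exact: df. Qed.

Let trunc n k (v : 'rV[R]_n) : 'rV[R]_n :=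
  \row_i if (i < k)%N then v ord0 i else 0.

Let trunc_le n k (v : 'rV[R]_n) : enorm (trunc k v) <= enorm v.
Proof.
rewrite le_enorm; apply: ler_sum => i _; rewrite !mxE.
by case: ifP => // _; rewrite mul0r -expr2 sqr_ge0.
Qed.

(** [Ck_on] speaks of coordinate directions only. The increment along [v] is split into steps
    changing one coordinate at a time, through the truncations [trunc k w]; the mean value theorem
    and the continuity of the partial derivatives control each step. *)
Lemma C1_is_derive n (U : set 'rV[R]_n) (f : 'rV[R]_n -> R) x v :
  open U -> Ck_on 1 U f -> U x ->
  is_derive x v f (dotv v (gradient f x)).
Proof.
move=> oU C1 Ux; apply/is_derive_epsP => e e0.
pose e1 := e / (n%:R * enorm v + 1).
have nv0 : 0 <= n%:R * enorm v by rewrite mulr_ge0// enorm_ge0.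
have e10 : 0 < e1 by rewrite divr_gt0// ltr_wpDl.
have /nbhs_enorm[r0 r00 r0U] : nbhs x U by exact: open_nbhs_nbhs.
have /choice[r rP] (i : 'I_n) : exists r, 0 < r /\
    forall y, enorm (y - x) < r -> `|partial i f y - partial i f x| <= e1.
  have [_ /(_ i)[_ [/(_ _ Ux) c _]]] := C1.
  by have [s s0 H] := continuous_enorm c e10; exists s.
pose r1 := \big[Num.min/r0]_i r i.
have r1r0 : r1 <= r0 by apply/bigmin_leP; left.
have r1r i : r1 <= r i by apply/bigmin_leP; right; exists i.
have r10 : 0 < r1 by apply/bigmin_gtP; split => // i _; have [] := rP i.
exists (r1 / (enorm v + 1)); first by rewrite divr_gt0// ltr_wpDl// enorm_ge0.
move=> h; rewrite ltr_pdivlMr ?ltr_wpDl ?enorm_ge0// => hr.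
have hv : enorm (h *: v) < r1.
  by rewrite enormZ (le_lt_trans _ hr)// ler_wpM2l// lerDl.
set w := h *: v in hv *.
have claim k : (k <= n)%N -> `|f (x + trunc k w) - f x -
    \sum_(i < n | (i < k)%N) w ord0 i * partial i f x| <=
    \sum_(i < n | (i < k)%N) e1 * `|w ord0 i|.
  elim: k => [_|k IH kn].
    rewrite big_pred0// big_pred0// (_ : trunc 0 w = 0) ?addr0 ?subrr ?normr0//.
    by apply/rowP => i; rewrite !mxE.
  pose i := Ordinal kn.
  have ti : trunc k.+1 w = trunc k w + w ord0 i *: delta_mx ord0 i.
    apply/rowP => j; rewrite !mxE eqxx /= ltnS leq_eqVlt.
    have [->|ji] := eqVneq j i; first by rewrite eqxx /= ltnn add0r mulr1.
    by rewrite mulr0 addr0 (_ : (j == k :> nat) = false)//; apply/negbTE.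
  have sumS (F : 'I_n -> R) : \sum_(j < n | (j < k.+1)%N) F j =
      \sum_(j < n | (j < k)%N) F j + F i.
    rewrite (bigD1 i)//= addrC; congr (_ + _); apply: eq_bigl => j.
    rewrite ltnS leq_eqVlt -val_eqE /=.
    by case: (ltngtP j k) => //=; rewrite ?andbT ?andbF.
  rewrite !sumS ti addrA.
  have inU (t : R) : `|t| <= `|w ord0 i| ->
      enorm (x + trunc k w + t *: delta_mx ord0 i - x) < r1.
    move=> tw; apply: le_lt_trans hv.
    rewrite addrAC [x + _]addrC addrK le_enorm; apply: (@le_trans _ _ (dotv (trunc k.+1 w) (trunc k.+1 w))); last first.
      by rewrite -le_enorm trunc_le.
    rewrite ti; apply: ler_sum => j _; rewrite !mxE eqxx/=.
    have [->|ji] := eqVneq j i; last by rewrite !mulr0.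
    rewrite ltnn !add0r !mulr1 -!expr2 -real_normK ?num_real// -[leRHS]real_normK ?num_real//.
    by rewrite lerXn2r// ?nnegrE//; move: tw; rewrite mxE.
  have [t|c cw E] := @MVT_line (fun t => f (x + trunc k w + t *: delta_mx ord0 i))
      (fun t => partial i f (x + trunc k w + t *: delta_mx ord0 i)) (w ord0 i).
    move=> tw; apply: is_derive_line; apply: Ck_on_is_derive_partial C1 _.
    by apply: r0U; apply: lt_le_trans (inU _ tw) r1r0.
  move: E; rewrite scale0r addr0 => E.
  have := IH (ltnW kn).
  have : `|partial i f (x + trunc k w + c *: delta_mx ord0 i) * w ord0 i -
     w ord0 i * partial i f x| <= e1 * `|w ord0 i|.
    rewrite (mulrC (w ord0 i)) -mulrBl normrM ler_wpM2r//.
    by have [_] := rP i; apply; apply: lt_le_trans (inU _ cw) (r1r i).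
  rewrite -E.
  set a := f (_ + _ + _); set b := f (_ + _); set s1 := \sum_(j < n | _) _.
  set s2 := \sum_(j < n | _) _.
  move=> H1 H2; rewrite (_ : a - f x - (s1 + w ord0 i * partial i f x) =
    (b - f x - s1) + (a - b - w ord0 i * partial i f x)); last by ring.
  by apply: le_trans (ler_normD _ _) _; rewrite lerD.
have := claim n (leqnn n).
rewrite (_ : trunc n w = w); last by apply/rowP => i; rewrite mxE ltn_ord.
under eq_bigl do rewrite ltn_ord.
under [in X in _ <= X]eq_bigl do rewrite ltn_ord.
rewrite (_ : \sum_(i < n) w ord0 i * partial i f x = h * dotv v (gradient f x)); last first.
  by rewrite mulr_sumr; apply: eq_bigr => i _; rewrite !mxE mulrA.
move=> H; apply: le_trans H _.
apply: (@le_trans _ _ (\sum_(i < n) e1 * (`|h| * enorm v))).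
  apply: ler_sum => i _; rewrite (ler_pM2l e10) mxE normrM.
  by rewrite ler_wpM2l// enorm_coord.
rewrite sumr_const card_ord -mulr_natl mulrCA [_ * enorm v]mulrC !mulrA ler_wpM2r//.
by rewrite -mulrA /e1 mulrAC ler_pdivrMr ?ltr_wpDl// (ler_pM2l e0) lerDl.
Qed.

Definition quadf n (H : 'M[R]_n) (v : 'rV[R]_n) : R :=
  \sum_(i < n) \sum_(j < n) v ord0 i * v ord0 j * H i j.

Lemma C2_is_derive_gradient n (U : set 'rV[R]_n) (f : 'rV[R]_n -> R) x v w :
  open U -> Ck_on 2 U f -> U x ->
  is_derive x v (fun y => dotv w (gradient f y))
    (\sum_(i < n) \sum_(j < n) w ord0 i * v ord0 j * hessian f x i j).
Proof.
move=> oU C2 Ux.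
rewrite (_ : (fun y => _) = \sum_(i < n) (fun y => w ord0 i * partial i f y)); last first.
  by apply/funext => y; rewrite fct_sumE; apply: eq_bigr => i _; rewrite !mxE.
apply: is_derive_sum => i.
have H := C1_is_derive v oU (Ck_on_partial i C2) Ux.
apply: (is_derive_eq (@is_deriveZ _ _ _ _ (w ord0 i) _ _ _ H)); rewrite /GRing.scale/= mulr_sumr; apply: eq_bigr => j _.
by rewrite !mxE mulrA.
Qed.

(** One mean value step: the derivative of the remainder along the line is the first-order error of
    the gradient, at most [e] times the length. *)
Lemma C2_taylor n (U : set 'rV[R]_n) (f : 'rV[R]_n -> R) x v :
  open U -> Ck_on 2 U f -> U x ->
  forall e : R, 0 < e -> exists2 r : R, 0 < r & forall h : R, `|h| < r ->
  `|f (x + h *: v) - f x - h * dotv v (gradient f x) -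
     h ^+ 2 / 2 * quadf (hessian f x) v| <= e * h ^+ 2.
Proof.
move=> oU C2 Ux e e0.
set D := dotv v _; set Q := quadf _ _.
have /is_derive_epsP/(_ _ e0)[r1 r10 H1] := C2_is_derive_gradient v v oU C2 Ux.
have /nbhs_enorm[r2 r20 r2U] : nbhs x U by exact: open_nbhs_nbhs.
exists (Num.min r1 (r2 / (enorm v + 1))).
  by rewrite lt_min r10 divr_gt0// ltr_wpDl// enorm_ge0.
move=> h; rewrite lt_min => /andP[hr1 hr2].
pose g t := f (x + t *: v) - t * D - t ^+ 2 / 2 * Q.
pose dg t := dotv v (gradient f (x + t *: v)) - D - t * Q.
have [t|c ch] := @MVT_line g dg h.
  move=> th; have Ut : U (x + t *: v).
    apply: r2U; rewrite addrC addKr enormZ.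
    move: hr2; rewrite ltr_pdivlMr ?ltr_wpDl ?enorm_ge0//; apply: le_lt_trans.
    by rewrite ler_pM ?enorm_ge0// lerDl.
  have df := is_derive_line (C1_is_derive v oU (Ck_onW C2) Ut).
  have dt : is_derive t 1 (fun t : R => t * D) D.
    apply: (@is_derive_quadratic R^o _ _ _ _ 0) => k.
    rewrite /GRing.scale/= mulr1 (_ : _ - _ - _ = 0); last by ring.
    by rewrite normr0 mul0r.
  have dq : is_derive t 1 (fun t : R => t ^+ 2 / 2 * Q) (t * Q).
    apply: (@is_derive_quadratic R^o _ _ _ _ (`|Q|)) => k.
    rewrite /GRing.scale/= mulr1.
    rewrite (_ : _ - _ - _ = Q * (k ^+ 2 / 2)); last by field.
    rewrite normrM ler_wpM2l// ger0_norm ?divr_ge0 ?sqr_ge0//.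
    by have := sqr_ge0 k; lra.
  exact: is_deriveB (is_deriveB df dt) dq.
rewrite /g /dg scale0r addr0 expr0n/= !mul0r !subr0 => E.
rewrite (_ : f (x + h *: v) - f x - h * D - h ^+ 2 / 2 * Q =
  f (x + h *: v) - h * D - h ^+ 2 / 2 * Q - f x); last by ring.
rewrite E normrM -[h ^+ 2]real_normK ?num_real// expr2 mulrA.
rewrite ler_wpM2r//; apply: le_trans (H1 _ (le_lt_trans ch hr1)) _.
by rewrite ler_wpM2l// ltW.
Qed.

(** The mixed second difference [F] is symmetric in its two directions, and two mean value steps
    turn it into [h ^+ 2] times either mixed partial at a point near [x]. *)
Lemma hessian_sym n (U : set 'rV[R]_n) (f : 'rV[R]_n -> R) x :
  open U -> Ck_on 2 U f -> U x -> (hessian f x)^T = hessian f x.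
Proof.
move=> oU C2 Ux.
pose e_ i : 'rV[R]_n := delta_mx ord0 i.
pose F i j h := f (x + h *: e_ i + h *: e_ j) - f (x + h *: e_ i) -
   (f (x + h *: e_ j) - f x).
have FC i j h : F i j h = F j i h.
  by rewrite /F (addrAC x); ring.
have key i j e : 0 < e -> exists2 r : R, 0 < r & forall h : R, `|h| < r ->
    `|F j i h - h ^+ 2 * partial j (partial i f) x| <= e * h ^+ 2.
  move=> e0.
  have C1 := Ck_on_partial i C2.
  have [_ /(_ j)[_ [/(_ _ Ux) c _]]] := C1.
  have [r1 r10 H1] := continuous_enorm c e0.
  have /nbhs_enorm[r2 r20 r2U] : nbhs x U by exact: open_nbhs_nbhs.
  exists (Num.min r1 r2 / 2); first by rewrite divr_gt0// lt_min r10.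
  move=> h hr.
  have small s t : `|s| <= `|h| -> `|t| <= `|h| ->
      enorm (x + s *: e_ i + t *: e_ j - x) < Num.min r1 r2.
    move=> sh th; rewrite addrAC [x + _]addrC addrK.
    apply: le_lt_trans (enormD _ _) _; rewrite !enormZ !enorm_delta !mulr1.
    by move: hr; rewrite ltr_pdivlMr//; lra.
  have inU s t : `|s| <= `|h| -> `|t| <= `|h| -> U (x + s *: e_ i + t *: e_ j).
    move=> sh th; apply: r2U; apply: lt_le_trans (small _ _ sh th) _.
    by rewrite ge_min lexx orbT.
  have [t|c1 c1h E1] := @MVT_line
     (fun t => f (x + h *: e_ j + t *: e_ i) - f (x + t *: e_ i))
     (fun t => partial i f (x + h *: e_ j + t *: e_ i) - partial i f (x + t *: e_ i)) h.
    move=> th; apply: is_deriveB; apply: is_derive_line;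
      apply: (Ck_on_is_derive_partial _ (Ck_onW C2)).
      by rewrite addrAC; exact: inU.
    by have := inU t 0 th; rewrite scale0r addr0 normr0; apply.
  have [t|c2 c2h E2] := @MVT_line (fun t => partial i f (x + c1 *: e_ i + t *: e_ j))
     (fun t => partial j (partial i f) (x + c1 *: e_ i + t *: e_ j)) h.
    move=> th; apply: is_derive_line; apply: (Ck_on_is_derive_partial _ C1).
    exact: inU.
  move: E1 E2; rewrite !scale0r !addr0 => E1 E2.
  have -> : F j i h = partial j (partial i f) (x + c1 *: e_ i + c2 *: e_ j) * h ^+ 2.
    rewrite /F expr2 mulrA -E2 (addrAC x (c1 *: _)) -E1; ring.
  rewrite (mulrC (h ^+ 2)) -mulrBl normrM (ger0_norm (sqr_ge0 _)) ler_wpM2r ?sqr_ge0//.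
  by apply: H1; apply: lt_le_trans (small _ _ c1h c2h) _; rewrite ge_min lexx.
apply/matrixP => i j; rewrite !mxE.
apply/eqP; rewrite -subr_eq0 -normr_le0; apply/ler_addgt0Pl => e e0; rewrite addr0.
have e20 : 0 < e / 2 by rewrite divr_gt0.
have [r1 r10 H1] := key i j _ e20; have [r2 r20 H2] := key j i _ e20.
pose h := Num.min r1 r2 / 2.
have h0 : 0 < h by rewrite divr_gt0// lt_min r10.
have hm : `|h| < Num.min r1 r2 by rewrite gtr0_norm// /h ltr_pdivrMr// ltr_pMr ?ltr1n// lt_min r10.
move: hm; rewrite lt_min => /andP[/H1 + /H2].
rewrite (FC i j); move: (F j i h) => G.
set A := partial i (partial j f) x; set B := partial j (partial i f) x.
clearbody A B => HA HB.
have h20 : 0 < h ^+ 2 by rewrite exprn_gt0.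
rewrite -(ler_pM2r h20) -{1}(gtr0_norm h20) -normrM.
rewrite (_ : (A - B) * h ^+ 2 = (G - h ^+ 2 * B) - (G - h ^+ 2 * A)); last by ring.
apply: le_trans (ler_normB _ _) _; rewrite (splitr e) mulrDl.
by rewrite lerD.
Qed.

End calculus.

(** * Quadratic forms and traces on the tangent space of a graph *)

Section linear_algebra.
Context {R : realType}.
Implicit Types n m : nat.

Lemma quadfE n (H : 'M[R]_n) (v : 'rV[R]_n) : quadf H v = dotv (v *m H) v.
Proof.
rewrite /quadf exchange_big; apply: eq_bigr => j _.
by rewrite mxE mulr_suml; apply: eq_bigr => i _; ring.
Qed.

Lemma quadfZ n (H : 'M[R]_n) (v : 'rV[R]_n) a : quadf H (a *: v) = a ^+ 2 * quadf H v.
Proof. by rewrite !quadfE -scalemxAl dotvZl dotvZr mulrA -expr2. Qed.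

Lemma sum_dotv_row m n (A B : 'M[R]_(m, n)) :
  \sum_i dotv (row i A) (row i B) = \tr (A *m B^T).
Proof.
apply: eq_bigr => i _; rewrite mxE; apply: eq_bigr => j _.
by rewrite !mxE.
Qed.

Lemma sum_quadf_row m n (P : 'M[R]_(m, n)) (K : 'M[R]_n) :
  \sum_i quadf K (row i P) = \tr (P *m K *m P^T).
Proof. by rewrite -sum_dotv_row; apply: eq_bigr => i _; rewrite quadfE row_mul. Qed.

Lemma dotv_split n (a b : 'rV[R]_n.+1) :
  dotv a b = dotv (col' ord_max a) (col' ord_max b) + a ord0 ord_max * b ord0 ord_max.
Proof.
rewrite /dotv big_ord_recr/=; congr (_ + _); apply: eq_bigr => i _.
by rewrite !mxE; congr (a _ _ * b _ _); apply/val_inj; rewrite /= /bump leqNgt ltn_ord.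
Qed.

Definition vlast n (u : 'rV[R]_n) (s : R) : 'rV[R]_n.+1 :=
  \row_j (if unlift ord_max j is Some i then u ord0 i else s).

Lemma vlast_col' n (u : 'rV[R]_n) s : col' ord_max (vlast u s) = u.
Proof. by apply/rowP => i; rewrite !mxE liftK. Qed.

Lemma vlast_last n (u : 'rV[R]_n) s : vlast u s ord0 ord_max = s.
Proof. by rewrite mxE unlift_none. Qed.

Lemma vlastE n (a : 'rV[R]_n.+1) : vlast (col' ord_max a) (a ord0 ord_max) = a.
Proof. by apply/rowP => j; rewrite mxE; case: unliftP => [i ->|->]; rewrite ?mxE. Qed.

Lemma vlastD n (u v : 'rV[R]_n) s t : vlast (u + v) (s + t) = vlast u s + vlast v t.
Proof. by apply/rowP => j; rewrite !mxE; case: unlift => [i|]; rewrite ?mxE. Qed.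

Lemma vlastZ n (u : 'rV[R]_n) s c : vlast (c *: u) (c * s) = c *: vlast u s.
Proof. by apply/rowP => j; rewrite !mxE; case: unlift => [i|]; rewrite ?mxE. Qed.

Lemma dotv_vlast n (u v : 'rV[R]_n) s t :
  dotv (vlast u s) (vlast v t) = dotv u v + s * t.
Proof. by rewrite dotv_split !vlast_col' !vlast_last. Qed.

(* Differential of the graph parametrization [u |-> (u, f u)], [g = grad f]. *)
Definition graph_diff n (g : 'rV[R]_n) : 'M[R]_(n, n.+1) :=
  \matrix_(i, j) vlast (delta_mx ord0 i) (g ord0 i) ord0 j.

Lemma mul_graph_diff n (a g : 'rV[R]_n) : a *m graph_diff g = vlast a (dotv a g).
Proof.
have Glift i k : graph_diff g i (lift ord_max k) = (k == i)%:R.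
  by rewrite mxE [LHS]mxE liftK mxE eqxx.
have Glast i : graph_diff g i ord_max = g ord0 i.
  by rewrite mxE vlast_last.
apply/rowP => j; rewrite mxE [RHS]mxE; case: (unliftP ord_max j) => [i ->|->].
  rewrite (bigD1 i)//= Glift eqxx mulr1 big1 ?addr0// => k ki.
  by rewrite Glift eq_sym (negbTE ki) mulr0.
by apply: eq_bigr => i _; rewrite Glast.
Qed.

Lemma dotv_delta_mx n (A : 'M[R]_n) i j :
  dotv (delta_mx ord0 i *m A) (delta_mx ord0 j) = A i j.
Proof. by rewrite dotvC dotv_delta -rowE mxE. Qed.

Lemma graph_diff_gram n (g : 'rV[R]_n) :
  graph_diff g *m (graph_diff g)^T = 1%:M + g^T *m g.
Proof.
apply/matrixP => i j; rewrite -dotv_delta_mx mulmxA dotv_mxl trmxK.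
rewrite !mul_graph_diff dotv_vlast !dotv_delta !mxE big_ord1 !mxE.
by rewrite eqxx/= eq_sym.
Qed.

Lemma unitmx_pos n (A : 'M[R]_n) : (forall v, v != 0 -> 0 < quadf A v) ->
  A \in unitmx.
Proof.
move=> A0; rewrite -row_free_unit -kermx_eq0; apply/eqP/row_matrixP => i.
rewrite row0; apply/eqP; apply: contraT => /A0.
by rewrite quadfE -row_mul mulmx_ker row0 dot0v ltxx.
Qed.

Lemma quadf_gram n (g v : 'rV[R]_n) :
  quadf (1%:M + g^T *m g) v = dotv v v + dotv v g ^+ 2.
Proof.
rewrite -graph_diff_gram quadfE mulmxA dotv_mxl trmxK mul_graph_diff.
by rewrite dotv_vlast expr2.
Qed.

Lemma gram_unit n (g : 'rV[R]_n) : 1%:M + g^T *m g \in unitmx.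
Proof.
apply: unitmx_pos => v v0; rewrite quadf_gram ltr_wpDr ?sqr_ge0//.
by rewrite lt_def dotv_ge0 andbT; apply: contraNneq v0 => /dotv_eq0 ->.
Qed.

Lemma gram_sym n (g : 'rV[R]_n) : (1%:M + g^T *m g)^T = 1%:M + g^T *m g.
Proof. by rewrite linearD/= trmx1 trmx_mul trmxK. Qed.

(* For [T] of full rank with Gram matrix [B = T T^t], the rows of
   [P = T^t B^-1] are the tangential coordinates of the standard basis. *)
Section projection.
Variables (n m : nat) (T : 'M[R]_(n, m)) (B K : 'M[R]_n).
Hypotheses (TT : T *m T^T = B) (Bu : B \in unitmx).
Let P := T^T *m invmx B.

Let Bsym : B^T = B.
Proof. by rewrite -TT trmx_mul trmxK. Qed.

Let PP : P^T *m P = invmx B.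
Proof.
rewrite /P trmx_mul trmxK trmx_inv Bsym mulmxA -(mulmxA (invmx B)) TT.
by rewrite mulVmx// mul1mx.
Qed.

(** Summing over the ambient basis produces the trace relative to the metric [B] without an
    orthonormal tangent frame. *)
Lemma sum_quadf_proj : \sum_i quadf K (row i P) = \tr (K *m invmx B).
Proof. by rewrite sum_quadf_row -mulmxA mxtrace_mulC -mulmxA PP. Qed.

Lemma sum_gram_proj : \sum_i quadf B (row i P) = n%:R.
Proof. by rewrite sum_quadf_row -mulmxA mxtrace_mulC -mulmxA PP mulmxV// mxtrace1. Qed.

(** [P *m T] is the orthogonal projection onto the row space of [T], of trace [n]; both the cross
    terms and the squared projections sum to that trace. *)
Lemma sum_residual_proj a :
  \sum_i dotv (delta_mx ord0 i - a *: (row i P *m T)) (delta_mx ord0 i - a *: (row i P *m T)) =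
  m%:R - 2 * a * n%:R + a ^+ 2 * n%:R.
Proof.
have S1 : \sum_i dotv (row i P *m T) (row i P *m T) = n%:R.
  rewrite -sum_gram_proj; apply: eq_bigr => i _.
  by rewrite dotv_mxl -mulmxA TT quadfE dotvC.
have S2 : \sum_i dotv (delta_mx ord0 i) (row i P *m T) = n%:R.
  transitivity (\tr (P *m T)).
    by apply: eq_bigr => i _; rewrite dotv_delta -row_mul mxE.
  by rewrite mxtrace_mulC /P mulmxA TT mulmxV// mxtrace1.
have S0 : \sum_(i < m) dotv (delta_mx ord0 i : 'rV[R]_m) (delta_mx ord0 i) = m%:R.
  rewrite (eq_bigr (fun=> 1)); first by rewrite sumr_const card_ord.
  by move=> i _; rewrite dotv_delta mxE !eqxx.
rewrite -S0 -[X in 2 * a * X]S2 -[X in a ^+ 2 * X]S1 !mulr_sumr -sumrB -big_split/=.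
apply: eq_bigr => i _; rewrite !dotvE (dotvC (row i P *m T) (delta_mx _ _)); ring.
Qed.

End projection.

End linear_algebra.

(** * Boundary charts and second differences *)

Section chart.
Context {R : realType} (n : nat).
Variables (W : set 'rV[R]_n.+1) (y : 'rV[R]_n.+1) (Q : 'M[R]_n.+1) (f : 'rV[R]_n -> R).
Hypotheses (openW : open W) (notWy : ~ W y) (clWy : closure W y).
Hypothesis chart : graph_chart W y Q f.
Local Notation del := (dist_compl W).
Let W0 : ~` W !=set0. Proof. by exists y. Qed.

Let QQ : Q *m Q^T = 1%:M. Proof. by case: chart. Qed.
Let QTQ : Q^T *m Q = 1%:M. Proof. by apply: mulmx1C. Qed.
Let QT_orth : Q^T *m Q^T^T = 1%:M. Proof. by rewrite trmxK. Qed.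

Let coord z : 'rV[R]_n := col' ord_max ((z - y) *m Q).
Let height z : R := ((z - y) *m Q) ord0 ord_max.

Definition surf (u : 'rV[R]_n) : 'rV[R]_n.+1 := y + vlast u (f u) *m Q^T.

Let coord_lip z z' : enorm (coord z - coord z') <= enorm (z - z').
Proof.
have E : col' ord_max ((z - z') *m Q) = coord z - coord z'.
  rewrite (_ : z - z' = (z - y) - (z' - y)); last by rewrite opprB addrA subrK.
  by rewrite (mulmxBl (z - y)); apply/rowP => i; rewrite !mxE.
by rewrite -(enorm_orth (z - z') QQ) le_enorm dotv_split E lerDl -expr2 sqr_ge0.
Qed.

Let height_lip z z' : `|height z - height z'| <= enorm (z - z').
Proof.
rewrite -(enorm_orth (z - z') QQ); apply: le_trans (enorm_coord _ ord_max).
suff -> : height z - height z' = ((z - z') *m Q) ord0 ord_max by [].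
rewrite (_ : z - z' = (z - y) - (z' - y)); last by rewrite opprB addrA subrK.
by rewrite (mulmxBl (z - y)) mxE [X in _ = _ + X]mxE.
Qed.

Let coord_y : coord y = 0.
Proof. by rewrite /coord subrr mul0mx; apply/rowP => i; rewrite !mxE. Qed.

Let height_y : height y = 0.
Proof. by rewrite /height subrr mul0mx mxE. Qed.

Let coordE z : z = y + vlast (coord z) (height z) *m Q^T.
Proof. by rewrite vlastE -mulmxA QQ mulmx1 addrC subrK. Qed.

Let surf_coord u : coord (surf u) = u.
Proof. by rewrite /coord /surf addrC addKr -mulmxA QTQ mulmx1 vlast_col'. Qed.

Let surf_height u : height (surf u) = f u.
Proof. by rewrite /height /surf addrC addKr -mulmxA QTQ mulmx1 vlast_last. Qed.

Lemma chart_radius : exists U rho, [/\ open U, 0 < rho, Ck_on 2 U f,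
  forall u, enorm u < rho -> U u &
  forall z, enorm (z - y) < rho -> (W z <-> f (coord z) < height z)].
Proof.
have [_ _ [U [oU U0 C2]] /nbhs_enorm[r1 r10 H1]] := chart.
have /nbhs_enorm[r2 r20 H2] : nbhs (0 : 'rV[R]_n) U by exact: open_nbhs_nbhs.
exists U, (Num.min r1 r2); split => //.
- by rewrite lt_min r10.
- by move=> u; rewrite lt_min => /andP[_ ur]; apply: H2; rewrite subr0.
- by move=> z; rewrite lt_min => /andP[zr _]; exact: H1.
Qed.

Section radius.
Variables (U : set 'rV[R]_n) (rho : R).
Hypotheses (oU : open U) (rho0 : 0 < rho) (C2 : Ck_on 2 U f).
Hypothesis rhoU : forall u, enorm u < rho -> U u.
Hypothesis rhoW : forall z, enorm (z - y) < rho -> (W z <-> f (coord z) < height z).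

Let U0 : U 0. Proof. by apply: rhoU; rewrite enorm0. Qed.

(** Outside [W] the height is at most [f]. If it were strictly less, by continuity a whole
    neighborhood of [z] would lie below the graph and miss [W]. *)
Lemma boundary_graph z : ~ W z -> closure W z -> enorm (z - y) < rho ->
  z = surf (coord z).
Proof.
move=> Wz clz zr; rewrite {1}(coordE z) /surf; congr (_ + vlast _ _ *m _).
have Uz : U (coord z).
  by apply: rhoU; apply: le_lt_trans zr; have := coord_lip z y; rewrite coord_y subr0.
apply/eqP; rewrite eq_le; apply/andP; split.
  by rewrite leNgt; apply/negP => H; apply: Wz; apply/rhoW.
rewrite leNgt; apply/negP => H.
have gap : 0 < (f (coord z) - height z) / 3 by rewrite divr_gt0// subr_gt0.
have [cf _] := C2.
have [r r0 Hr] := continuous_enorm (cf _ Uz) gap.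
pose r' := Num.min r (Num.min ((f (coord z) - height z) / 3) (rho - enorm (z - y))).
have [z' [Wz' z'B]] : (W `&` [set z' | enorm (z' - z) < r']) !=set0.
  apply: clz; apply/nbhs_enorm; exists r' => //.
  by rewrite !lt_min r0 gap subr_gt0.
move: z'B; rewrite /= !lt_min => /and3P[z1 z2 z3].
have z'r : enorm (z' - y) < rho by have := enormB_trans z z' y; lra.
have := (rhoW z'r).1 Wz'.
have := Hr _ (le_lt_trans (coord_lip z' z) z1).
have := height_lip z' z; rewrite !ler_norml => /andP[? ?] /andP[? ?]; lra.
Qed.

Lemma chart_f0 : f 0 = 0.
Proof.
have := boundary_graph notWy clWy; rewrite subrr enorm0 => /(_ rho0) H.
by rewrite -coord_y -surf_height -H height_y.
Qed.

(** The graph points become competitors for [del]. Keeping [u] and [f u] below [rho / 3] places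
    [surf u] where the chart describes [W]. *)
Lemma surf_out : exists2 r : R, 0 < r & forall u, enorm u < r -> U u /\ ~ W (surf u).
Proof.
have r30 : 0 < rho / 3 by rewrite divr_gt0.
have [cf _] := C2.
have [r r0 Hr] := continuous_enorm (cf _ U0) r30.
exists (Num.min r (rho / 3)); first by rewrite lt_min r0.
move=> u; rewrite lt_min => /andP[ur u3].
have {}Hr : `|f u| <= rho / 3 by have := Hr u; rewrite subr0 chart_f0 subr0; apply.
split; first by apply: rhoU; lra.
move=> Wu; have ur' : enorm (surf u - y) < rho.
  rewrite /surf addrC addKr enorm_orth//.
  rewrite (_ : vlast u (f u) = vlast u 0 + f u *: vlast 0 1); last first.
    by rewrite -vlastZ -vlastD mulr1 scaler0 addr0 add0r.
  apply: le_lt_trans (enormD _ _) _; rewrite enormZ.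
  rewrite /enorm !dotv_vlast dot0v mulr0 addr0 add0r mulr1 sqrtr1 mulr1.
  by rewrite -/(enorm u); lra.
by have := (rhoW ur').1 Wu; rewrite surf_coord surf_height ltxx.
Qed.

Let g := gradient f 0.
Let K := hessian f 0.
(** [TQ] is the differential of [surf] at 0, its rows spanning the tangent space at [y]. The vector
    [kap] below is the vertical direction of the chart, which is normal to the boundary only when
    [g = 0]. *)
Let TQ := graph_diff g *m Q^T.
Let kap : 'rV[R]_n.+1 := vlast 0 1 *m Q^T.

Let kap1 : dotv kap kap = 1.
Proof. by rewrite dotv_orth// dotv_vlast dot0v mulr1 add0r. Qed.

Let TQ_gram a : dotv (a *m TQ) (a *m TQ) = quadf (1%:M + g^T *m g) a.
Proof.
by rewrite mulmxA dotv_orth// mul_graph_diff dotv_vlast quadf_gram expr2.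
Qed.

Let rem a (h : R) := (f (h *: a) - h * dotv a g) / h ^+ 2.

Let rem_cvg a : rem a h @[h --> 0^'] --> quadf K a / 2.
Proof.
apply/cvgrPdist_le => e e0; have [r r0 Hr] := C2_taylor a oU C2 U0 e0.
apply/nbhs_ballP; exists r => // h; rewrite /ball/= sub0r normrN => hr h0.
have h2 : 0 < h ^+ 2 by rewrite lt_def sqrf_eq0 h0 sqr_ge0.
have := Hr h hr; rewrite add0r chart_f0 subr0 => H.
rewrite distrC -(ler_pM2r h2) -{1}(gtr0_norm h2) -normrM.
move: H; congr (`| _ | <= _); rewrite /rem -/g -/K.
by field.
Qed.

Let surf_line a h : h != 0 ->
  surf (h *: a) = y + h *: (a *m TQ) + (h ^+ 2 * rem a h) *: kap.
Proof.
move=> h0; rewrite /surf -addrA; congr (_ + _).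
rewrite /TQ mulmxA mul_graph_diff /kap !scalemxAl -mulmxDl; congr (_ *m _).
rewrite -!vlastZ -vlastD scaler0 addr0 mulr1; congr vlast.
rewrite /rem (dotvC a); have h20 : h ^+ 2 != 0 by rewrite sqrf_eq0.
by field.
Qed.

Let near_surf_out a : \forall h \near (0 : R)^', ~ W (surf (h *: a)).
Proof.
have [r r0 Hr] := surf_out.
apply/nbhs_ballP; exists (r / (enorm a + 1)).
  by rewrite /= divr_gt0// ltr_wpDl// enorm_ge0.
move=> h; rewrite /ball/= sub0r normrN ltr_pdivlMr ?ltr_wpDl ?enorm_ge0// => hr _.
apply: (Hr _ _).2; rewrite enormZ; apply: le_lt_trans hr.
by rewrite ler_wpM2l// lerDl.
Qed.

Let sqdist x e a h : h != 0 ->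
  let p := x - y in let b := e - a *m TQ in
  dotv (x + h *: e - surf (h *: a)) (x + h *: e - surf (h *: a)) =
  dotv p p + h * (2 * dotv p b) + h ^+ 2 *
   (dotv b b - 2 * rem a h * dotv p kap - 2 * h * rem a h * dotv b kap +
    h ^+ 2 * rem a h ^+ 2).
Proof.
move=> h0 p b; rewrite surf_line//.
have -> : x + h *: e - (y + h *: (a *m TQ) + (h ^+ 2 * rem a h) *: kap) =
   p + h *: b - (h ^+ 2 * rem a h) *: kap.
  by apply/rowP => i; rewrite /p /b !mxE; ring.
move: kap1; clearbody p b; move: kap (rem a h) => k r k1.
by rewrite !dotvE k1 (dotvC b p) !(dotvC k); ring.
Qed.

Let hcvg : (h : R) @[h --> (0 : R)^'] --> (0 : R).
Proof. exact: cvg_within. Qed.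

Let sqdist_cvg p b a :
  dotv b b - 2 * rem a h * dotv p kap - 2 * h * rem a h * dotv b kap +
    h ^+ 2 * rem a h ^+ 2 @[h --> (0 : R)^'] --> dotv b b - dotv p kap * quadf K a.
Proof.
have -> : dotv b b - dotv p kap * quadf K a =
  dotv b b - 2 * (quadf K a / 2) * dotv p kap - 2 * 0 * (quadf K a / 2) * dotv b kap +
    (0 * 0) * (quadf K a / 2 * (quadf K a / 2)) by field.
have c1 : rem a h * rem a h @[h --> 0^'] --> quadf K a / 2 * (quadf K a / 2).
  by apply: cvgM; exact: rem_cvg.
have c2 : h * h @[h --> (0 : R)^'] --> (0 : R) * 0 by apply: cvgM; exact: hcvg.
have c3 : 2 * rem a h @[h --> 0^'] --> 2 * (quadf K a / 2).
  by apply: cvgM; [exact: cvg_cst|exact: rem_cvg].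
have c4 : 2 * h * rem a h @[h --> (0 : R)^'] --> 2 * 0 * (quadf K a / 2).
  by apply: cvgM; [apply: cvgM; [exact: cvg_cst|exact: hcvg]|exact: rem_cvg].
apply: cvgD; last by apply: cvgM; [exact: c2|exact: c1].
apply: cvgB; last by apply: cvgM; [exact: c4|exact: cvg_cst].
apply: cvgB; first exact: cvg_cst.
by apply: cvgM; [exact: c3|exact: cvg_cst].
Qed.

Let minimum_conditions (A L : R) (T : R -> R) :
  (\forall h \near (0 : R)^', 0 <= h * A + h ^+ 2 * T h) ->
  T h @[h --> (0 : R)^'] --> L -> A = 0 /\ 0 <= L.
Proof.
move=> H TL.
have T1 : \forall h \near (0 : R)^', `|L - T h| <= 1 by apply: cvgr_dist_le TL _ _.
have A0 : A = 0.
  apply/eqP; apply: contraT => A0.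
  have /nbhs_ballP[r /= r0 Hr] : \forall h \near (0 : R)^', 0 <= h * A + h ^+ 2 * T h /\
    `|L - T h| <= 1 by near=> h; split; near: h.
  have Ap : 0 < `|A| by rewrite normr_gt0.
  have Lp : 0 < `|L| + 1 by rewrite ltr_wpDl.
  (* With [h] of size [s] and sign opposite to [A], the linear term is [- (s * |A|)] and the
     second-order term is at most half of that size. *)
  pose s := Num.min (r / 2) (`|A| / (2 * (`|L| + 1))).
  have s0 : 0 < s by rewrite lt_min !divr_gt0// mulr_gt0.
  have sr : s < r by rewrite gt_min ltr_pdivrMr// ltr_pMr// ltr1n.
  have sA : s * (2 * (`|L| + 1)) <= `|A|.
    by rewrite -ler_pdivlMr ?mulr_gt0// ge_min lexx orbT.
  pose h := - Num.sg A * s.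
  have hs : `|h| = s by rewrite normrM normrN normr_sg A0 mul1r gtr0_norm.
  have h0 : h != 0 by rewrite -normr_gt0 hs.
  have [] := Hr h (ltac:(by rewrite /ball/= sub0r normrN hs)) h0.
  have -> : h * A = - (s * `|A|) by rewrite normrEsg /h; ring.
  have -> : h ^+ 2 = s ^+ 2 by rewrite -[h ^+ 2]real_normK ?num_real// hs.
  move=> H1 H2.
  have TL1 : T h <= `|L| + 1.
    by move: H2; rewrite ler_norml => /andP[? ?]; have := ler_norm L; lra.
  have := ler_wpM2l (sqr_ge0 s) TL1 => H3.
  have := ler_wpM2l (ltW s0) sA => H4.
  have : 0 < s * `|A| by rewrite mulr_gt0.
  by lra.
split => //; rewrite leNgt; apply/negP => L0.
have TL0 : \forall h \near (0 : R)^', T h < 0 by exact: cvgr_lt TL _ L0.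
have [h [h0 [H1 H2]]] : exists h : R, h != 0 /\ (0 <= h * A + h ^+ 2 * T h /\ T h < 0).
  apply: (@filter_ex _ (0 : R)^'); near=> h; split; first by near: h; exact: nbhs_dnbhs_neq.
  by split; near: h.
have h2 : 0 < h ^+ 2 by rewrite lt_def sqrf_eq0 h0 sqr_ge0.
by move: H1; rewrite A0 mulr0 add0r pmulr_rge0// leNgt H2.
Unshelve. all: by end_near. Qed.

(** Necessary conditions for the squared distance from [z] to [surf (h *: a)] to be minimal at
    [h = 0]: [z - y] is normal to the boundary, and the curvature in direction [a] is bounded by the
    inverse distance. *)
Lemma foot_conditions z a : foot W z y ->
  dotv (z - y) (a *m TQ) = 0 /\
  0 <= quadf (1%:M + g^T *m g) a - dotv (z - y) kap * quadf K a.
Proof.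
move=> [_ zy].
have H := @minimum_conditions _ _ _ _ (@sqdist_cvg (z - y) (0 - a *m TQ) a).
have [] := H (2 * dotv (z - y) (0 - a *m TQ)).
  near=> h; have h0 : h != 0 by near: h; exact: nbhs_dnbhs_neq.
  have out : ~ W (surf (h *: a)) by near: h; exact: near_surf_out.
  have := sqdist z 0 a h0; rewrite /= scaler0 addr0 => E.
  have : enorm (z - y) <= enorm (z - surf (h *: a)) by rewrite zy dist_compl_le.
  by rewrite le_enorm E -addrA lerDl.
rewrite sub0r !dotvNr dotvNl opprK TQ_gram => H1 H2; split => //.
by move: H1; lra.
Unshelve. all: by end_near. Qed.

Lemma foot_height x : W x -> foot W x y ->
  0 < dotv (x - y) kap /\
  del x = dotv (x - y) kap * Num.sqrt (1 + dotv g g).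
Proof.
move=> Wx fx; set eta := dotv (x - y) kap.
have dx := dist_compl_gt0 openW W0 Wx.
have etaE : height x = eta.
  rewrite /eta /kap dotvC dotv_mxl trmxK dotv_split.
  by rewrite vlast_col' vlast_last dot0v add0r mul1r.
have xi : coord x = - eta *: g.
  apply/rowP => i; have [H _] := foot_conditions (delta_mx ord0 i) fx.
  move: H; rewrite /TQ mulmxA dotvC dotv_mxl trmxK mul_graph_diff dotv_split.
  rewrite vlast_col' vlast_last !dotv_delta -/(coord x) -/(height x) etaE.
  by move=> H; rewrite [RHS]mxE; lra.
have dsq : del x ^+ 2 = eta ^+ 2 * (1 + dotv g g).
  rewrite -fx.2 enorm_sqr -(dotv_orth _ _ QQ) dotv_split -/(coord x) -/(height x).
  by rewrite etaE xi dotvZl dotvZr; ring.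
have wp : 0 < 1 + dotv g g by rewrite ltr_wpDr// dotv_ge0.
have eta0 : eta != 0.
  apply: contraTneq dx => e0; move: dsq; rewrite e0 expr0n mul0r => /eqP.
  by rewrite sqrf_eq0 => /eqP ->; rewrite ltxx.
(* The segment from [y] to [x] runs in [W], hence above the graph; for negative [eta] its points
   near [y] would fall below, since [h * rem] tends to 0. *)
have eta_ge0 : 0 <= eta * (1 + dotv g g).
  rewrite leNgt; apply/negP => neg.
  have remc : h * rem (coord x) h @[h --> (0 : R)^'] --> (0 : R) * (quadf K (coord x) / 2).
    by apply: cvgM; [exact: hcvg|exact: rem_cvg].
  have c1 : \forall h \near (0 : R)^', eta * (1 + dotv g g) < h * rem (coord x) h.
    by apply: cvgr_gt remc _ _; rewrite mul0r.
  have [e /= e0 He] : \forall h \near (0 : R)^', eta * (1 + dotv g g) < h * rem (coord x) h by [].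
  pose h := Num.min (e / 2) (Num.min (1 / 2) (rho / (2 * (enorm (x - y) + 1)))).
  have h0 : 0 < h.
    by rewrite !lt_min !divr_gt0// mulr_gt0// ltr_wpDl// enorm_ge0.
  have h1 : h <= 1.
    by apply: (@le_trans _ _ (1 / 2)); [rewrite /h !ge_min lexx !orbT|lra].
  have he : ball 0 e h.
    rewrite /ball/= sub0r normrN gtr0_norm// gt_min ltr_pdivrMr// ltr_pMr//.
    by rewrite ltr1n.
  have hrho : enorm (y + h *: (x - y) - y) < rho.
    rewrite addrC addKr enormZ gtr0_norm//.
    apply: (@le_lt_trans _ _ (rho / (2 * (enorm (x - y) + 1)) * enorm (x - y))).
      by rewrite ler_wpM2r ?enorm_ge0// /h !ge_min lexx !orbT.
    have E0 := enorm_ge0 (x - y).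
    rewrite mulrAC ltr_pdivrMr; last by rewrite mulr_gt0// ltr_wpDl.
    by rewrite ltr_pM2l//; lra.
  have [_ dh] := foot_segment W0 fx (ltW h0) h1.
  have Wh : W (y + h *: (x - y)).
    by apply: (dist_compl_gt0P); rewrite dh mulr_gt0.
  have := (rhoW hrho).1 Wh.
  have -> : coord (y + h *: (x - y)) = h *: coord x.
    by rewrite /coord addrC addKr -scalemxAl; apply/rowP => i; rewrite !mxE.
  have -> : height (y + h *: (x - y)) = h * height x.
    by rewrite /height addrC addKr -scalemxAl mxE.
  have h2 : h ^+ 2 != 0 by rewrite sqrf_eq0 gt_eqF.
  have -> : f (h *: coord x) = h * (dotv (coord x) g + h * rem (coord x) h).
    by rewrite /rem; field; rewrite gt_eqF.
  rewrite ltr_pM2l// etaE xi dotvZl -xi.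
  have := He h he (lt0r_neq0 h0); lra.
have etap : 0 < eta by rewrite lt_def eta0/= -(pmulr_lge0 _ wp).
split => //; apply/eqP; rewrite -(@eqrXn2 _ 2)//; last 2 first.
- exact: ltW.
- by rewrite mulr_ge0 ?sqrtr_ge0// ltW.
by rewrite exprMn sqr_sqrtr ?ltW// dsq.
Qed.

(* [del (x + h e)] is at most the distance from [x + h e] to the point
   [surf (h a)] of the boundary, for any choice of [a]. *)
Lemma upper_barrier x e a eps : W x -> foot W x y -> 0 < eps ->
  \forall h \near (0 : R)^', del (x + h *: e) <= del x + h * (dotv (x - y) e / del x) +
    h ^+ 2 * ((dotv (e - a *m TQ) (e - a *m TQ) - dotv (x - y) kap * quadf K a -
       (dotv (x - y) e / del x) ^+ 2) / (2 * del x) + eps).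
Proof.
move=> Wx fx eps0; set p := x - y; set b := e - a *m TQ.
have dx := dist_compl_gt0 openW W0 Wx.
set beta := dotv p e / del x.
(* Displacing the boundary point tangentially does not affect the first-order term, because [x - y]
   is normal. *)
have pb : dotv p b = dotv p e.
  by rewrite /b dotvBr (foot_conditions a fx).1 subr0.
pose T h := dotv b b - 2 * rem a h * dotv p kap - 2 * h * rem a h * dotv b kap +
    h ^+ 2 * rem a h ^+ 2.
pose L := dotv b b - dotv p kap * quadf K a - beta ^+ 2.
have mc : (del x + h * beta) @[h --> (0 : R)^'] --> del x + 0 * beta.
  by apply: cvgD; [exact: cvg_cst|apply: cvgM; [exact: hcvg|exact: cvg_cst]].
rewrite mul0r addr0 in mc.
have TL : (T h - beta ^+ 2) / (2 * (del x + h * beta)) @[h --> (0 : R)^'] --> L / (2 * del x).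
  apply: cvgM; first by apply: cvgB; [exact: sqdist_cvg|exact: cvg_cst].
  apply: cvgV; first by rewrite mulf_neq0// gt_eqF.
  by apply: cvgM; [exact: cvg_cst|exact: mc].
near=> h; have h0 : h != 0 by near: h; exact: nbhs_dnbhs_neq.
have out : ~ W (surf (h *: a)) by near: h; exact: near_surf_out.
have m0 : 0 < del x + h * beta by near: h; exact: cvgr_gt mc _ dx.
have Th : (T h - beta ^+ 2) / (2 * (del x + h * beta)) <= L / (2 * del x) + eps.
  by near: h; apply: cvgr_le TL _ _; rewrite ltrDl.
set m := del x + h * beta in m0 Th *.
apply: le_trans (dist_compl_le _ out) _.
have := sqdist x e a h0; rewrite /= -/p -/b -/(T h) pb => E.
have pp : dotv p p = del x ^+ 2 by rewrite -enorm_sqr fx.2.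
set N := enorm _; have N2 : N ^+ 2 = m ^+ 2 + h ^+ 2 * (T h - beta ^+ 2).
  by rewrite enorm_sqr E pp /m /beta; field; rewrite gt_eqF.
(* The square root lies below its tangent at [m ^+ 2]: [2 * m * N <= N ^+ 2 + m ^+ 2]. *)
have N1 : N <= m + h ^+ 2 * ((T h - beta ^+ 2) / (2 * m)).
  rewrite (_ : m + _ = (N ^+ 2 + m ^+ 2) / (2 * m)); last first.
    by rewrite N2; field; rewrite gt_eqF.
  rewrite ler_pdivlMr ?mulr_gt0//; have := sqr_ge0 (N - m); lra.
by apply: le_trans N1 _; rewrite lerD2l ler_wpM2l ?sqr_ge0.
Unshelve. all: by end_near. Qed.


Let TQ_TQ : TQ *m TQ^T = 1%:M + g^T *m g.
Proof.
by rewrite /TQ trmx_mul trmxK -mulmxA (mulmxA Q^T) QTQ mul1mx graph_diff_gram.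
Qed.

Let gram_u : 1%:M + g^T *m g \in unitmx. Proof. exact: gram_unit. Qed.

(** This is the second-order condition at the end [z] of the extended segment, whose foot is still
    [y]; the factor [1 + r / del x] is the source of strictness. *)
Let extension_height x r : W x -> foot W x y -> 0 < r -> extendable W r x ->
  forall a, (1 + r / del x) * (dotv (x - y) kap * quadf K a) <=
    quadf (1%:M + g^T *m g) a.
Proof.
move=> Wx fx r0 [z zx xz] a.
have [Ez fz] := extendable_foot openW W0 Wx r0 fx zx xz.
have [_] := foot_conditions a fz.
have -> : z - y = (1 + r / del x) *: (x - y).
  by rewrite Ez scalerDl scale1r addrAC.
by rewrite dotvZl; lra.
Qed.

Let Hmean := \tr (shape_operator f 0).

Let Hmean_height x : W x -> foot W x y ->
  del x * Hmean = dotv (x - y) kap * \tr (K *m invmx (1%:M + g^T *m g)).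
Proof.
move=> Wx fx; rewrite /Hmean /shape_operator mxtraceZ -/g -/K.
have [_ ->] := foot_height Wx fx.
have w0 : Num.sqrt (1 + dotv g g) != 0.
  by rewrite gt_eqF// sqrtr_gt0 ltr_wpDr// dotv_ge0.
by field.
Qed.

(** Summing [extension_height] over the projected coordinate directions gives
    [(1 + r / del x) * (del x * Hmean) <= n]. *)
Lemma one_sub_dist_mean_gt0 x r : (1 <= n)%N -> W x -> foot W x y -> 0 < r ->
  extendable W r x -> 0 < n%:R - del x * Hmean.
Proof.
move=> n1 Wx fx r0 xr; rewrite Hmean_height//.
have dx := dist_compl_gt0 openW W0 Wx.
have H i := extension_height Wx fx r0 xr (row i (TQ^T *m invmx (1%:M + g^T *m g))).
have := ler_sum (index_enum 'I_n.+1) (P := xpredT) (fun i _ => H i).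
rewrite sum_gram_proj// -!mulr_sumr (sum_quadf_proj _ TQ_TQ gram_u).
set tau := _ * \tr _; have l1 : 0 < r / del x by rewrite divr_gt0.
have n0 : 0 < n%:R :> R by rewrite ltr0n.
move=> H1; have [t0|t0] := leP tau 0; first by lra.
have : 0 < r / del x * tau by rewrite mulr_gt0.
by lra.
Qed.

Lemma second_difference_le x r eps : (1 <= n)%N -> W x -> foot W x y -> 0 < r ->
  extendable W r x -> 0 < eps ->
  \forall h \near (0 : R)^',
    \sum_(i < n.+1) (del (x + h *: delta_mx ord0 i) +
      del (x - h *: delta_mx ord0 i) - 2 * del x) <=
    h ^+ 2 * (- (n%:R * Hmean / (n%:R - del x * Hmean)) + eps).
Proof.
move=> n1 Wx fx r0 xr eps0.
have dx := dist_compl_gt0 openW W0 Wx.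
have pos := one_sub_dist_mean_gt0 n1 Wx fx r0 xr.
pose P := TQ^T *m invmx (1%:M + g^T *m g).
(* [alpha] minimizes [n - 2 n alpha + alpha^2 (n - del x * Hmean)]. *)
pose alpha := n%:R / (n%:R - del x * Hmean).
pose e i : 'rV[R]_n.+1 := delta_mx ord0 i.
pose a i := alpha *: row i P.
(* There are [2 * n.+1] barriers sharing the error. *)
pose eps' := eps / (2 * n.+1%:R).
have eps'0 : 0 < eps' by rewrite divr_gt0// mulr_gt0// ltr0n.
pose L i := (dotv (e i - a i *m TQ) (e i - a i *m TQ) - dotv (x - y) kap * quadf K (a i) -
       (dotv (x - y) (e i) / del x) ^+ 2) / (2 * del x).
have up : \forall h \near (0 : R)^', forall i : 'I_n.+1,
    del (x + h *: e i) <= del x + h * (dotv (x - y) (e i) / del x) + h ^+ 2 * (L i + eps').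
  by apply: filter_forall => i; exact: upper_barrier.
(* Reversing both the direction and the displacement preserves [L i] and flips the linear term, so
   the linear terms cancel in the second difference. *)
have down : \forall h \near (0 : R)^', forall i : 'I_n.+1,
    del (x - h *: e i) <= del x - h * (dotv (x - y) (e i) / del x) + h ^+ 2 * (L i + eps').
  apply: filter_forall => i.
  have := @upper_barrier x (- e i) (- a i) eps' Wx fx eps'0.
  apply: filterS => h; rewrite scalerN; congr (_ <= _ + _ + _ * (_ + _)).
    by rewrite dotvNr; ring.
  have E : - e i - - a i *m TQ = - (e i - a i *m TQ) by rewrite mulNmx !opprD.
  rewrite /L E.
  congr ((_ - _ * _ - _) / _).
  - by rewrite dotvNl dotvNr opprK.
  - by rewrite !quadfE mulNmx dotvNl dotvNr opprK.
  - by rewrite dotvNr; ring.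
have sumL : \sum_i (2 * L i) = - (n%:R * Hmean / (n%:R - del x * Hmean)).
  have S1 : \sum_i dotv (e i - a i *m TQ) (e i - a i *m TQ) =
      n.+1%:R - 2 * alpha * n%:R + alpha ^+ 2 * n%:R.
    rewrite -(sum_residual_proj TQ_TQ gram_u); apply: eq_bigr => i _.
    by rewrite /a -scalemxAl.
  have S2 : \sum_i dotv (x - y) kap * quadf K (a i) = alpha ^+ 2 * (del x * Hmean).
    rewrite Hmean_height// -(sum_quadf_proj K TQ_TQ gram_u) mulrCA !mulr_sumr.
    by apply: eq_bigr => i _; rewrite /a quadfZ; ring.
  (* This removes the normal direction from the count, turning [n.+1] into [n]. *)
  have S3 : \sum_i (dotv (x - y) (e i) / del x) ^+ 2 = 1.
    transitivity ((\sum_i (dotv (x - y) (e i)) ^+ 2) / del x ^+ 2).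
      by rewrite mulr_suml; apply: eq_bigr => i _; rewrite expr_div_n.
    rewrite (_ : \sum_i _ = dotv (x - y) (x - y)).
      by rewrite -enorm_sqr fx.2 divff// sqrf_eq0 gt_eqF.
    by apply: eq_bigr => i _; rewrite dotvC dotv_delta expr2.
  transitivity ((\sum_i dotv (e i - a i *m TQ) (e i - a i *m TQ) -
     \sum_i dotv (x - y) kap * quadf K (a i) -
     \sum_i (dotv (x - y) (e i) / del x) ^+ 2) / del x).
    rewrite -!sumrB mulr_suml; apply: eq_bigr => i _; rewrite /L.
    by field; rewrite gt_eqF.
  rewrite S1 S2 S3 /alpha -(natr1 n).
  by field; rewrite !gt_eqF.
near=> h.
have uph : forall i : 'I_n.+1, del (x + h *: e i) <=
  del x + h * (dotv (x - y) (e i) / del x) + h ^+ 2 * (L i + eps') by near: h.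
have downh : forall i : 'I_n.+1, del (x - h *: e i) <=
  del x - h * (dotv (x - y) (e i) / del x) + h ^+ 2 * (L i + eps') by near: h.
apply: (@le_trans _ _ (\sum_(i < n.+1) h ^+ 2 * (2 * L i + 2 * eps'))).
  apply: ler_sum => i _; have := uph i; have := downh i.
  move: (h * _) (h ^+ 2) => c s; lra.
rewrite -mulr_sumr big_split/= sumL sumr_const card_ord ler_wpM2l ?sqr_ge0//.
rewrite lerD2l (_ : (2 * eps') *+ n.+1 = eps)//.
have N0 : n.+1%:R != 0 :> R by rewrite pnatr_eq0.
by rewrite -[LHS]mulr_natr /eps'; move: n.+1%:R N0 => N N0; field.
Unshelve. all: by end_near. Qed.

(** Half the second derivative, in direction [v] at parameter [u], of the squared distance to the
    graph from a point whose height exceeds [f u] by [sigma]. *)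
Let Mq u sigma v := dotv v v + dotv v (gradient f u) ^+ 2 -
  sigma * quadf (hessian f u) v.

Let Mq_pos_near eta c : 0 < c -> (forall v, c * dotv v v <= Mq 0 eta v) ->
  exists2 r : R, 0 < r & forall u sigma v, enorm u < r -> `|sigma - eta| < r ->
    v != 0 -> 0 < Mq u sigma v.
Proof.
move=> c0 Mc.
pose F (i j : 'I_n) (p : 'rV[R]_n * R) :=
  partial i f p.1 * partial j f p.1 - p.2 * partial j (partial i f) p.1.
have cpart i : partial i f p.1 @[p --> ((0 : 'rV[R]_n), eta)] --> partial i f 0.
  apply: (@cvg_comp _ _ _ fst (partial i f) _ (nbhs (0 : 'rV[R]_n))); first exact: cvg_fst.
  by have [_ /(_ i)[_ [+ _]]] := C2; apply.
have cpart2 i j : partial j (partial i f) p.1 @[p --> ((0 : 'rV[R]_n), eta)] -->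
    partial j (partial i f) 0.
  apply: (@cvg_comp _ _ _ fst (partial j (partial i f)) _ (nbhs (0 : 'rV[R]_n))).
    exact: cvg_fst.
  by have [_ /(_ i)[_ [_ /(_ j)[_ [+ _]]]]] := C2; apply.
have cF i j : F i j p @[p --> ((0 : 'rV[R]_n), eta)] --> F i j (0, eta).
  apply: cvgB; first by apply: cvgM; exact: cpart.
  by apply: cvgM; [exact: cvg_snd|exact: cpart2].
(* Each of the [n ^ 2] coefficients multiplies at most [dotv v v], so the total perturbation stays
   below half of [c * dotv v v]. *)
pose eps := c / (2 * (n%:R ^+ 2 + 1)).
have nn : 0 < n%:R ^+ 2 + 1 :> R by rewrite ltr_wpDl// sqr_ge0.
have eps0 : 0 < eps by rewrite divr_gt0// mulr_gt0.
have [[A B] /= [/nbhs_enorm[r1 r10 H1] /nbhs_normP[r2 /= r20 H2]] AB] :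
    \forall p \near ((0 : 'rV[R]_n), eta), forall i j, `|F i j (0, eta) - F i j p| <= eps.
  have FF := nbhs_filter ((0 : 'rV[R]_n), eta).
  apply: (@filter_forall _ _ (fun i p => forall j, `|F i j (0, eta) - F i j p| <= eps) _ FF) => i.
  apply: (@filter_forall _ _ (fun j p => `|F i j (0, eta) - F i j p| <= eps) _ FF) => j.
  exact: (@cvgr_dist_le _ _ _ _ FF _ _ (cF i j) _ eps0).
exists (Num.min r1 r2); first by rewrite lt_min r10.
move=> u sigma v; rewrite lt_min => /andP[ur _]; rewrite lt_min => /andP[_ sr] v0.
have Fp i j : `|F i j (0, eta) - F i j (u, sigma)| <= eps.
  apply: (AB (u, sigma)); split => /=; first by apply: H1; rewrite subr0.
  by apply: H2; rewrite /ball_/= distrC.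
have MF w s : Mq w s v = dotv v v + \sum_i \sum_j v ord0 i * v ord0 j * F i j (w, s).
  rewrite /Mq -addrA; congr (_ + _).
  rewrite expr2 /dotv big_distrlr/= /quadf mulr_sumr -sumrB; apply: eq_bigr => i _.
  rewrite mulr_sumr -sumrB; apply: eq_bigr => j _; rewrite /F !mxE/=; ring.
have vp : 0 < dotv v v.
  by rewrite lt_def dotv_ge0 andbT; apply: contraNneq v0 => /dotv_eq0 ->.
have diff : `|Mq 0 eta v - Mq u sigma v| <= n%:R ^+ 2 * eps * dotv v v.
  rewrite !MF opprD addrACA subrr add0r -sumrB.
  apply: le_trans (ler_norm_sum _ _ _) _.
  apply: (@le_trans _ _ (\sum_(i < n) \sum_(j < n) eps * dotv v v)).
    apply: ler_sum => i _; rewrite -sumrB; apply: le_trans (ler_norm_sum _ _ _) _.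
    apply: ler_sum => j _; rewrite -mulrBr normrM mulrC ler_pM//.
    by rewrite normrM -enorm_sqr expr2 ler_pM ?enorm_coord.
  have NN (a : R) : (a *+ n) *+ n = n%:R ^+ 2 * a.
    by rewrite -mulrnA -[LHS]mulr_natl natrM expr2.
  by rewrite !sumr_const !card_ord NN mulrA.
have small : n%:R ^+ 2 * eps * dotv v v < c * dotv v v.
  rewrite ltr_pM2r// /eps mulrA ltr_pdivrMr ?mulr_gt0// mulrC ltr_pM2l//.
  by have := sqr_ge0 (n%:R : R); lra.
move: (Mc v) diff small; move: (Mq 0 eta v) (Mq u sigma v) => a b.
move: (c * dotv v v) (n%:R ^+ 2 * eps * dotv v v) => p q.
by rewrite ler_norml => ? /andP[? ?]; lra.
Qed.

(* Two feet close to [y] of the same point: the squared distance along the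
   segment joining their parameters is strictly convex and takes its minimum
   at both ends. *)
Lemma foot_unique_near x r : W x -> foot W x y -> 0 < r -> extendable W r x ->
  exists2 s : R, 0 < s & forall x' y' y'', W x' -> enorm (x' - x) < s ->
    foot W x' y' -> foot W x' y'' -> enorm (y' - y) < s -> enorm (y'' - y) < s ->
    y' = y''.
Proof.
move=> Wx fx r0 xr.
have dx := dist_compl_gt0 openW W0 Wx.
set eta := dotv (x - y) kap.
have etaE : height x = eta.
  rewrite /eta /kap dotvC dotv_mxl trmxK dotv_split.
  by rewrite vlast_col' vlast_last dot0v add0r mul1r.
pose lam := r / del x.
have lam0 : 0 < lam by rewrite divr_gt0.
have [s1 s10 Hs1] : exists2 s : R, 0 < s & forall u sigma v, enorm u < s ->
    `|sigma - eta| < s -> v != 0 -> 0 < Mq u sigma v.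
  (* The Hessian term is at most the Gram form divided by [1 + lam], which leaves the fraction
     [lam / (1 + lam)] of that form. *)
  apply: (@Mq_pos_near eta (lam / (1 + lam))); first by rewrite divr_gt0// addr_gt0.
  move=> v; have := extension_height Wx fx r0 xr v; rewrite -/lam -/eta quadf_gram.
  rewrite /Mq -/g -/K; set q := eta * _ => H.
  rewrite mulrAC ler_pdivrMr ?addr_gt0//.
  have := mulr_ge0 (ltW lam0) (sqr_ge0 (dotv v g)); lra.
have [s2 s20 Hs2] := surf_out.
have [cf _] := C2.
have s13 : 0 < s1 / 3 by rewrite divr_gt0.
have [s3 s30 Hs3] := continuous_enorm (cf _ U0) s13.
(* One third of [s1] covers the change of [height x'], another the values of [f] along the segment;
   [height x' - f] then stays within [s1] of [eta]. *)
pose s := Num.min (s1 / 3) (Num.min s2 (Num.min s3 rho)).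
have s0 : 0 < s by rewrite !lt_min s13 s20 s30.
exists s => // x' y' y'' Wx' xs fy' fy'' ys' ys''.
have bd z : foot W x' z -> enorm (z - y) < s -> z = surf (coord z).
  move=> fz zs; apply: boundary_graph; first by have [] := fz.
    by have /(nearest_pointP openW W0 z Wx')[[]] := fz.
  by apply: lt_le_trans zs _; rewrite /s !ge_min lexx !orbT.
have cs z : enorm (z - y) < s -> enorm (coord z) < s.
  by move=> zs; apply: le_lt_trans zs; have := coord_lip z y; rewrite coord_y subr0.
set u' := coord y'; set u'' := coord y''.
have Ey' : y' = surf u' by exact: bd.
have Ey'' : y'' = surf u'' by exact: bd.
have [uu|vn0] := eqVneq (u'' - u') 0.
  by rewrite Ey' Ey''; congr surf; apply/esym/eqP; rewrite -subr_eq0 uu.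
set v := u'' - u' in vn0; exfalso.
pose ut t := u' + t *: v.
have uts t : 0 <= t <= 1 -> enorm (ut t) < s.
  move=> /andP[t0 t1]; have -> : ut t = (1 - t) *: u' + t *: u''.
    by apply/rowP => i; rewrite !mxE; ring.
  apply: le_lt_trans (enormD _ _) _; rewrite !enormZ !ger0_norm ?subr_ge0//.
  have := cs _ ys'; have := cs _ ys''; rewrite -/u' -/u''.
  have [->|tn1] := eqVneq t 1; first by rewrite subrr mul0r add0r mul1r.
  move=> H1 H2; have t1' : 0 < 1 - t by rewrite subr_gt0 lt_neqAle tn1.
  have := ltr_pM2l t1' (enorm u') s; rewrite H2 => H3.
  have := ler_wpM2l t0 (ltW H1) => H4.
  lra.
have utU t : 0 <= t <= 1 -> U (ut t) /\ ~ W (surf (ut t)).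
  by move=> /uts H; apply: Hs2; apply: lt_le_trans H _; rewrite /s !ge_min lexx !orbT.
pose E t := dotv (coord x' - ut t) (coord x' - ut t) + (height x' - f (ut t)) ^+ 2.
have EE t : E t = dotv (x' - surf (ut t)) (x' - surf (ut t)).
  rewrite -(dotv_orth _ _ QQ) dotv_split.
  have -> : (x' - surf (ut t)) *m Q = (x' - y) *m Q - (surf (ut t) - y) *m Q.
    by rewrite -mulmxBl opprB addrA subrK.
  have E1 : col' ord_max ((x' - y) *m Q - (surf (ut t) - y) *m Q) = coord x' - ut t.
    by rewrite -[in RHS](surf_coord (ut t)); apply/rowP => i; rewrite !mxE.
  have E2 : ((x' - y) *m Q - (surf (ut t) - y) *m Q) ord0 ord_max = height x' - f (ut t).
    by rewrite -[in RHS](surf_height (ut t)) /height mxE [X in _ + X]mxE.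
  by rewrite E1 E2 /E expr2.
have Emin t : 0 <= t <= 1 -> del x' ^+ 2 <= E t.
  move=> /utU[_ Wt]; rewrite EE -enorm_sqr lerXn2r ?nnegrE ?enorm_ge0 ?dist_compl_ge0//.
  exact: dist_compl_le.
have E0 : E 0 = del x' ^+ 2.
  by rewrite EE /ut scale0r addr0 -Ey' -enorm_sqr fy'.2.
have E1 : E 1 = del x' ^+ 2.
  have u1 : ut 1 = u'' by rewrite /ut scale1r /v addrC subrK.
  by rewrite EE u1 -Ey'' -enorm_sqr fy''.2.
pose D t := - 2 * (dotv (coord x' - ut t) v +
  (height x' - f (ut t)) * dotv v (gradient f (ut t))).
have dE (t : R) : 0 <= t <= 1 -> is_derive t 1 E (D t).
  move=> /utU[Ut _].
  have df := is_derive_line (C1_is_derive v oU (Ck_onW C2) Ut).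
  have d1 : is_derive t 1 (fun t => dotv (coord x' - ut t) (coord x' - ut t))
      (- 2 * dotv (coord x' - ut t) v).
    apply: (@is_derive_quadratic _ R^o _ _ _ _ (dotv v v)) => h.
    have -> : ut (t + h *: 1) = ut t + h *: v.
      by rewrite /ut /GRing.scale/= mulr1 -addrA -scalerDl.
    rewrite opprD addrA; move: (coord x' - ut t) => w.
    rewrite dotv_sub_scale (_ : _ - _ - _ = h ^+ 2 * dotv v v); last by ring.
    rewrite ger0_norm; first by rewrite [leLHS]mulrC.
    by rewrite mulr_ge0// ?sqr_ge0// dotv_ge0.
  have d2 : is_derive t 1 (fun t => height x' - f (ut t)) (- dotv v (gradient f (ut t))).
    have := is_deriveB (@is_derive_cst _ _ _ (height x') t 1) df.
    by rewrite sub0r.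
  have d3 : is_derive t 1 (fun t => (height x' - f (ut t)) ^+ 2)
     (- 2 * ((height x' - f (ut t)) * dotv v (gradient f (ut t)))).
    have H := is_deriveM d2 d2.
    by apply: (is_derive_eq H); rewrite /GRing.scale/=; ring.
  have H := is_deriveD d1 d3.
  by apply: (is_derive_eq H); rewrite /D; ring.
have dD (t : R) : 0 <= t <= 1 ->
    is_derive t 1 D (2 * Mq (ut t) (height x' - f (ut t)) v).
  move=> /utU[Ut _].
  have df := is_derive_line (C1_is_derive v oU (Ck_onW C2) Ut).
  have dg := is_derive_line (C2_is_derive_gradient v v oU C2 Ut).
  have d1 : is_derive t 1 (fun t => dotv (coord x' - ut t) v) (- dotv v v).
    apply: (@is_derive_quadratic _ R^o _ _ _ _ 0) => h.
    have -> : ut (t + h *: 1) = ut t + h *: v.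
      by rewrite /ut /GRing.scale/= mulr1 -addrA -scalerDl.
    rewrite opprD addrA; move: (coord x' - ut t) => w.
    by rewrite dotvBl dotvZl (_ : _ - _ - _ = 0) ?normr0 ?mul0r//; ring.
  have d2 : is_derive t 1 (fun t => height x' - f (ut t)) (- dotv v (gradient f (ut t))).
    have := is_deriveB (@is_derive_cst _ _ _ (height x') t 1) df.
    by rewrite sub0r.
  have H := is_deriveZ (- 2) (is_deriveD d1 (is_deriveM d2 dg)).
  by apply: (is_derive_eq H); rewrite /GRing.scale/= /Mq /quadf; ring.
have half : 0 <= (1 / 2 : R) <= 1 by apply/andP; split; [rewrite divr_ge0|rewrite ler_pdivrMr// mul1r ler1n].
have := Emin _ half; rewrite -E0 leNgt => /negP; apply.
apply: (strict_convex_midpoint dE dD); last by rewrite E0 E1.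
move=> t t01; rewrite mulr_gt0//; have us := uts _ t01.
apply: Hs1 => //.
  by apply: lt_le_trans us _; rewrite /s ge_min ler_pdivrMr// ler_peMr ?ler1n// ltW.
have Hf : `|f (ut t)| <= s1 / 3.
  have := Hs3 (ut t); rewrite subr0 chart_f0 subr0; apply.
  by apply: lt_le_trans us _; rewrite /s !ge_min lexx !orbT.
have Hh : `|height x' - eta| < s1 / 3.
  rewrite -etaE; apply: le_lt_trans (height_lip _ _) _; apply: lt_le_trans xs _.
  by rewrite /s ge_min lexx.
rewrite addrAC; apply: le_lt_trans (ler_normB _ _) _.
apply: (lt_le_trans (ltr_leD Hh Hf)).
by rewrite -mulrDl ler_pdivrMr// mulr_natr mulrS mulr2n lerD2l lerDl ltW.
Qed.

(** To apply [foot_unique_near], all feet of nearby points must be close to [y]. Adding a ball about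
    [y] to [W] removes the only foot of [x], so the distance to what remains of the complement
    exceeds [del x], and a gap persists near [x]. *)
Lemma good_set_extendable x r : W x -> foot W x y -> 0 < r -> extendable W r x ->
  good_set W x.
Proof.
move=> Wx fx r0 xr.
have [s s0 Hs] := foot_unique_near Wx fx r0 xr.
pose W' := W `|` [set z | enorm (z - y) < s].
have openB : open [set z : 'rV[R]_n.+1 | enorm (z - y) < s].
  rewrite openE => z /= zs; apply/nbhs_enorm; exists (s - enorm (z - y)).
    by rewrite subr_gt0.
  by move=> z' zz' /=; have := enormB_trans z z' y; lra.
have openW' : open W' by exact: openU.
have [t t0 Ht] : exists2 t : R, 0 < t & forall x' y', enorm (x' - x) < t ->
    foot W x' y' -> enorm (y' - y) < s.
  (* With an empty complement [dist_compl W'] would be an infimum over the empty set; every foot is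
     then in the ball. *)
  have [ne|/set0P/negP/negPn/eqP E] := pselect (~` W' !=set0); last first.
    exists 1 => // x' y' _ [Wy' _]; apply: contrapT => Hy'.
    suff : (~` W') y' by rewrite E.
    by move=> [].
  have [z [nz xz]] := foot_exists openW' ne x.
  have Wz : ~ W z by move=> Wz; apply: nz; left.
  have dm : del x < dist_compl W' x.
    rewrite lt_neqAle -{2}xz dist_compl_le// andbT; apply/negP => /eqP E.
    have fz : foot W x z by split => //; rewrite xz -E.
    apply: nz; right; rewrite /= (extendable_unique openW W0 Wx r0 xr fz fx).
    by rewrite subrr enorm0.
  exists ((dist_compl W' x - del x) / 3); first by rewrite divr_gt0// subr_gt0.
  move=> x' y' xx' [Wy' xy']; rewrite ltNge; apply/negP => ys.
  have : dist_compl W' x <= enorm (x - y').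
    by apply: dist_compl_le => -[//|/=]; rewrite ltNge ys.
  have := enormB_trans x' x y'; rewrite xy' (enormBC x x').
  by have := dist_compl_lipschitz W0 x' x; lra.
have /nbhs_enorm[q q0 Hq] : nbhs x W by exact: open_nbhs_nbhs.
apply/nbhs_enorm; exists (Num.min q (Num.min s t)); first by rewrite !lt_min q0 s0.
move=> x'; rewrite !lt_min => /and3P[xq xs xt].
have Wx' := Hq _ xq; split => //.
have [y' fy'] := foot_exists openW W0 x'.
exists y'; split; first exact/nearest_pointP.
move=> y'' /nearest_pointP => /(_ openW W0 Wx') fy''.
by apply: (Hs x' y' y'' Wx' xs fy' fy''); [exact: (Ht x' y')|exact: (Ht x' y'')].
Qed.

End radius.
End chart.

(** * Principal curvatures are real *)

Section real_roots.
Context {R : realType}.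
Local Notation C := (R[i])%C.

Let ReMr (x : C) (y : R) : complex.Re (x * y%:C%C) = complex.Re x * y.
Proof. by case: x => a b /=; rewrite mulr0 subr0. Qed.

Let ImMr (x : C) (y : R) : complex.Im (x * y%:C%C) = complex.Im x * y.
Proof. by case: x => a b /=; rewrite mulr0 add0r. Qed.

Let Re_mulmx n (v : 'rV[C]_n) (A : 'M[R]_n) :
  map_mx (@complex.Re R) (v *m map_mx (real_complex R) A) = map_mx (@complex.Re R) v *m A.
Proof.
apply/rowP => j; rewrite !mxE raddf_sum; apply: eq_bigr => i _.
by rewrite !mxE; exact: ReMr.
Qed.

Let Im_mulmx n (v : 'rV[C]_n) (A : 'M[R]_n) :
  map_mx (@complex.Im R) (v *m map_mx (real_complex R) A) = map_mx (@complex.Im R) v *m A.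
Proof.
apply/rowP => j; rewrite !mxE raddf_sum; apply: eq_bigr => i _.
by rewrite !mxE; exact: ImMr.
Qed.

(** Write an eigenvector as [a + i b]. Pairing the real part of [v K = z v B] with [b] and the
    imaginary part with [a], symmetry leaves [Im z * (quadf B a + quadf B b) = 0]. *)
Let Im_eigenvalue n (K B : 'M[R]_n) (z : C) : K^T = K -> B^T = B ->
  (forall v, v != 0 -> 0 < quadf B v) ->
  eigenvalue (map_mx (real_complex R) (K *m invmx B)) z -> complex.Im z = 0.
Proof.
move=> Ks Bs Bpos /eigenvalueP[v vz v0].
have Bu := unitmx_pos Bpos.
have E : v *m map_mx (real_complex R) K = z *: (v *m map_mx (real_complex R) B).
  by rewrite -[K](mulmxKV Bu) map_mxM mulmxA vz scalemxAl.
set a := map_mx (@complex.Re R) v; set b := map_mx (@complex.Im R) v.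
have Ea : a *m K = complex.Re z *: (a *m B) - complex.Im z *: (b *m B).
  rewrite -Re_mulmx E -Re_mulmx -Im_mulmx; apply/rowP => j; rewrite !mxE.
  by case: z {vz E} => s t; case: (\sum_j0 _).
have Eb : b *m K = complex.Re z *: (b *m B) + complex.Im z *: (a *m B).
  rewrite -Im_mulmx E -Re_mulmx -Im_mulmx; apply/rowP => j; rewrite !mxE.
  by case: z {vz E Ea} => s t; case: (\sum_j0 _).
have sK : dotv (a *m K) b = dotv (b *m K) a by rewrite dotv_mxl Ks dotvC.
have sB : dotv (a *m B) b = dotv (b *m B) a by rewrite dotv_mxl Bs dotvC.
have : complex.Im z * (quadf B a + quadf B b) = 0.
  move: sK; rewrite Ea Eb !quadfE; rewrite dotvBl !dotvDl !dotvZl sB; lra.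
move=> /eqP; rewrite mulf_eq0 => /orP[/eqP//|/eqP ab0].
have Bge0 w : 0 <= quadf B w.
  have [->|w0] := eqVneq w 0; last exact/ltW/Bpos.
  by rewrite quadfE dotv0.
have a0 : a = 0.
  by apply/eqP; apply: contraT => /Bpos; have := Bge0 b; lra.
have b0 : b = 0.
  by apply/eqP; apply: contraT => /Bpos; have := Bge0 a; lra.
case/eqP: v0; apply/rowP => j.
have := congr1 (fun w : 'rV[R]_n => w ord0 j) a0.
have := congr1 (fun w : 'rV[R]_n => w ord0 j) b0.
by rewrite !mxE; case: (v ord0 j) => s t /= -> ->.
Qed.

(* [K B^-1] is self-adjoint for the inner product [B], so its complex
   eigenvalues are real. *)
Lemma char_poly_split n (K B : 'M[R]_n) : K^T = K -> B^T = B ->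
  (forall v, v != 0 -> 0 < quadf B v) ->
  exists kappa : 'rV[R]_n,
    char_poly (K *m invmx B) = \prod_(i < n) ('X - (kappa ord0 i)%:P).
Proof.
move=> Ks Bs Bpos; set M := K *m invmx B.
have [r Er] := closed_field_poly_normal (char_poly (map_mx (real_complex R) M)).
move: Er; rewrite (monicP (char_poly_monic _)) scale1r => Er.
have sr : size r = n.
  by have := size_char_poly (map_mx (real_complex R) M); rewrite Er size_prod_XsubC => -[].
exists (\row_i complex.Re r`_i).
apply: (map_poly_inj (real_complex R)); rewrite map_char_poly Er rmorph_prod/=.
rewrite (big_nth 0) sr big_mkord; apply: eq_bigr => i _.
rewrite map_polyXsubC mxE; congr ('X - _%:P).
have ir : r`_i \in r by rewrite mem_nth// sr.
have : complex.Im r`_i = 0.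
  apply: (Im_eigenvalue Ks Bs Bpos); rewrite eigenvalue_root_char Er.
  by rewrite root_prod_XsubC.
by case: (r`_i) => s t /= ->.
Qed.

Lemma sum_roots_char_poly n (A : 'M[R]_n) (kappa : 'rV[R]_n) :
  char_poly A = \prod_(i < n) ('X - (kappa ord0 i)%:P) ->
  \sum_(i < n) kappa ord0 i = \tr A.
Proof.
case: n A kappa => [|n] A kappa E; first by rewrite /mxtrace !big_ord0.
have := char_poly_trace A (ltn0Sn n); rewrite E /=.
have := coefPn_prod_XsubC (ps := [seq kappa ord0 i | i <- index_enum 'I_n.+1]).
have sz : size [seq kappa ord0 i | i <- index_enum 'I_n.+1] = n.+1.
  by rewrite size_map -[index_enum _]enumT size_enum_ord.
rewrite sz big_map => /(_ isT) /= -> /eqP.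
by rewrite eqr_opp big_map => /eqP.
Qed.

(** The given chart only shows that some curvature vector exists, by reality of the eigenvalues. The
    chart returned is the one witnessing the vector picked by [xget], and the estimates are then run
    in that chart. *)
Lemma mean_curvature_trace n (W : set 'rV[R]_n.+1) y : C2_boundary W ->
  boundary W y ->
  exists Q f, graph_chart W y Q f /\ mean_curvature W y = \tr (shape_operator f 0).
Proof.
move=> CW yW; have [Q [f chart]] := CW y yW.
have [kappa kappaE] : exists kappa, are_principal_curvatures W y kappa.
  have [_ _ [U [oU U0 C2]] _] := chart.
  have [kappa E] := @char_poly_split n
    ((Num.sqrt (1 + dotv (gradient f 0) (gradient f 0)))^-1 *: hessian f 0)
    (1%:M + (gradient f 0)^T *m gradient f 0)
    (ltac:(by rewrite linearZ/= (hessian_sym oU C2 U0))) (gram_sym _)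
    (ltac:(by move=> v v0; rewrite quadf_gram ltr_wpDr ?sqr_ge0// lt_def dotv_ge0 andbT;
      apply: contraNneq v0 => /dotv_eq0 ->)).
  exists kappa, Q, f; split => //; rewrite -E /shape_operator.
  by rewrite scalemxAl.
have : are_principal_curvatures W y (principal_curvatures W y).
  exact: (@xgetPex _ (0 : 'rV[R]_n) _ (ex_intro _ kappa kappaE)).
move=> [Q' [f' [chart' E]]]; exists Q', f'; split => //.
exact: sum_roots_char_poly E.
Qed.

End real_roots.

(** * Passage to the limit *)

Section fatou_limit.
Context d (T : measurableType d) (R : realType).
Variables (mu : {measure set T -> \bar R}) (D : set T).
Local Open Scope ereal_scope.

Lemma limn_einf_ge (u : R^nat) (l : R) :
  (forall e : R, (0 < e)%R -> \forall k \near \oo, (l - e <= u k)%R) ->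
  l%:E <= limn_einf (EFin \o u).
Proof.
move=> H; rewrite limn_einf_lim; apply/lee_subgt0Pr => e e0.
apply: lime_ge; first exact: is_cvg_einfs.
have [N _ HN] := H e e0; exists N => // m /= Nm.
apply: le_ereal_inf_tmp => _ [k /= mk <-]; rewrite -EFinB lee_fin.
by apply: HN => /=; exact: leq_trans mk.
Qed.

(** [f] carries no measurability assumption: Fatou's lemma is applied to the lower limit [h] of the
    nonnegative functions [F k + psi], and [f <= h - psi] enters only through monotonicity. The
    integrals of [F k] are known through those of [G k], which converge by domination. *)
Lemma le_integral_fatou (F G : nat -> T -> R) (f G0 psi g : T -> R) : measurable D ->
  (forall k, mu.-integrable D (EFin \o F k)) ->
  (forall k, measurable_fun D (G k)) ->
  mu.-integrable D (EFin \o psi) -> mu.-integrable D (EFin \o g) ->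
  (forall k x, D x -> (- psi x <= F k x)%R) ->
  (forall k x, D x -> (`|G k x| <= g x)%R) ->
  (forall x, D x -> G ^~ x @ \oo --> G0 x) ->
  (forall k, \int[mu]_(x in D) (G k x)%:E = \int[mu]_(x in D) (F k x)%:E) ->
  (forall x, D x -> forall e : R, (0 < e)%R ->
    \forall k \near \oo, (f x - e <= F k x)%R) ->
  \int[mu]_(x in D) (f x)%:E <= \int[mu]_(x in D) (G0 x)%:E.
Proof.
move=> mD iF mG ipsi ig psiF Gg GG0 GF fF.
have mF k : measurable_fun D (fun x => (F k x + psi x)%:E).
  apply/measurable_EFinP; apply: measurable_funD.
    exact/measurable_EFinP/(measurable_int mu (iF k)).
  exact/measurable_EFinP/(measurable_int mu ipsi).
have [iG0 _ cG] : [/\ mu.-integrable D (EFin \o G0),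
    [sequence \int[mu]_(x in D) `|(G k x)%:E - (G0 x)%:E|]_k @ \oo --> 0 &
    [sequence \int[mu]_(x in D) (G k x)%:E]_k @ \oo --> \int[mu]_(x in D) (G0 x)%:E].
  apply: (@dominated_convergence _ _ _ _ _ mD (fun k x => (G k x)%:E) (EFin \o G0) (EFin \o g)) => //.
  - by move=> k; exact/measurable_EFinP.
  - exact/measurable_EFinP/(measurable_fun_cvg mG).
  - by apply: aeW => x Dx; apply: cvg_EFin; [exact: nearW|exact: GG0].
  - by apply: aeW => x k Dx; rewrite /= lee_fin Gg.
pose h x := limn_einf (fun k => (F k x + psi x)%:E).
have mh : measurable_fun D h.
  apply: measurableT_comp => //; apply: measurable_fun_limn_esup => k.
  exact: measurableT_comp.
have F0 k x : D x -> 0 <= (F k x + psi x)%:E.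
  by move=> Dx; rewrite lee_fin; have := psiF k x Dx; lra.
have h0 x : D x -> 0 <= h x.
  move=> Dx; apply: limn_einf_ge => e e0; apply: nearW => k.
  by have := psiF k x Dx; lra.
have hle : \int[mu]_(x in D) h x <= \int[mu]_(x in D) (G0 x)%:E + \int[mu]_(x in D) (psi x)%:E.
  apply: le_trans (fatou mu mD mF F0) _.
  have cF : (fun k => \int[mu]_(x in D) (F k x + psi x)%:E) @ \oo -->
      \int[mu]_(x in D) (G0 x)%:E + \int[mu]_(x in D) (psi x)%:E.
    rewrite (_ : (fun k => _) = fun k =>
        \int[mu]_(x in D) (G k x)%:E + \int[mu]_(x in D) (psi x)%:E); last first.
      apply/funext => k; rewrite GF -integralD//; last exact: iF.
    apply: cvgeD => //; last exact: cvg_cst.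
    by rewrite fin_num_adde_defr// integrable_fin_num.
  by have [-> _] := cvg_limn_einf_sup cF.
have psi_fin := integrable_fin_num mD ipsi.
have ih : mu.-integrable D h.
  apply/integrableP; split => //.
  under eq_integral => x /set_mem Dx do rewrite gee0_abs ?h0//.
  apply: (le_lt_trans hle); rewrite -ge0_fin_numE; last first.
    by apply: le_trans (integral_ge0 _ h0) hle.
  by rewrite fin_numD psi_fin integrable_fin_num.
apply: (@le_trans _ _ (\int[mu]_(x in D) (h \- (EFin \o psi)) x)).
  apply: (@le_integral_off_negligible _ _ _ mu D set0) => // x Dx _ /=.
  rewrite EFinN leeBrDr//; apply: limn_einf_ge => e e0.
  by near=> k; have : (f x - e <= F k x)%R; [near: k; exact: fF|lra].
by rewrite integralB// leeBlDr.
Unshelve. all: by end_near. Qed.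

End fatou_limit.

(** * Discrete integration by parts *)

Section green.
Context {R : realType} (n : nat).
Implicit Types (u phi : 'rV[R]_n -> R) (M L : R).

Lemma bounded_support_integrable phi M L : measurable_fun setT phi -> 0 <= M ->
  (forall x, phi x != 0 -> `|x| <= M) -> (forall x, `|phi x| <= L) ->
  (lebesgue_row n).-integrable setT (EFin \o phi).
Proof.
move=> mphi M0 phiM phiL.
have : (lebesgue_row n).-integrable (cbox M) (EFin \o phi).
  apply: measurable_bounded_integrable.
  - exact: cbox_measurable.
  - by change (lebesgue_row n (cbox M) < +oo)%E; rewrite lebesgue_row_cbox// ltry.
  - exact: measurable_funTS.
  - by exists L; split; [exact: num_real|move=> K LK x _; exact: le_trans (ltW LK)].
move=> /(integrable_mkcond _ (@cbox_measurable _ n M)); congr (_.-integrable _ _).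
apply/funext => x; rewrite patchE; case: ifPn => // /negP xM.
apply/esym; rewrite /=; congr _%:E; apply/eqP; apply: contraT => /phiM xn.
by case: xM; apply/mem_set/cboxP.
Qed.

Lemma continuous_support_bounded phi M : continuous phi -> 0 <= M ->
  (forall x, phi x != 0 -> `|x| <= M) -> exists2 L, 0 <= L & forall x, `|phi x| <= L.
Proof.
move=> cphi M0 phiM.
have : compact (phi @` cbox M).
  by apply: continuous_compact; [exact: continuous_subspaceT|exact: cbox_compact].
move=> /compact_bounded[L [_ HL]]; exists (`|L| + 1) => // x.
have [->|x0] := eqVneq (phi x) 0; first by rewrite normr0.
apply: (HL (`|L| + 1)); first by rewrite (le_lt_trans (ler_norm _))// ltrDl.
by exists x => //; apply/cboxP => //; exact: phiM.
Qed.

Lemma continuous_translate (f : 'rV[R]_n -> R) (a : 'rV[R]_n) : continuous f ->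
  continuous (fun x : 'rV[R]_n => f (x + a)).
Proof.
move=> cf x A /cf /nbhs_enorm[e e0 He]; apply/nbhs_enorm; exists e => // y ye.
by apply: He; rewrite opprD addrACA subrr addr0.
Qed.

Lemma continuous_support_integrable phi M : continuous phi -> 0 <= M ->
  (forall x, phi x != 0 -> `|x| <= M) ->
  (lebesgue_row n).-integrable setT (EFin \o phi).
Proof.
move=> cphi M0 phiM; have [L L0 HL] := continuous_support_bounded cphi M0 phiM.
by apply: (bounded_support_integrable _ M0 phiM HL); exact: continuous_measurable_row.
Qed.

(** Here [l x = p (x + a) - q x] and [r x = p x - q x] with [p], [q] integrable, so the identity is
    translation invariance of the integral of [p]. *)
Lemma discrete_integration_by_parts u phi M (a : 'rV[R]_n) : continuous u ->
  continuous phi -> 0 <= M -> (forall x, phi x != 0 -> `|x| <= M) ->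
  let l x := (u (x + a) - u x) * (phi (x + a) - phi x) in
  let r x := - (phi x * (u (x + a) + u (x - a) - 2 * u x)) in
  [/\ (lebesgue_row n).-integrable setT (EFin \o l),
      (lebesgue_row n).-integrable setT (EFin \o r) &
      \int[lebesgue_row n]_x (l x)%:E = \int[lebesgue_row n]_x (r x)%:E]%E.
Proof.
move=> cu cphi M0 phiM l r.
have cua b : continuous (fun x : 'rV[R]_n => u (x + b)).
  exact: continuous_translate.
pose p x := (u x - u (x - a)) * phi x.
pose q x := (u (x + a) - u x) * phi x.
have cp : continuous p by move=> x; apply: cvgM (cphi x); apply: cvgB; [exact: cu|exact: cua].
have cq : continuous q by move=> x; apply: cvgM (cphi x); apply: cvgB; [exact: cua|exact: cu].
have supp (v : 'rV[R]_n -> R) x : v x * phi x != 0 -> `|x| <= M.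
  by rewrite mulf_eq0 negb_or => /andP[_]; exact: phiM.
have ip := continuous_support_integrable cp M0 (supp _).
have iq := continuous_support_integrable cq M0 (supp _).
have ipa : (lebesgue_row n).-integrable setT (EFin \o (fun x => p (x + a))).
  apply: (@continuous_support_integrable _ (M + `|a|)).
  - exact: continuous_translate.
  - by rewrite addr_ge0.
  - move=> x /(supp (fun x => u x - u (x - a))) xa; rewrite -[x](addrK a).
    by apply: le_trans (ler_normB _ _) _; rewrite lerD2r.
have lE : (EFin \o l = (EFin \o (fun x => p (x + a)%R)) \- (EFin \o q))%E.
  by apply/funext => x; rewrite /= -EFinB /l /p /q addrK; congr _%:E; ring.
have rE : (EFin \o r = (EFin \o p) \- (EFin \o q))%E.
  by apply/funext => x; rewrite /= -EFinB /r /p /q; congr _%:E; ring.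
split; [by rewrite lE; exact: integrableB|by rewrite rE; exact: integrableB|].
transitivity (\int[lebesgue_row n]_x (EFin \o l) x)%E => //.
transitivity (\int[lebesgue_row n]_x (EFin \o r) x)%E => //.
rewrite lE rE !integralB//; congr (_ - _)%E.
apply: (@integral_translation _ n a (EFin \o p)) ipa.
by apply/measurable_EFinP; exact: continuous_measurable_row.
Qed.

End green.

(** * Semiconcavity and differentiability of the distance *)

Section distance_differences.
Context {R : realType} (d : nat) (W : set 'rV[R]_d).
Hypothesis openW : open W.
Hypothesis W0 : ~` W !=set0.
Local Notation del := (dist_compl W).
Implicit Types x y v a w : 'rV[R]_d.

Let enorm_add_ub w a : 0 < enorm w ->
  enorm (w + a) <= enorm w + (2 * dotv w a + dotv a a) / (2 * enorm w).
Proof.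
move=> w0; set s := enorm (w + a); set t := enorm w in w0 *.
have E : s ^+ 2 = t ^+ 2 + (2 * dotv w a + dotv a a).
  by rewrite !enorm_sqr !dotvE (dotvC a w); ring.
rewrite -(ler_pM2l (_ : 0 < 2 * t)) ?mulr_gt0// mulrDr mulrC.
rewrite [X in _ <= _ + X]mulrC divfK ?gt_eqF ?mulr_gt0//.
have := sqr_ge0 (s - t); move: E.
move: (2 * dotv w a + dotv a a) s t {w0} => q s t; nra.
Qed.

(** One foot of [x] serves as competitor for both [x + a] and [x - a], and the linear terms
    cancel. *)
Lemma dist_compl_second_difference x a : W x ->
  del (x + a) + del (x - a) - 2 * del x <= dotv a a / del x.
Proof.
move=> Wx; have dx := dist_compl_gt0 openW W0 Wx.
have [y [Wy xy]] := foot_exists openW W0 x.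
have w0 : 0 < enorm (x - y) by rewrite xy.
have H1 : del (x + a) <= enorm (x - y + a) by rewrite addrAC; exact: dist_compl_le.
have H2 : del (x - a) <= enorm (x - y - a) by rewrite addrAC; exact: dist_compl_le.
have := enorm_add_ub a w0; have := enorm_add_ub (- a) w0.
move: H1 H2; rewrite xy !dotvE => H1 H2 H3 H4.
have -> : dotv a a / del x = (2 * dotv (x - y) a + dotv a a) / (2 * del x) +
    (2 * - dotv (x - y) a + - - dotv a a) / (2 * del x).
  by field; rewrite gt_eqF.
lra.
Qed.

(** [del] is squeezed between the distance to [y] and [del z] minus the distance to [z], which have
    the same value and the same gradient at [x]. *)
Lemma dist_compl_is_derive r x y v : W x -> 0 < r -> extendable W r x ->
  foot W x y -> is_derive x v del (dotv (x - y) v / del x).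
Proof.
move=> Wx r0 [z zx xz] fy; have dx := dist_compl_gt0 openW W0 Wx.
have [zE _] := extendable_foot openW W0 Wx r0 fy zx xz.
have [Wy xy] := fy.
have ub h : del (x + h *: v) <= enorm (x - y + h *: v).
  by rewrite addrAC; exact: dist_compl_le.
have w0 : 0 < enorm (x - y) by rewrite xy.
have zxE : z - x = (r / del x) *: (x - y) by rewrite zE addrC addKr.
have nzx : enorm (z - x) = r.
  by rewrite zxE enormZ xy gtr0_norm ?divr_gt0// divfK ?gt_eqF.
move: (x - y) ub w0 xy zxE => w ub w0 xy zxE.
apply: (@is_derive_quadratic _ _ _ _ _ _ (dotv v v / (2 * del x) + dotv v v / (2 * r))) => h.
have q1 : 0 <= h ^+ 2 * (dotv v v / (2 * del x)).
  by rewrite mulr_ge0 ?sqr_ge0// divr_ge0 ?dotv_ge0// mulr_ge0// ltW.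
have q2 : 0 <= h ^+ 2 * (dotv v v / (2 * r)).
  by rewrite mulr_ge0 ?sqr_ge0// divr_ge0 ?dotv_ge0// mulr_ge0// ltW.
have lb : del z - del (x + h *: v) <= enorm (z - x - h *: v).
  by have := dist_compl_lipschitz W0 z (x + h *: v); rewrite opprD addrA.
have := enorm_add_ub (h *: v) w0; have := enorm_add_ub (- (h *: v)) (_ : 0 < enorm (z - x)).
rewrite nzx => /(_ r0); move: (ub h) lb; rewrite xy zxE !dotvE -zxE => {}ub lb E1 E2.
have E1' : (2 * - (r / del x * (h * dotv w v)) + - - (h * (h * dotv v v))) / (2 * r) =
    h ^+ 2 * (dotv v v / (2 * r)) - h * (dotv w v / del x).
  by field; rewrite !gt_eqF.
have E2' : (2 * (h * dotv w v) + h * (h * dotv v v)) / (2 * del x) =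
    h ^+ 2 * (dotv v v / (2 * del x)) + h * (dotv w v / del x).
  by field; rewrite gt_eqF.
rewrite E1' in E1; rewrite E2' in E2.
rewrite [leRHS]mulrC mulrDr ler_norml; apply/andP; split; lra.
Qed.

End distance_differences.

(** * Difference quotients along the steps [1 / (k + 1)] *)

Section difference_quotients.
Context {R : realType} (d : nat).
Implicit Types (phi : 'rV[R]_d -> R) (x v : 'rV[R]_d).

Lemma near_inv_nat (P : R -> Prop) : (\forall h \near 0^', P h) ->
  \forall k \near \oo, P k.+1%:R^-1.
Proof.
move=> /nbhs_ballP[e /= e0 He].
have [N _ HN] : \forall k \near \oo, k.+1%:R^-1 < e by exact: near_infty_natSinv_lt (PosNum e0).
exists N => // k /HN ke; apply: He; last by rewrite invr_neq0 ?pnatr_eq0.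
by rewrite /ball/= sub0r normrN gtr0_norm ?invr_gt0.
Qed.

Lemma is_derive_diff_quotient phi x v (l : R) : is_derive x v phi l ->
  (fun k => k.+1%:R * (phi (x + k.+1%:R^-1 *: v) - phi x)) @ \oo --> l.
Proof.
move=> /is_derive_epsP H; apply/cvgrPdist_le => e /H[r r0 Hr].
have := @near_inv_nat (fun h => `|h^-1 * (phi (x + h *: v) - phi x) - l| <= e).
move=> Hn; have : \forall k \near \oo,
    `|k.+1%:R^-1^-1 * (phi (x + k.+1%:R^-1 *: v) - phi x) - l| <= e.
  apply: Hn; apply/nbhs_ballP; exists r => // h; rewrite /ball/= sub0r normrN => hr h0.
  have h1 : 0 < `|h| by rewrite normr_gt0.
  rewrite -(ler_pM2l h1) -normrM mulrBr mulVKf//.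
  by rewrite [X in _ <= X]mulrC; exact: Hr.
by apply: filterS => k; rewrite invrK distrC.
Qed.

(** Applied to the test function: its partial derivatives vanish wherever it does. *)
Lemma is_derive_min0 phi x v (l : R) : (forall y, 0 <= phi y) -> phi x = 0 ->
  is_derive x v phi l -> l = 0.
Proof.
move=> p0 px /is_derive_epsP H; apply/eqP; rewrite -normr_le0.
apply/ler_addgt0Pr => e /H[r r0 Hr]; rewrite add0r.
have r2 : `|r / 2| < r by rewrite gtr0_norm ?divr_gt0//; lra.
have r2' : `|- (r / 2)| < r by rewrite normrN.
have := Hr _ r2; have := Hr _ r2'; rewrite px !subr0 normrN (gtr0_norm (_ : 0 < r / 2)) ?divr_gt0//.
have := p0 (x + (r / 2) *: v); have := p0 (x + - (r / 2) *: v).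
move=> pm pp; rewrite !ler_norml => /andP[_ b1] /andP[_ b2].
have q0 : 0 < r / 2 by rewrite divr_gt0.
apply/andP; split; nra.
Qed.

End difference_quotients.

(** * From second differences to the weak inequality *)

Section weak_laplacian.
Context {R : realType} (d : nat) (W : set 'rV[R]_d).
Hypothesis openW : open W.
Hypothesis W0 : ~` W !=set0.
Variable phi : 'rV[R]_d -> R.
Hypothesis phi_test : test_function W phi.
Hypothesis phi_ge0 : forall x, 0 <= phi x.
Local Notation del := (dist_compl W).
Local Notation mu := (lebesgue_row d).
Local Notation e_ i := (delta_mx ord0 i : 'rV[R]_d).

Let C1 : Ck_on 1 setT phi. Proof. by case: phi_test => /(_ 1). Qed.

Let phi_cont : continuous phi. Proof. by move=> x; case: C1 => /(_ x I). Qed.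

Let phi_out x : ~ W x -> phi x = 0.
Proof.
move=> Wx; have [_ _ sW] := phi_test.
by apply/eqP; apply: contraT => px; case: Wx; apply/sW/subset_closure.
Qed.

Let phi_derive i x : is_derive x (e_ i) phi (partial i phi x).
Proof. by apply: Ck_on_is_derive_partial C1 _. Qed.

Let partial0 i x : phi x = 0 -> partial i phi x = 0.
Proof. by move=> p0; apply: is_derive_min0 phi_ge0 p0 (phi_derive i x). Qed.

Let phi_support : exists2 M, 0 <= M & forall x, phi x != 0 -> `|x| <= M.
Proof.
have [_ /compact_bounded[M [_ HM]] _] := phi_test.
exists (`|M| + 1) => // x px; apply: (HM (`|M| + 1)).
  by rewrite (le_lt_trans (ler_norm _))// ltrDl.
exact: subset_closure.
Qed.

Let phi_lipschitz : exists2 L, 0 <= L &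
  forall i x (h : R), `|phi (x + h *: e_ i) - phi x| <= L * `|h|.
Proof.
have [M M0 suppM] := phi_support.
have /choice[L HL] (i : 'I_d) : exists L, 0 <= L /\ forall x, `|partial i phi x| <= L.
  have cp : continuous (partial i phi).
    by move=> x; have [_ /(_ i)[_ [/(_ x I)]]] := C1.
  have [x|L] := continuous_support_bounded cp M0; last by exists L.
  by move=> px; apply: suppM; apply: contra_neq px => /partial0.
exists (\sum_i L i) => [|i x h]; first by apply: sumr_ge0 => i _; case: (HL i).
have [c _] := @MVT_line R (fun t => phi (x + t *: e_ i))
  (fun t => partial i phi (x + t *: e_ i)) h (fun t _ => is_derive_line (phi_derive i _)).
rewrite scale0r addr0 => ->; rewrite normrM ler_wpM2r//.
apply: le_trans ((HL i).2 _) _; rewrite (bigD1 i)//= lerDl.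
by apply: sumr_ge0 => j _; case: (HL j).
Qed.

Let del_below : exists2 c, 0 < c & forall x, phi x != 0 -> c <= del x.
Proof.
have [_ cK KW] := phi_test.
have [K0|/set0P/negP/negPn/eqP K0] := pselect (closure [set x | phi x != 0] !=set0).
  have [|c cK' Hc] := @EVT_min_rV _ _ del _ K0 cK.
    by apply: continuous_subspaceT; exact: dist_compl_continuous.
  exists (del c); first by apply: dist_compl_gt0 => //; apply: KW; exact/set_mem.
  by move=> x px; apply: Hc; apply/mem_set/subset_closure.
exists 1 => // x px.
have : closure [set x | phi x != 0] x by exact: subset_closure.
by rewrite K0.
Qed.

(** [G] and [F] are the two integrands of [discrete_integration_by_parts] for step [1 / (k + 1)]
    along [e_ i], with the factor [h ^- 2] absorbed into the function [u]. *)
Let G k i x := (k.+1%:R ^+ 2 * del (x + k.+1%:R^-1 *: e_ i) - k.+1%:R ^+ 2 * del x) *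
  (phi (x + k.+1%:R^-1 *: e_ i) - phi x).
Let F k i x := - (phi x * (k.+1%:R ^+ 2 * del (x + k.+1%:R^-1 *: e_ i) +
  k.+1%:R ^+ 2 * del (x - k.+1%:R^-1 *: e_ i) - 2 * (k.+1%:R ^+ 2 * del x))).

Let GF k i : [/\ mu.-integrable setT (EFin \o G k i), mu.-integrable setT (EFin \o F k i) &
  (\int[mu]_x (G k i x)%:E = \int[mu]_x (F k i x)%:E)%E].
Proof.
have [M M0 suppM] := phi_support.
apply: (discrete_integration_by_parts (u := fun x => k.+1%:R ^+ 2 * del x)) M0 suppM => //.
apply: (@lipschitz_enorm_continuous _ _ _ (k.+1%:R ^+ 2)) => [|x y]; first exact: sqr_ge0.
by rewrite -mulrBr ler_wpM2l ?sqr_ge0// dist_compl_lipschitz.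
Qed.

Let invS_gt0 k : 0 < k.+1%:R^-1 :> R. Proof. by rewrite invr_gt0. Qed.

Let del_quotient k i x : `|del (x + k.+1%:R^-1 *: e_ i) - del x| <= k.+1%:R^-1.
Proof.
have E : enorm (x + k.+1%:R^-1 *: e_ i - x) = k.+1%:R^-1.
  by rewrite (addrC x) addrK enormZ enorm_delta mulr1 gtr0_norm.
rewrite -[leRHS]E ler_norml -lerNl opprB dist_compl_lipschitz// andbT.
by rewrite enormBC dist_compl_lipschitz.
Qed.

Let G_bound : exists2 g : 'rV[R]_d -> R, mu.-integrable setT (EFin \o g) &
  forall k x, `|\sum_i G k i x| <= g x.
Proof.
have [M M0 suppM] := phi_support; have [L L0 lipL] := phi_lipschitz.
(* The steps have length at most 1, so enlarging the cube around the support by 1 contains all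
   translates. *)
pose g (x : 'rV[R]_d) := d%:R * L * \1_(cbox (M + 1)) x.
have M1 : 0 <= M + 1 by rewrite addr_ge0.
exists g.
  apply: (@bounded_support_integrable _ _ _ (M + 1) (d%:R * L)) => //.
  - apply: measurable_funM; first exact: measurable_cst.
    by apply: measurable_indic; exact: cbox_measurable.
  - move=> x; rewrite /g indicE; case: (boolP (x \in _)) => [/set_mem/(cboxP _ M1)//|_].
    by rewrite mulr0 eqxx.
  - move=> x; rewrite /g indicE; case: (_ \in _); last by rewrite mulr0 normr0 mulr_ge0.
    by rewrite mulr1 ger0_norm// mulr_ge0.
move=> k x; rewrite /g indicE; have [xM|xM] := boolP (x \in cbox (M + 1)).
  rewrite mulr1 mulr_natl -[X in _ *+ X]card_ord -sumr_const.
  apply: le_trans (ler_norm_sum _ _ _) (ler_sum _ _) => i _.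
  have H1 := del_quotient k i x.
  have H2 := lipL i x k.+1%:R^-1; rewrite (gtr0_norm (invS_gt0 k)) in H2.
  rewrite /G -mulrBr -mulrA normrM ger0_norm ?sqr_ge0// normrM.
  rewrite -[leRHS](mulVKf (_ : k.+1%:R ^+ 2 != 0)) ?expf_neq0 ?pnatr_eq0//.
  rewrite ler_wpM2l ?sqr_ge0// -exprVn expr2 -mulrA [_ * L]mulrC.
  by apply: ler_pM.
rewrite mulr0 big1 ?normr0// => i _; rewrite /G.
have px : phi x = 0.
  apply: contraNeq xM => /suppM xM; apply/mem_set/cboxP => //.
  by rewrite (le_trans xM)// lerDl.
have -> : phi (x + k.+1%:R^-1 *: e_ i) = 0.
  apply: contraNeq xM => /suppM xM; apply/mem_set/cboxP => //.
  rewrite -[x](addrK (k.+1%:R^-1 *: e_ i)); apply: le_trans (ler_normB _ _) _.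
  apply: lerD => //; apply: le_trans (norm_le_enorm _) _.
  by rewrite enormZ enorm_delta mulr1 gtr0_norm// invf_le1 ?ler1n.
by rewrite px subrr mulr0.
Qed.

Let F_bound : exists C, forall k x, - (C * phi x) <= \sum_i F k i x.
Proof.
have [c c0 Hc] := del_below.
(* Semiconcavity costs [1 / del x <= 1 / c] per direction on the support. *)
exists (d%:R / c) => k x; have [px|px] := eqVneq (phi x) 0.
  by rewrite px mulr0 oppr0 sumr_ge0// => i _; rewrite /F px mul0r oppr0.
have Wx : W x by apply: contrapT => /phi_out /eqP; exact/negP.
have p0 := phi_ge0 x.
rewrite -mulrA mulr_natl -[X in _ *+ X]card_ord -mulNrn -sumr_const.
apply: ler_sum => i _; rewrite /F lerNl opprK.
have := dist_compl_second_difference openW W0 (k.+1%:R^-1 *: e_ i) Wx.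
rewrite dotvZl dotvZr dotv_delta mxE !eqxx mulr1 => H.
rewrite [leRHS]mulrC ler_wpM2l// mulrCA -mulrDr -mulrBr.
rewrite -(ler_pM2l (_ : 0 < (k.+1%:R^-1) ^+ 2)) ?exprn_gt0//.
rewrite exprVn mulKf ?expf_neq0 ?pnatr_eq0// -exprVn expr2.
by apply: le_trans H _; rewrite ler_wpM2l ?mulr_ge0// lef_pV2 ?posrE// ?Hc// (lt_le_trans c0)// Hc.
Qed.

Let G_cvg x : ~ cut W x ->
  (fun k => \sum_i G k i x) @ \oo --> dotv (gradient del x) (gradient phi x).
Proof.
move=> cx; rewrite /dotv.
apply: cvg_big => [|i _]; first exact: add_continuous.
have E k : G k i x = (k.+1%:R * (del (x + k.+1%:R^-1 *: e_ i) - del x)) *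
    (k.+1%:R * (phi (x + k.+1%:R^-1 *: e_ i) - phi x)).
  by rewrite /G; ring.
under eq_fun do rewrite E.
have cphi := is_derive_diff_quotient (phi_derive i x).
rewrite !mxE; have [px|px] := eqVneq (phi x) 0; last first.
  have Wx : W x by apply: contrapT => /phi_out /eqP; exact/negP.
  have [r r0 xr] := not_cut Wx cx; have [y fy] := foot_exists openW W0 x.
  apply: cvgM cphi; apply: is_derive_diff_quotient.
  have Dd := dist_compl_is_derive openW W0 (e_ i) Wx r0 xr fy.
  by apply: derivableP; exact: ex_derive.
(* Where [phi] vanishes, [del] may fail to be differentiable; its quotients are bounded by 1 while
   those of [phi] tend to 0, and the limit integrand is 0 whatever value [partial i del x] takes. *)
rewrite (partial0 i px) mulr0; rewrite (partial0 i px) in cphi.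
apply/norm_cvg0P; apply: (@squeeze_cvgr _ _ _ _ (fun=> 0)
   (fun k => `|k.+1%:R * (phi (x + k.+1%:R^-1 *: e_ i) - phi x)|)).
- apply: nearW => k; rewrite normr_ge0 normrM ler_piMl//.
  by rewrite normrM ger0_norm// -ler_pdivlMl// mulr1 del_quotient.
- exact: cvg_cst.
- by apply/norm_cvg0P.
Qed.

Lemma weak_laplacian_ge (f : 'rV[R]_d -> R) :
  (forall x, W x -> ~ cut W x -> forall eps, 0 < eps -> \forall h \near (0 : R)^',
    \sum_i (del (x + h *: e_ i) + del (x - h *: e_ i) - 2 * del x) <=
    h ^+ 2 * (- f x + eps)) ->
  (\int[mu]_(x in W) (f x * phi x)%:E <=
   \int[mu]_(x in W) (dotv (gradient del x) (gradient phi x))%:E)%E.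
Proof.
move=> Hf; have mZ := measurable_cut openW W0; have Z0 := lebesgue_cut openW W0.
(* Translation invariance lives on the whole space and the pointwise limits off the cut; both
   integrands vanish outside [W], so the domain can be exchanged. *)
have toT (q : 'rV[R]_d -> R) : (forall x, ~ W x -> q x = 0) ->
    (\int[mu]_(x in W) (q x)%:E = \int[mu]_(x in setT `\` cut W) (q x)%:E)%E.
  move=> q0; rewrite integral_mkcond -(integral_setD_negligible _ _ mZ Z0).
  apply: eq_integral => x _; rewrite patchE; case: ifPn => // /negP xW.
  by rewrite q0// => /mem_set.
rewrite !toT; first last.
- move=> x /phi_out px; rewrite /dotv big1// => i _.
  by rewrite [gradient phi x _ _]mxE (partial0 i px) mulr0.
- by move=> x /phi_out ->; rewrite mulr0.
have mD : measurable (setT `\` cut W) by exact: measurableD.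
have [g ig Gg] := G_bound; have [C FC] := F_bound.
have iF k : mu.-integrable setT (EFin \o (fun x => \sum_i F k i x)).
  rewrite (_ : _ \o _ = fun x => \sum_i (F k i x)%:E)%E; last first.
    by apply/funext => x; rewrite /= sumEFin.
  by apply: integrable_sum => // i _; case: (GF k i).
have iG k : mu.-integrable setT (EFin \o (fun x => \sum_i G k i x)).
  rewrite (_ : _ \o _ = fun x => \sum_i (G k i x)%:E)%E; last first.
    by apply/funext => x; rewrite /= sumEFin.
  by apply: integrable_sum => // i _; case: (GF k i).
have iphi : mu.-integrable setT (EFin \o (fun x => C * phi x)).
  have [M M0 suppM] := phi_support.
  rewrite (_ : _ \o _ = fun x => C%:E * (phi x)%:E)%E; last exact/funext.
  by apply: integrableZl => //; exact: continuous_support_integrable suppM.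
have sub (q : 'rV[R]_d -> \bar R) : mu.-integrable setT q ->
    mu.-integrable (setT `\` cut W) q.
  by apply: integrableS.
apply: (@le_integral_fatou _ _ _ _ _ (fun k x => \sum_i F k i x) (fun k x => \sum_i G k i x)
  _ _ (fun x => C * phi x) g) => //; try by [move=> *; exact: sub].
- move=> k; apply: measurable_funTS; apply/measurable_EFinP.
  exact: measurable_int (iG k).
- by move=> x [_ cx]; exact: G_cvg.
- move=> k; rewrite -!(integral_setD_negligible _ _ mZ Z0).
  under eq_integral do rewrite -sumEFin.
  under [RHS]eq_integral do rewrite -sumEFin.
  rewrite !integral_sum//; try by move=> i; case: (GF k i).
  by apply: eq_bigr => i _; case: (GF k i).
move=> x [_ cx] e e0; have [px|px] := eqVneq (phi x) 0.
  apply: nearW => k; rewrite px mulr0 sub0r; apply: (@le_trans _ _ 0).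
    by rewrite oppr_le0 ltW.
  by rewrite sumr_ge0// => i _; rewrite /F px mul0r oppr0.
have p0 : 0 < phi x by rewrite lt_neqAle eq_sym px phi_ge0.
have Wx : W x by apply: contrapT => /phi_out /eqP; exact/negP.
(* The error is multiplied by [phi x] afterwards. *)
have := near_inv_nat (Hf x Wx cx (e / phi x) (divr_gt0 e0 p0)).
apply: filterS => k Hk.
have -> : \sum_i F k i x = - (phi x * (k.+1%:R ^+ 2 *
    \sum_i (del (x + k.+1%:R^-1 *: e_ i) + del (x - k.+1%:R^-1 *: e_ i) - 2 * del x))).
  rewrite !mulr_sumr -sumrN; apply: eq_bigr => i _.
  by rewrite /F; ring.
move: Hk; rewrite exprVn ler_pdivlMl ?exprn_gt0//.
set S := _ * \sum_i _ => HS.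
have : phi x * S <= phi x * (- f x + e / phi x) by rewrite ler_pM2l.
rewrite mulrDr [phi x * (e / _)]mulrC divfK//; lra.
Qed.

End weak_laplacian.

Theorem theorem1p6 (R : realType) (n : nat) (Omega : set 'rV[R]_n.+1)
    (N : 'rV[R]_n.+1 -> 'rV[R]_n.+1) :
  (1 <= n)%N ->
  open Omega -> connected Omega ->
  boundary Omega !=set0 -> C2_boundary Omega ->
  (forall x, good_set Omega x -> nearest_point Omega x (N x)) ->
  forall phi : 'rV[R]_n.+1 -> R,
    test_function Omega phi -> (forall x, 0 <= phi x) ->
    (\int[lebesgue_row n.+1]_(x in Omega)
        (dotv (gradient (dist_compl Omega) x) (gradient phi x))%:E >=
     \int[lebesgue_row n.+1]_(x in Omega)
        (n%:R * mean_curvature Omega (N x) /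
         (n%:R - dist_compl Omega x * mean_curvature Omega (N x)) * phi x)%:E)%E.
Proof.
move=> n1 oW _ [y0 [_ y0W]] C2W HN phi phi_test phi0.
have W0 : ~` Omega !=set0.
  by exists y0 => Wy0; apply: y0W; exact: open_nbhs_nbhs.
apply: (weak_laplacian_ge oW W0 phi_test phi0) => x Wx cx eps eps0.
have [r r0 xr] := not_cut Wx cx.
have [y fy] := foot_exists oW W0 x.
have [Wy xy] := fy.
have yB : boundary Omega y by have [] := (nearest_pointP oW W0 y Wx).2 fy.
have clWy : closure Omega y by case: yB.
have [Q [f [chart HE]]] := mean_curvature_trace C2W yB.
have [U [rho [oU rho0 C2f rhoU rhoW]]] := chart_radius chart.
(* [N] is constrained on the good set only; off the cut [x] belongs to it, so [N x] is the foot
   [y]. *)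
have gx := good_set_extendable oW Wy clWy chart oU rho0 C2f rhoU rhoW Wx fy r0 xr.
have fN := (nearest_pointP oW W0 (N x) Wx).1 (HN x gx).
have NE : N x = y by exact: (extendable_unique oW W0 Wx r0 xr fN fy).
have := second_difference_le oW Wy clWy chart oU rho0 C2f rhoU rhoW n1 Wx fy r0 xr eps0.
by rewrite NE HE.
Qed.
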